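(* Let $\mathbb{G}$ be a $k$-step Carnot group, let $S\subset\mathbb{G}$ be a compact hypersurface of class $C^2$, and let $\varphi\in C^1(S)$. Then $$\int_S\psi(x)\,|\mathrm{grad}_{HS}\varphi(x)|\,\sigma_H^{n-1}(x)=\int_{\mathbb{R}}ds\int_{\varphi^{-1}[s]\cap S}\psi(y)\,\sigma_H^{n-2}(y)$$ for every $\psi\in L^1(S,\sigma_H^{n-1})$.
   Context: A $k$-step Carnot group $\mathbb{G}$ is an $n$-dimensional connected, simply connected, nilpotent Lie group whose Lie algebra satisfies $\mathfrak{g}=H_1\oplus\dots\oplus H_k$, $[H_1,H_{i-1}]=H_i$ for $2\le i\le k$, $[H_1,H_k]=0$. $H:=H_1$ is regarded as a left-invariant subbundle of $T\mathbb{G}$. $\mathfrak{g}$ carries a left-invariant Riemannian metric for which the layers $H_i$ are mutually orthogonal; $P_E$ denotes orthogonal projection onto a subbundle $E$, and $\sigma_R^m$ is $m$-dimensional Riemannian measure. $\nu$ is the Riemannian unit normal of $S$; the $H$-perimeter measure is $\sigma_H^{n-1}=|P_H\nu|\,\sigma_R^{n-1}$ on $S$. $H_xS=H_x\cap T_xS$, and $\mathrm{grad}_{HS}\varphi=P_{HS}(\mathrm{grad}_{TS}\varphi)$, where $\mathrm{grad}_{TS}\varphi$ is the Riemannian gradient of $\varphi$ on $S$. On an $(n-2)$-dimensional submanifold $N$ with unit normal 2-vector $\nu_1\wedge\nu_2$, $\sigma_H^{n-2}=|P_H\nu_1\wedge P_H\nu_2|\,\sigma_R^{n-2}$. On the level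 sets $\varphi^{-1}[s]\cap S$ this reads $\sigma_H^{n-2}=|P_H\nu|\,|P_{HS}\eta|\,\sigma_R^{n-2}$ with $\eta=\mathrm{grad}_{TS}\varphi/|\mathrm{grad}_{TS}\varphi|$ (defined where $\mathrm{grad}_{TS}\varphi\neq0$, hence $\sigma_R^{n-2}$-a.e. on $\varphi^{-1}[s]$ for a.e. $s$). *)

(* Defs.v *)
From HB Require Import structures.
From mathcomp Require Import all_boot all_order all_algebra.
From mathcomp Require Import all_classical all_reals all_analysis.
Set Implicit Arguments.
Unset Strict Implicit.
Unset Printing Implicit Defensive.
Import Order.TTheory GRing.Theory Num.Theory.
Import numFieldNormedType.Exports.
Local Open Scope classical_set_scope.
Local Open Scope ring_scope.

Lemma sigma_finite_product d1 d2 (T1 : measurableType d1)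
    (T2 : measurableType d2) (R : realType)
    (m1 : {sigma_finite_measure set T1 -> \bar R})
    (m2 : {sigma_finite_measure set T2 -> \bar R}) :
  sigma_finite setT (m1 \x m2)%E.
Proof.
have /sigma_finiteP[F [TF ndF Foo]] := sigma_finiteT m1.
have /sigma_finiteP[G [TG ndG Goo]] := sigma_finiteT m2.
exists (fun n => F n `*` G n).
  rewrite -setXTT TF TG predeqE => -[x y]; split.
    move=> [/= [n _ Fnx] [k _ Gky]]; exists (maxn n k) => //; split.
    - by move: x Fnx; exact/subsetPset/ndF/leq_maxl.
    - by move: y Gky; exact/subsetPset/ndG/leq_maxr.
  by move=> [n _ []/= ? ?]; split; exists n.
move=> k; have [? ?] := Foo k; have [? ?] := Goo k.
split; first exact: measurableX.
by rewrite product_measure1E// lte_mul_pinfty// ge0_fin_numE.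
Qed.

Section cons_measure.
Context d (T : measurableType d) (R : realType) (m : nat).
Variable mu : {sigma_finite_measure set T -> \bar R}.
Variable mum : {sigma_finite_measure set (m.-tuple T) -> \bar R}.

Definition cons_tup (p : T * m.-tuple T) : m.+1.-tuple T := [tuple of p.1 :: p.2].

Definition cons_measure : set (m.+1.-tuple T) -> \bar R :=
  pushforward (mu \x mum)%E cons_tup.

Let mcons : measurable_fun setT cons_tup.
Proof. by apply: measurable_cons; [exact: measurable_fst|exact: measurable_snd]. Qed.

Let cons0 : cons_measure set0 = 0%E.
Proof. by rewrite /cons_measure /pushforward preimage_set0 measure0. Qed.

Let cons_ge0 A : (0 <= cons_measure A)%E.
Proof. exact: measure_ge0. Qed.

Let cons_add : semi_sigma_additive cons_measure.
Proof.
move=> F mF tF mUF; rewrite /cons_measure /pushforward preimage_bigcup.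
apply: measure_semi_sigma_additive.
- by move=> n; rewrite -[X in measurable X]setTI; exact: mcons.
- apply/trivIsetP => /= i j _ _ ij; rewrite -preimage_setI.
  by move/trivIsetP : tF => /(_ _ _ _ _ ij) ->//; rewrite preimage_set0.
- by rewrite -preimage_bigcup -[X in measurable X]setTI; exact: mcons.
Qed.

HB.instance Definition _ := isMeasure.Build _ _ _ cons_measure cons0 cons_ge0 cons_add.

Let cons_sigma_finite : sigma_finite setT cons_measure.
Proof.
have [F FT Foo] := sigma_finite_product mu mum.
pose g (t : m.+1.-tuple T) : T * m.-tuple T := (thead t, [tuple of behead t]).
have gK : cancel cons_tup g.
  by move=> [x t]; rewrite /g /cons_tup /=; congr (_, _); exact/val_inj.
have Kg : cancel g cons_tup by move=> t; rewrite /g /cons_tup/= -tuple_eta.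
have mg : measurable_fun setT g.
  by apply/measurable_fun_pairP; split => /=;
    [exact: measurable_tnth|exact: measurable_behead].
exists (fun i => g @^-1` F i).
  by rewrite -preimage_bigcup -FT preimage_setT.
move=> i; have [mFi Fioo] := Foo i; split.
  by rewrite -[X in measurable X]setTI; exact: mg.
rewrite /cons_measure /pushforward (_ : _ @^-1` _ = F i)//.
by apply/seteqP; split => p /=; rewrite gK.
Qed.

HB.instance Definition _ :=
  Measure_isSigmaFinite.Build _ _ _ cons_measure cons_sigma_finite.
End cons_measure.

(* Lebesgue measure on R^m, as the m-fold product of the one on R (a Dirac
   mass when m = 0). *)
Fixpoint lebesgue_tuple (R : realType) m :
    {sigma_finite_measure set (m.-tuple (measurableTypeR R)) -> \bar R} :=
  match m with
  | 0 => \d_([tuple] : 0.-tuple (measurableTypeR R))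
  | m'.+1 => cons_measure (@lebesgue_measure R) (lebesgue_tuple R m')
  end.


Definition row_of_tuple (R : realType) m (t : m.-tuple R) : 'rV[R]_m :=
  \row_i tnth t i.

(* [Cr r U f]: f is of class C^r on the open set U. *)
Fixpoint Cr (R : realType) (V W : normedModType R) (r : nat) (U : set V)
    (f : V -> W) : Prop :=
  match r with
  | 0 => forall x, U x -> {for x, continuous f}
  | r'.+1 => (forall x, U x -> differentiable f x) /\
             forall v, Cr r' U (fun x => 'd f x v)
  end.

Definition smooth (R : realType) (V W : normedModType R) (U : set V)
  (f : V -> W) := forall r, Cr r U f.

#[short(type="topGroupType")]
HB.structure Definition TopGroup := {G of Group G & PointedTopological G}.

Record chart (R : realType) (n : nat) (M : topologicalType) := Chart {
  chart_fun :> M -> 'rV[R]_n;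
  chart_dom : set M;
  chart_inv : 'rV[R]_n -> M }.

Definition chart_cod (R : realType) n (M : topologicalType)
  (c : chart R n M) : set 'rV[R]_n := c @` chart_dom c.

Definition is_chart (R : realType) n (M : topologicalType) (c : chart R n M) :=
  [/\ open (chart_dom c), open (chart_cod c),
      {within chart_dom c, continuous c},
      {within chart_cod c, continuous (chart_inv c)} &
      {in chart_dom c, cancel c (chart_inv c)}].

Section group_scope_records.
Local Open Scope group_scope.

(* [unit_chart] is a fixed chart around the unit; it identifies the Lie algebra
   (the tangent space at the unit) with R^n. *)
Record lieGroup (R : realType) (n : nat) := LieGroup {
  lie_sort :> topGroupType;
  lie_hausdorff : hausdorff_space lie_sort;
  lie_second_countable : @second_countable lie_sort;
  lie_atlas : set (chart R n lie_sort);
  lie_atlas_chart : forall c, lie_atlas c -> is_chart c;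
  lie_atlas_cover : forall x, exists2 c, lie_atlas c & chart_dom c x;
  lie_atlas_smooth : forall c d, lie_atlas c -> lie_atlas d ->
    smooth (c @` (chart_dom c `&` chart_dom d)) (d \o chart_inv c);
  lie_mul_continuous :
    continuous (fun p : lie_sort * lie_sort => p.1 * p.2);
  lie_inv_continuous : continuous (fun x : lie_sort => x^-1);
  lie_mul_smooth : forall b c d, lie_atlas b -> lie_atlas c -> lie_atlas d ->
    smooth [set u : 'rV[R]_n * 'rV[R]_n | [/\ chart_cod b u.1, chart_cod c u.2 &
                     chart_dom d (chart_inv b u.1 * chart_inv c u.2)]]
           (fun u => d (chart_inv b u.1 * chart_inv c u.2));
  lie_inv_smooth : forall c d, lie_atlas c -> lie_atlas d ->
    smooth [set u | chart_cod c u /\ chart_dom d (chart_inv c u)^-1]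
           (fun u => d (chart_inv c u)^-1);
  unit_chart : chart R n lie_sort;
  unit_chart_atlas : lie_atlas unit_chart;
  unit_chart_dom : chart_dom unit_chart 1 }.

End group_scope_records.

Section lie_group.
Context (R : realType) (n : nat) (G : lieGroup R n).
Local Notation g := 'rV[R]_n.
Local Notation e := (unit_chart G).

(* [left_field v] is the left-invariant vector field generated by v, read in
   the chart [unit_chart]. *)
Definition left_field (v : g) (q : g) : g :=
  'd (fun w : g => e (chart_inv e q * chart_inv e w)%g) (e 1%g) v.

Definition lie_bracket (v w : g) : g :=
  'd (left_field w) (e 1%g) v - 'd (left_field v) (e 1%g) w.

Definition lie_bracket_space (U V : {vspace g}) : {vspace g} :=
  <<[seq lie_bracket u v | u <- vbasis U, v <- vbasis V]>>%VS.

Fixpoint lower_central (i : nat) : {vspace g} :=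
  match i with
  | 0 => fullv
  | i'.+1 => lie_bracket_space fullv (lower_central i')
  end.

Definition nilpotent_lie := exists i, lower_central i = 0%VS.

Definition simply_connected := forall c : R -> G,
  {within `[0, 1], continuous c} -> c 0 = c 1 ->
  exists h : R * R -> G, {within `[0, 1] `*` `[0, 1], continuous h} /\
    forall t, `[0, 1]%classic t ->
      [/\ h (0, t) = c t, h (1, t) = c 0, h (t, 0) = c 0 & h (t, 1) = c 0].

Definition CrG (V : normedModType R) (r : nat) (U : set V) (f : V -> G) :=
  (forall u, U u -> {for u, continuous f}) /\
  forall c, lie_atlas c -> Cr r (U `&` f @^-1` chart_dom c) (c \o f).

(* Differential of f at u followed by the left translation of the tangent space
   at f u to the Lie algebra. All tangent vectors are represented in this way:
   a left-invariant subbundle of TG is then a fixed subspace of the Lie algebra,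
   and a left-invariant metric is a fixed inner product on it. *)
Definition left_diff (V : normedModType R) (f : V -> G) (u : V) : V -> g :=
  'd (fun w => e ((f u)^-1 * f w)%g) u.

End lie_group.

Record carnotGroup (R : realType) (n k : nat) := CarnotGroup {
  carnot_lie :> lieGroup R n;
  carnot_connected : connected [set: carnot_lie];
  carnot_simply_connected : simply_connected carnot_lie;
  carnot_nilpotent : nilpotent_lie carnot_lie;
  layer : nat -> {vspace 'rV[R]_n};
  layer_sum : (\sum_(i < k) layer i.+1)%VS = fullv;
  layer_direct : directv (\sum_(i < k) layer i.+1)%VS;
  layer_bracket : forall i, (2 <= i <= k)%N ->
    lie_bracket_space carnot_lie (layer 1) (layer i.-1) = layer i;
  layer_last : lie_bracket_space carnot_lie (layer 1) (layer k) = 0%VS;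
  metric : 'rV[R]_n -> 'rV[R]_n -> R;
  metric_sym : forall u v, metric u v = metric v u;
  metric_linear : forall a u v w,
    metric (a *: u + v) w = a * metric u w + metric v w;
  metric_pos : forall u, u != 0 -> 0 < metric u u;
  metric_layers : forall i j, (1 <= i <= k)%N -> (1 <= j <= k)%N -> i != j ->
    forall u v, u \in layer i -> v \in layer j -> metric u v = 0 }.

Section hypersurface.
Context (R : realType) (n k : nat) (G : carnotGroup R n k).
Local Notation g := 'rV[R]_n.

Definition metric_norm (v : g) : {nonneg R} := (Num.sqrt (metric G v v))%:nng.

Definition orth_proj (E : set g) (v : g) : g :=
  get [set w | E w /\ forall z, E z -> metric G (v - w) z = 0].

Definition horizontal : set g := [set v | v \in layer G 1].

(* U is the domain of a local parametrization P, of class C^r, of the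
   m-dimensional embedded submanifold N. *)
Definition local_param (r m : nat) (N : set G) (U : set 'rV[R]_m)
    (P : 'rV[R]_m -> G) :=
  [/\ open U, CrG r U P, forall u, U u -> injective (left_diff P u),
      exists2 O, open O & P @` U = N `&` O &
      exists Q : G -> 'rV[R]_m, {within P @` U, continuous Q} /\
                                {in U, cancel P Q}].

Definition submanifold (r m : nat) (N : set G) :=
  forall x, N x -> exists U P, @local_param r m N U P /\ (P @` U) x.

Definition jacobian m (P : 'rV[R]_m -> G) (u : 'rV[R]_m) : R :=
  Num.sqrt (\det (\matrix_(i, j) metric G (left_diff P u (delta_mx 0 i))
                                          (left_diff P u (delta_mx 0 j)))).

(* Riemannian measure of an m-dimensional embedded submanifold N, with density w:
   in a local parametrization P it is w (P u) * jacobian P u * du, where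
   jacobian P is the square root of the Gram determinant of the metric. The
   pieces of N lying in one parametrization are measured by [piece_area]; the
   measure [area] is the Caratheodory measure of the outer measure which they
   generate by countable Borel covers. It is complete and carried by N. *)
Definition piece_area m (N : set G) (w : G -> {nonneg R})
    (B : set (g_sigma_algebraType (@open G))) : \bar R :=
  ereal_inf [set a | exists U P V, [/\ @local_param 1 m N U P, V `<=` U,
    measurable (@row_of_tuple R m @^-1` V : set (m.-tuple (measurableTypeR R))),
    N `&` B `<=` P @` V &
    a = \int[lebesgue_tuple R m]_(t in @row_of_tuple R m @^-1` V)
          ((w (P (row_of_tuple t)))%:num * jacobian P (row_of_tuple t))%:E]]%E.

Lemma piece_area_ge0 m N w B : (0 <= piece_area m N w B)%E.
Proof.
apply: le_ereal_inf_tmp => _ [U [P [V [_ _ _ _ ->]]]].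
by apply: integral_ge0 => t _; rewrite lee_fin mulr_ge0// sqrtr_ge0.
Qed.

Lemma piece_area0 m N w : piece_area m N w set0 = 0%E.
Proof.
apply/eqP; rewrite eq_le piece_area_ge0 andbT; apply: ereal_inf_lbound.
exists set0, (fun=> point), set0; split => //.
- split => //.
  + split => // c _; rewrite set0I.
    by split => [x []|v x []].
  + by exists set0; [exact: open0|rewrite image_set0 setI0].
  + exists (fun=> point); split; last by move=> u; rewrite inE.
    by rewrite image_set0; exact: continuous_subspace0.
- by rewrite preimage_set0.
- by rewrite setI0.
- by rewrite preimage_set0 integral_set0.
Qed.

Definition area_ext m N w : set G -> \bar R :=
  mu_ext (piece_area m N w).

Let area_ext0 m N w : area_ext m N w set0 = 0%E.
Proof. exact: mu_ext0 (@piece_area0 m N w) (@piece_area_ge0 m N w). Qed.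

Let area_ext_ge0 m N w A : (0 <= area_ext m N w A)%E.
Proof. exact: mu_ext_ge0 (@piece_area_ge0 m N w) A. Qed.

Let le_area_ext m N w : {homo area_ext m N w : A B / A `<=` B >-> (A <= B)%E}.
Proof. exact: (le_mu_ext (piece_area m N w)). Qed.

Let area_ext_sub m N w : sigma_subadditive (area_ext m N w).
Proof. exact: mu_ext_sigma_subadditive (@piece_area_ge0 m N w). Qed.

HB.instance Definition _ m N w := isOuterMeasure.Build R G (area_ext m N w)
  (@area_ext0 m N w) (@area_ext_ge0 m N w) (@le_area_ext m N w)
  (@area_ext_sub m N w).

Definition area_outer m N w : {outer_measure set G -> \bar R} :=
  area_ext m N w.

Definition area m N w :
    {measure set (caratheodory_type (area_outer m N w)) -> \bar R} :=
  (area_outer m N w : set (caratheodory_type (area_outer m N w)) -> \bar R).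
Arguments area : clear implicits.

Definition curve_at (S : set G) (x : G) (c : R -> G) :=
  c 0 = x /\ exists2 eps : R, 0 < eps &
    CrG 1 (`]- eps, eps[ : set R^o) (c : R^o -> G) /\
    forall t, `]- eps, eps[%classic t -> S (c t).

Definition velocity (c : R -> G) : g := left_diff (c : R^o -> G) 0 1.

Definition tangent (S : set G) (x : G) : set g :=
  [set velocity c | c in curve_at S x].

Definition hor_tangent (S : set G) (x : G) : set g :=
  horizontal `&` tangent S x.

(* The sign of the normal is irrelevant below. *)
Definition normal (S : set G) (x : G) : g :=
  get [set v | metric G v v = 1 /\ forall w, tangent S x w -> metric G v w = 0].

Definition C1_on (S : set G) (phi : G -> R) :=
  forall U P, @local_param 2 n.-1 S U P -> Cr 1 U (phi \o P : _ -> R^o).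

Definition grad_T (S : set G) (phi : G -> R) (x : G) : g :=
  get [set v | tangent S x v /\ forall c, curve_at S x c ->
                 metric G v (velocity c) = derive1 (phi \o c : R^o -> R^o) 0].

Definition grad_H (S : set G) (phi : G -> R) (x : G) : g :=
  orth_proj (hor_tangent S x) (grad_T S phi x).

Definition perimeter_measure (S : set G) :=
  area n.-1 S (fun x => metric_norm (orth_proj horizontal (normal S x))).

Definition unit_grad (S : set G) (phi : G -> R) (x : G) : g :=
  (metric_norm (grad_T S phi x))%:num^-1 *: grad_T S phi x.

(* The part of the level set where [unit_grad] is defined; it is an embedded
   C^1 submanifold of dimension n - 2. The rest of the level set, on which the
   density of the measure is undefined, is not charged by [level_measure]. *)
Definition regular_level (S : set G) (phi : G -> R) (s : R) : set G :=
  [set x | [/\ S x, phi x = s & grad_T S phi x != 0]].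

Definition level_measure (S : set G) (phi : G -> R) (s : R) :=
  area n.-2 (regular_level S phi s)
    (fun x => ((metric_norm (orth_proj horizontal (normal S x)))%:num *
               (metric_norm (orth_proj (hor_tangent S x) (unit_grad S phi x)))%:num)%:nng).

End hypersurface.

(* Main.v *)
(** Left translations identify every tangent space with the Lie algebra, so in a
    local parametrization P the Riemannian measure with density w is integration
    of w (P u) * jac P (u) du, jac P being the square root of the Gram determinant
    of the left-translated differential of P; by the change of variables formula
    for C^1 diffeomorphisms of R^m this does not depend on P.

    Near a point of S where grad_T phi <> 0, the inverse function theorem yields a
    parametrization P of S with phi (P (s, t)) = s, whose slices P (s, .)
    parametrize the regular level sets.  The gradient of phi satisfies
    |grad_T phi|^2 = (Gram^-1)_00, a quotient of Gram determinants by Cramer's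
    rule, hence jac (P (s, .)) = |grad_T phi| jac P.  As
    |P_H nu| |P_HS eta| |grad_T phi| = |P_H nu| |grad_HS phi|, Tonelli's theorem in
    the coordinates (s, t) is the coarea formula on the part of S covered by P.
    Countably many such P cover the regular points, and the other points
    contribute to neither side.

    An integrable psi agrees with a Borel function off a Borel null set Z; the
    formula for the indicator of Z shows that Z is null for almost every level
    measure, so that psi may be replaced on both sides. *)
From HB Require Import structures.
Require Import Defs.
From mathcomp Require Import all_boot all_order all_algebra.
From mathcomp Require Import all_classical all_reals all_analysis.
From mathcomp Require Import perm measurable_realfun ring lra.
Set Implicit Arguments.
Unset Strict Implicit.
Unset Printing Implicit Defensive.
Import Order.TTheory GRing.Theory Num.Theory.
Import numFieldNormedType.Exports.
Local Open Scope classical_set_scope.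
Local Open Scope ring_scope.

(** The inverse of a parametrization is only assumed continuous. Transition maps are nevertheless
    C^1, because a continuous solution [u] of [p \o u = c], with [p] a C^1 immersion and [c] of
    class C^1, is itself C^1.

    Two obstacles come from the horizontal geometry. The normal is an arbitrary pointwise choice, so
    it need not vary continuously; the quantities involved are even in it and are rewritten through
    the projection on the tangent space. At characteristic points, where the horizontal part of the
    normal vanishes, the horizontal tangent space changes dimension and grad_HS phi may jump. Only
    the product |P_H nu| |grad_HS phi| is continuous on S, and the formula is proved with this
    product divided by |P_H nu| off the characteristic set.

    For signed psi the formulas for the positive and negative parts have to be subtracted. This is
    possible because |grad_HS phi| is bounded on the compact S, which makes both level integrals
    integrable in s. *)

Notation borel T := (g_sigma_algebraType (@open T)).

(** * Borel sets and integrals with densities *)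

Section borel_measurability.
Context (X Y : ptopologicalType) (R : realType).

Lemma open_borel (A : set X) : open A -> measurable (A : set (borel X)).
Proof. by move=> oA; exact: sub_sigma_algebra. Qed.

Lemma closed_borel (A : set X) : closed A -> measurable (A : set (borel X)).
Proof.
move=> cA; rewrite -[A]setCK; apply: (@measurableC _ (borel X)).
by apply: open_borel; rewrite openC.
Qed.

Lemma within_continuous_borel (D : set X) (f : X -> Y) :
  measurable (D : set (borel X)) -> {within D, continuous f} ->
  measurable_fun (D : set (borel X)) (f : borel X -> borel Y).
Proof.
move=> mD /continuousP cf; apply: (@measurability _ _ (borel X) (borel Y) D f (@open Y)) => // _ [B oB <-].
have /open_subspaceP[V oV VD] := cf _ oB.
by rewrite setIC -VD setIC; apply: measurableI => //; exact: open_borel.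
Qed.

Lemma within_continuous_borelR (D : set X) (f : X -> R) :
  measurable (D : set (borel X)) -> {within D, continuous f} ->
  measurable_fun (D : set (borel X)) (f : borel X -> measurableTypeR R).
Proof.
move=> mD /continuousP cf; apply: (@measurability _ _ (borel X) (measurableTypeR R) D f _ (measurable_realfun.RGenOpens.measurableE R)) => //.
move=> _ [_ [a [b ->]] <-].
have /open_subspaceP[V oV VD] := cf _ (@interval_open _ (BRight a) (BLeft b) isT isT).
rewrite setIC -VD setIC; apply: measurableI => //; exact: open_borel.
Qed.

Lemma within_continuous (Z : topologicalType) (D : set X) (f : X -> Z) :
  (forall x, D x -> {for x, continuous f}) -> {within D, continuous f}.
Proof. by move=> cf; apply: continuous_in_subspaceT => x /[!inE]; exact: cf. Qed.

End borel_measurability.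

(* Lindelof, for a property of open sets holding around every point. *)
Lemma second_countable_cover (X : topologicalType) (S : set X)
    (Pr : set X -> Prop) :
  @second_countable X -> Pr set0 ->
  (forall x, S x -> exists O, [/\ open O, O x & Pr O]) ->
  exists O : nat -> set X, [/\ forall i, open (O i), forall i, Pr (O i) &
    S `<=` \bigcup_i O i].
Proof.
move=> [B cB [Bo BB]] P0 PS.
pose Q b O := [/\ open O, b `<=` O & Pr O].
(* For each basic set [b] one good open set containing it is chosen when there is one, so the
   countable basis indexes the cover; the default [set0] is good by [Pr set0]. *)
pose F (b : set X) := if pselect (exists O, Q b O) is left e
  then projT1 (cid e) else set0.
have FE (b : set X) : open (F b) /\ Pr (F b).
  rewrite /F; case: pselect => [e|_]; last by split => //; exact: open0.
  by case: (cid e) => O [].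
have bF (b O : set X) : Q b O -> b `<=` F b.
  move=> q; rewrite /F; case: pselect => [e|[]]; last by exists O.
  by case: (cid e) => O' [].
case: (pfcard_geP cB) => [B0|[f]].
  exists (fun=> set0); split => // [i|x Sx]; first exact: open0.
  have [V [oO Ox _]] := PS _ Sx.
  have [|U [BU _] _] := BB x V; first exact: open_nbhs_nbhs.
  by move: BU; rewrite B0.
exists (fun i => F (f i)); split => [i|i|x Sx]; [exact: (FE _).1|exact: (FE _).2|].
have [V [oO Ox PO]] := PS _ Sx.
have [|U [BU Ux] UO] := BB x V; first exact: open_nbhs_nbhs.
have [i _ fi] := @surj _ _ _ _ f _ BU.
by exists i => //; rewrite fi; apply: (bF U V).
Qed.

Section integral_density.
Local Open Scope ereal_scope.
Context d1 d2 (T1 : measurableType d1) (T2 : measurableType d2) (R : realType).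
Context (mu : {measure set T1 -> \bar R}) (nu : {measure set T2 -> \bar R}).
Context (D : set T2) (f : T2 -> T1) (rho : T2 -> R).
Hypothesis mD : measurable D.
Hypothesis mf : measurable_fun D f.
Hypothesis mrho : measurable_fun D rho.
Hypothesis rho0 : forall x, D x -> (0 <= rho x)%R.
Hypothesis muE : forall B, measurable B ->
  mu B = \int[nu]_(x in D `&` f @^-1` B) (rho x)%:E.

Import HBNNSimple.

Let integral_density_nnsfun (h : {nnsfun T1 >-> R}) :
  \int[mu]_y (h y)%:E = \int[nu]_(x in D) ((h (f x))%:E * (rho x)%:E).
Proof.
rewrite integralT_nnsfun sintegralE.
under [RHS]eq_integral => x _.
  rewrite [h _]fimfunE -fsumEFin// ge0_mule_fsuml; last first.
    by move=> r; rewrite lee_fin; exact: nnfun_muleindic_ge0.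
  over.
rewrite ge0_integral_fsum//; last 2 first.
- move=> r; apply: emeasurable_funM => //; apply/measurable_EFinP => //.
  apply: measurable_funM => //.
  by apply: (measurable_comp (F := setT)).
- move=> r x Dx; rewrite mule_ge0//; last exact: rho0.
  by rewrite lee_fin; exact: nnfun_muleindic_ge0.
apply: eq_fsbigr => r /[!inE] -[y _ <-].
have mh : measurable (h @^-1` [set h y]) by exact: measurable_sfunP.
have mDh : measurable (D `&` f @^-1` (h @^-1` [set h y])) by exact: mf.
rewrite muE//.
under [RHS]eq_integral do rewrite EFinM -muleA.
rewrite ge0_integralZl_EFin//; last 2 first.
- by move=> x Dx; rewrite mule_ge0// ?lee_fin//; exact: rho0.
- apply: emeasurable_funM => //; apply/measurable_EFinP => //.
  by apply: (measurable_comp (F := setT)) => //; exact: measurable_indic.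
congr (_ * _).
rewrite integral_mkcondr; apply: eq_integral => x _.
rewrite patchE indicE; case: ifPn; first by rewrite inE/= => h1; rewrite mem_set// mul1e.
by rewrite notin_setE/= => h1; rewrite memNset// mul0e.
Qed.

(** [muE] is the case of indicators; simple functions follow by linearity, the general case by
    monotone convergence. It underlies integration in a parametrization, where [nu] is Lebesgue
    measure and [rho] the area density. *)
Lemma ge0_integral_density (g : T1 -> \bar R) :
  measurable_fun setT g -> (forall y, 0 <= g y) ->
  \int[mu]_y g y = \int[nu]_(x in D) (g (f x) * (rho x)%:E).
Proof.
move=> mg g0; pose h := nnsfun_approx measurableT mg.
have hg y : (h n y)%:E @[n --> \oo] --> g y.
  by apply: cvg_nnsfun_approx.
have ndh y : {homo (fun n => (h n y)%:E) : n m / (n <= m)%N >-> n <= m}.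
  by move=> n m nm; rewrite lee_fin; exact/lefP/nd_nnsfun_approx.
transitivity (limn (fun n => \int[mu]_y (h n y)%:E)).
  rewrite -monotone_convergence//.
  - by apply: eq_integral => y _; apply/esym/cvg_lim => //; exact: hg.
  - by move=> n; apply/measurable_EFinP.
  - by move=> n y _; rewrite lee_fin.
under eq_fun do rewrite integral_density_nnsfun.
rewrite -monotone_convergence//.
- apply: eq_integral => x /[!inE] Dx; apply/cvg_lim => //.
  by apply: cvgeZr => //; exact: hg.
- move=> n; apply: emeasurable_funM => //; apply/measurable_EFinP => //.
  by apply: (measurable_comp (F := setT)).
- by move=> n x Dx; rewrite mule_ge0// ?lee_fin//; exact: rho0.
- by move=> x Dx n m nm; rewrite lee_wpmul2r//; [exact: rho0|exact: ndh].
Qed.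

End integral_density.

(** * Calculus in R^m *)

Section matrix_limits.
Context (R : realType) (T : Type) (F : set_system T) {FF : Filter F}.

Lemma filter_finType (I : finType) (P : I -> T -> Prop) :
  (forall i, \forall x \near F, P i x) -> \forall x \near F, forall i, P i x.
Proof.
move=> FP.
have : \forall x \near F, forall i, i \in enum I -> P i x.
  elim: (enum I) => [|i s IH]; first exact: filterE.
  near=> x => j; rewrite inE => /predU1P[->|]; first by near: x; exact: FP.
  by move: j; near: x.
by apply: filterS => x Px i; apply: Px; rewrite mem_enum.
Unshelve. all: by end_near. Qed.

Lemma cvg_sumR (I : Type) (V : normedModType R) (r : seq I) (P : pred I)
    (f : I -> T -> V) (l : I -> V) :
  (forall i, P i -> f i x @[x --> F] --> l i) ->
  (\sum_(i <- r | P i) f i x) @[x --> F] --> \sum_(i <- r | P i) l i.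
Proof. by move=> fl; apply: cvg_big => //; exact: add_continuous. Qed.

Lemma cvg_prodR (I : Type) (r : seq I) (P : pred I) (f : I -> T -> R) (l : I -> R) :
  (forall i, P i -> f i x @[x --> F] --> l i) ->
  (\prod_(i <- r | P i) f i x) @[x --> F] --> \prod_(i <- r | P i) l i.
Proof. by move=> fl; apply: cvg_big => //; exact: mul_continuous. Qed.

Lemma cvg_mxP m n (A : T -> 'M[R]_(m, n)) (L : 'M[R]_(m, n)) :
  A x @[x --> F] --> L <-> forall i j, A x i j @[x --> F] --> L i j.
Proof.
split=> [AL i j|AL].
  exact: (continuous_cvg _ (@coord_continuous R m n i j L) AL).
apply/cvg_mx_entourageP => E entE.
have H (ij : 'I_m * 'I_n) :
    \forall x \near F, (L ij.1 ij.2, A x ij.1 ij.2) \in E.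
  have /cvg_app_entourageP/(_ _ entE) := AL ij.1 ij.2.
  by apply: filterS => x; rewrite inE.
by have := filter_finType H; apply: filterS => x Ex i j; exact: (Ex (i, j)).
Qed.

Lemma cvg_mulmx m n p (A : T -> 'M[R]_(m, n)) (B : T -> 'M[R]_(n, p))
    (L : 'M[R]_(m, n)) (M : 'M[R]_(n, p)) :
  A x @[x --> F] --> L -> B x @[x --> F] --> M ->
  (A x *m B x) @[x --> F] --> L *m M.
Proof.
move=> /cvg_mxP AL /cvg_mxP BM; apply/cvg_mxP => i j.
rewrite mxE; under eq_fun do rewrite mxE.
by apply: cvg_sumR => k _; apply: cvgM.
Qed.

Lemma cvg_trmx m n (A : T -> 'M[R]_(m, n)) (L : 'M[R]_(m, n)) :
  A x @[x --> F] --> L -> (A x)^T @[x --> F] --> L^T.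
Proof.
move=> /cvg_mxP AL; apply/cvg_mxP => i j.
by rewrite mxE; under eq_fun do rewrite mxE; exact: AL.
Qed.

Lemma cvg_det n (A : T -> 'M[R]_n) (L : 'M[R]_n) :
  A x @[x --> F] --> L -> \det (A x) @[x --> F] --> \det L.
Proof.
move=> /cvg_mxP AL; apply: cvg_sumR => s _; apply: cvgMl_tmp.
by apply: cvg_prodR => i _; exact: AL.
Qed.

Lemma cvg_adj n (A : T -> 'M[R]_n) (L : 'M[R]_n) :
  A x @[x --> F] --> L -> \adj (A x) @[x --> F] --> \adj L.
Proof.
move=> /cvg_mxP AL; apply/cvg_mxP => i j.
rewrite mxE; under eq_fun do rewrite mxE.
apply: cvgMl_tmp; apply: cvg_det; apply/cvg_mxP => k l.
by rewrite !mxE; under eq_fun do rewrite !mxE; exact: AL.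
Qed.

Lemma near_unitmx n (A : T -> 'M[R]_n) (L : 'M[R]_n) :
  A x @[x --> F] --> L -> L \in unitmx -> \forall x \near F, A x \in unitmx.
Proof.
move=> /cvg_det AL; rewrite unitmxE unitfE => L0.
have := @cvgr_neq0 _ R^o _ F FF (fun x => \det (A x)) (\det L) AL L0.
by apply: filterS => x; rewrite unitmxE unitfE.
Qed.

(** By the adjugate formula the inverse is a quotient of polynomials in the entries. [invmx] returns
    a singular matrix unchanged, so the formula is used only near the limit, where the matrices are
    invertible. *)
Lemma cvg_invmx n (A : T -> 'M[R]_n) (L : 'M[R]_n) :
  A x @[x --> F] --> L -> L \in unitmx -> invmx (A x) @[x --> F] --> invmx L.
Proof.
move=> AL uL.
have : (\det (A x))^-1 *: \adj (A x) @[x --> F] --> (\det L)^-1 *: \adj L.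
  apply: cvgZ; last exact: cvg_adj.
  by apply: cvgV; [move: uL; rewrite unitmxE unitfE|exact: cvg_det].
have -> : (\det L)^-1 *: \adj L = invmx L by rewrite /invmx uL.
apply: cvg_trans; apply: near_eq_cvg.
by have := near_unitmx AL uL; apply: filterS => x uA; rewrite /invmx uA.
Qed.

End matrix_limits.

Section differentials.
Context (R : realType).
Implicit Types V W : normedModType R.

Lemma diff_near_le V W (f : V -> W) x : differentiable f x ->
  forall e : R, 0 < e ->
  \forall y \near x, `|f y - f x - 'd f x (y - x)| <= e * `|y - x|.
Proof.
move=> /diff_locally/eqaddoP df e e0.
have := df _ e0; rewrite [in X in _ -> X]nbhs0P; apply: filterS => h /=.
by rewrite !fctE/= [h + x]addrC [x + h - x]addrAC subrr add0r opprD addrA.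
Qed.

Lemma near_le_diff V W (f : V -> W) x (L : {linear V -> W}) : continuous L ->
  (forall e : R, 0 < e ->
    \forall y \near x, `|f y - f x - L (y - x)| <= e * `|y - x|) ->
  differentiable f x /\ 'd f x = L :> (V -> W).
Proof.
move=> cL fL.
have H : f \o shift x = cst (f x) + L +o_ 0 id.
  apply/eqaddoP => e e0; have := fL _ e0; rewrite [in X in X -> _]nbhs0P.
  apply: filterS => h /=.
  by rewrite !fctE/= [h + x]addrC [x + h - x]addrAC subrr add0r opprD addrA.
have dL := diff_unique cL H.
by split => //; apply/diff_locallyP; rewrite dL.
Qed.

Lemma diff_near_eq V W (f g : V -> W) x : {near x, f =1 g} ->
  differentiable f x -> differentiable g x /\ 'd g x = 'd f x :> (V -> W).
Proof.
move=> fg df; apply: near_le_diff => [|e e0]; first exact: diff_continuous.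
have fgx := nbhs_singleton fg.
have := diff_near_le df e0; apply: filterS2 fg => y /= -> .
by rewrite fgx.
Qed.

End differentials.

Section row_linear.
Context (R : realType).
Implicit Types V W : normedModType R.

Lemma row_linE m (W : lmodType R) (f : {linear 'rV[R]_m -> W}) v :
  f v = \sum_j v 0 j *: f (delta_mx 0 j).
Proof. by rewrite [in LHS](row_sum_delta v) linear_sum; apply: eq_bigr => j _; rewrite linearZ. Qed.

Lemma row_lin_continuous m W (f : {linear 'rV[R]_m -> W}) : continuous f.
Proof.
move=> v; rewrite (_ : (f : _ -> _) = fun v => \sum_j v 0 j *: f (delta_mx 0 j)); last first.
  by apply/funext => w; exact: row_linE.
apply: (@cvg_sumR _ _ (nbhs v)) => j _; apply: cvgZr_tmp; exact: coord_continuous.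
Qed.

Lemma mulmxr_continuous m n (A : 'M[R]_(m, n)) : continuous (fun v : 'rV[R]_m => v *m A).
Proof. exact: (@row_lin_continuous _ _ (mulmxr A)). Qed.

Lemma diff_mulmxr m n (A : 'M[R]_(m, n)) (u : 'rV[R]_m) :
  differentiable (fun v : 'rV[R]_m => v *m A) u /\
  'd (fun v : 'rV[R]_m => v *m A) u = mulmx^~ A :> (_ -> _).
Proof.
have c := @mulmxr_continuous _ _ A.
split; first exact: (@linear_differentiable _ _ _ (mulmxr A)).
exact: (@diff_lin _ _ _ (mulmxr A)).
Qed.

Lemma mulJ m n (f : 'rV[R]_m -> 'rV[R]_n) u v : 'd f u v = v *m 'J f u.
Proof. by rewrite mul_rV_lin1. Qed.

Lemma rowJ m n (f : 'rV[R]_m -> 'rV[R]_n) u i : row i ('J f u) = 'd f u (delta_mx 0 i).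
Proof. by rewrite mulJ rowE. Qed.

Lemma JE m n (f : 'rV[R]_m -> 'rV[R]_n) u i j :
  'J f u i j = 'd f u (delta_mx 0 i) 0 j.
Proof. by rewrite -rowJ [RHS]mxE. Qed.

(** Differentiability half of the inverse function theorem, for [p] with a left inverse [K] of its
    differential. Applying [K] to the expansion of [p] at [u x0] expresses [u x - u x0] through
    [c x - c x0] up to [K (r x)]; continuity of [u] makes this remainder small relative to
    [u x - u x0] itself. *)
Lemma diff_lift (X : normedModType R) V W (p : V -> W) (u : X -> V) (c : X -> W) (x0 : X)
    (K : {linear W -> V}) :
  differentiable p (u x0) -> continuous K ->
  (forall v, K ('d p (u x0) v) = v) ->
  {for x0, continuous u} -> {near x0, p \o u =1 c} ->
  differentiable c x0 ->
  differentiable u x0 /\ 'd u x0 = K \o 'd c x0 :> (X -> V).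
Proof.
move=> dp cK KL cu puc dc.
have cc0 : p (u x0) = c x0 by exact: (nbhs_singleton puc).
have [M M0 KM] := linear_lipschitz cK.
have [N N0 dcN] := linear_lipschitz (diff_continuous dc).
pose r x := p (u x) - p (u x0) - 'd p (u x0) (u x - u x0).
have rE x : u x - u x0 = K (p (u x) - p (u x0)) - K (r x).
  by rewrite -linearB /r opprB addrCA subrr addr0 KL.
have rle (e : R) : 0 < e -> \forall x \near x0, `|r x| <= e * `|u x - u x0|.
  by move=> e0; have := cu _ (diff_near_le dp e0).
(* Lipschitz bound at [x0]: with the constant [(2 * M)^-1] for the remainder, [K (r x)] is at most
   half of [u x - u x0] in norm and is absorbed on the left; [N + 1] bounds the difference quotients
   of [c] near [x0]. *)
have step1 : \forall x \near x0, `|u x - u x0| <= 2 * M * (N + 1) * `|x - x0|.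
  have e0 : 0 < (2 * M)^-1 by rewrite invr_gt0 mulr_gt0.
  have := diff_near_le dc ltr01; apply: filterS3 (rle _ e0) puc => x rx /= pux.
  rewrite mul1r => cx.
  have c1 : `|c x - c x0| <= (N + 1) * `|x - x0|.
    rewrite mulrDl mul1r -[c x - c x0](subrK ('d c x0 (x - x0))) addrC.
    rewrite (le_trans (ler_normD _ _))// lerD//; exact: dcN.
  have h1 : `|u x - u x0| <= M * `|c x - c x0| + 2^-1 * `|u x - u x0|.
    rewrite {1}rE -pux cc0.
    rewrite (le_trans (ler_normB _ _))// lerD//.
    rewrite (le_trans (KM _))// -ler_pdivlMl// mulrA.
    by rewrite (le_trans rx)// invfM [_^-1 * M^-1]mulrC.
  have h2 : 2^-1 * `|u x - u x0| <= M * `|c x - c x0|.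
    by move: h1; set a := `|u x - _|; set b := M * _; lra.
  rewrite -!mulrA -ler_pdivrMl// (le_trans h2)// ler_pM2l//.
apply: near_le_diff => [x|e e0].
  by apply: continuous_comp; [exact: diff_continuous|exact: cK].
(* The error [e] is shared equally: half for the remainder of [c], half for [r], whose bound is
   converted from [u x - u x0] to [x - x0] by the constant of [step1]. The factor [M] is the cost of
   applying [K]. *)
have e1 : 0 < e / 2 / M by rewrite !divr_gt0.
have e2 : 0 < e / 2 / M / (2 * M * (N + 1)).
  by rewrite !divr_gt0// !mulr_gt0// addr_gt0.
near=> x => /=.
have rx : `|r x| <= e / 2 / M / (2 * M * (N + 1)) * `|u x - u x0|.
  by near: x; exact: rle.
have cx : `|c x - c x0 - 'd c x0 (x - x0)| <= e / 2 / M * `|x - x0|.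
  by near: x; exact: diff_near_le.
have pux : p (u x) = c x by near: x; exact: puc.
have s1 : `|u x - u x0| <= 2 * M * (N + 1) * `|x - x0| by near: x; exact: step1.
rewrite rE pux cc0 addrAC -linearB.
rewrite (le_trans (ler_normB _ _))//.
rewrite [e]splitr mulrDl lerD//.
  by rewrite (le_trans (KM _))// -ler_pdivlMl// mulrA [M^-1 * _]mulrC.
rewrite (le_trans (KM _))// -ler_pdivlMl// mulrA [M^-1 * _]mulrC (le_trans rx)//.
by rewrite -[leLHS]mulrA ler_pM2l// -ler_pdivlMl ?invrK ?invr_gt0 ?mulr_gt0 ?addr_gt0.
Unshelve. all: by end_near. Qed.

End row_linear.

Section C1_functions.
Context (R : realType).
Implicit Types X V W : normedModType R.

Lemma continuous_mxP (T : topologicalType) m n (A : T -> 'M[R]_(m, n)) x :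
  {for x, continuous A} <-> forall i j, {for x, continuous (fun y => A y i j)}.
Proof. exact: (@cvg_mxP R T (nbhs x) _). Qed.

Lemma Cr1_sub X W (U U' : set X) (f : X -> W) : U' `<=` U -> Cr 1 U f -> Cr 1 U' f.
Proof. by move=> sU [df cf]; split => [x /sU/df//|v x /sU]; exact: cf. Qed.

Lemma Cr1_continuous X W (U : set X) (f : X -> W) x :
  Cr 1 U f -> U x -> {for x, continuous f}.
Proof. by move=> [df _] /df; exact: differentiable_continuous. Qed.

Lemma CrW X W r (U : set X) (f : X -> W) : Cr r.+1 U f -> Cr r U f.
Proof.
elim: r f => [|r IH] f [df cf] /=.
  by move=> x /df; exact: differentiable_continuous.
by split=> // v; apply: IH; exact: cf.
Qed.

Lemma Cr1_eq X W (U : set X) (f g : X -> W) : open U ->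
  (forall x, U x -> f x = g x) -> Cr 1 U f -> Cr 1 U g.
Proof.
move=> oU fg [df cf].
have fgx x : U x -> {near x, f =1 g}.
  by move=> Ux; move: (open_nbhs_nbhs (conj oU Ux)); apply: filterS.
have dg x : U x -> differentiable g x /\ 'd g x = 'd f x :> (X -> W).
  by move=> Ux; apply: diff_near_eq; [exact: fgx|exact: df].
split=> [x /dg[]//|v x Ux].
rewrite /prop_for/continuous_at (dg _ Ux).2.
apply: cvg_trans (cf v x Ux); apply: near_eq_cvg.
move: (open_nbhs_nbhs (conj oU Ux)); apply: filterS => y Uy.
by rewrite (dg _ Uy).2.
Qed.

(** [Cr 1] controls ['d g] only along fixed directions; expanding the moving direction ['d f y v] in
    the standard basis reduces to those. *)
Lemma Cr1_comp X W p (U : set X) (U' : set 'rV[R]_p) (f : X -> 'rV[R]_p)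
    (g : 'rV[R]_p -> W) :
  open U -> (forall x, U x -> U' (f x)) -> Cr 1 U f -> Cr 1 U' g ->
  Cr 1 U (g \o f).
Proof.
move=> oU fU [df cf] [dg cg].
split=> [x Ux|v x Ux].
  by apply: differentiable_comp; [exact: df|apply/dg/fU].
have E y : U y -> 'd (g \o f) y v =
    \sum_j ('d f y v) 0 j *: 'd g (f y) (delta_mx 0 j).
  move=> Uy; rewrite diff_comp; [|exact: df|by apply/dg/fU].
  by rewrite /= [LHS]row_linE.
rewrite /prop_for/continuous_at E//.
have H : (\sum_j ('d f y v) 0 j *: 'd g (f y) (delta_mx 0 j)) @[y --> x] -->
    \sum_j ('d f x v) 0 j *: 'd g (f x) (delta_mx 0 j).
  apply: cvg_sumR => j _; apply: cvgZ.
    by have /cvg_mxP := cf v x Ux; apply.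
  exact: cvg_comp (differentiable_continuous (df _ Ux)) (cg (delta_mx 0 j) _ (fU _ Ux)).
apply: cvg_trans H; apply: near_eq_cvg.
by move: (open_nbhs_nbhs (conj oU Ux)); apply: filterS => y Uy; rewrite E.
Qed.

Lemma diff_coord X n (f : X -> 'rV[R]_n) x v j : differentiable f x ->
  differentiable (fun y => f y 0 j : R^o) x /\
  'd (fun y => f y 0 j : R^o) x v = 'd f x v 0 j.
Proof.
move=> df.
have dc := @differentiable_coord R _ _ (f x) 0 j.
split; first exact: (differentiable_comp df dc).
rewrite (_ : (fun y => _) = (fun M : 'rV[R]_n => M 0 j : R^o) \o f)//.
rewrite diff_comp//= [in LHS]row_linE.
rewrite [in RHS](row_sum_delta ('d f x v)) summxE.
apply: eq_bigr => k _; rewrite mxE.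
have -> : 'd (fun M : 'rV[R]_n => M 0 j : R^o) (f x) (delta_mx 0 k) = (delta_mx 0 k : 'rV[R]_n) 0 j :> R.
  have lf : linear (fun M : 'rV[R]_n => M 0 j : R^o) by move=> a u w; rewrite !mxE.
  pose L := GRing.isLinear.Build R 'rV[R]_n R^o _ _ lf.
  pose Lf : {linear 'rV[R]_n -> R^o} := HB.pack (fun M : 'rV[R]_n => M 0 j : R^o) L.
  rewrite (_ : (fun M => _) = Lf)//.
  by rewrite (@diff_lin _ _ _ Lf)//; exact: coord_continuous.
by [].
Qed.

Lemma Cr1_coord X n (U : set X) (f : X -> 'rV[R]_n) j : open U ->
  Cr 1 U f -> Cr 1 U (fun x => f x 0 j : R^o).
Proof.
move=> oU [df cf]; split=> [x /df dx|v x Ux]; first exact: (diff_coord 0 j dx).1.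
rewrite /prop_for/continuous_at (diff_coord v j (df _ Ux)).2.
have /cvg_mxP/(_ 0 j) := cf v x Ux; apply: cvg_trans; apply: near_eq_cvg.
move: (open_nbhs_nbhs (conj oU Ux)); apply: filterS => y Uy.
by rewrite (diff_coord v j (df _ Uy)).2.
Qed.

Lemma Cr1_row X n (U : set X) (f : X -> 'rV[R]_n) : open U ->
  (forall j, Cr 1 U (fun x => f x 0 j : R^o)) -> Cr 1 U f.
Proof.
move=> oU fj.
have df x : U x -> differentiable f x.
  move=> Ux.
  have -> : f = \sum_j (fun x => (f x 0 j : R^o) *: delta_mx 0 j).
    by apply/funext => y; rewrite fct_sumE -row_sum_delta.
  by apply: differentiable_sum => j; apply: differentiableZl; apply: (fj j).1.
split=> // v x Ux; apply/cvg_mxP => i j; rewrite ord1.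
rewrite -(diff_coord v j (df _ Ux)).2.
have := (fj j).2 v x Ux; apply: cvg_trans; apply: near_eq_cvg.
move: (open_nbhs_nbhs (conj oU Ux)); apply: filterS => y Uy.
by rewrite (diff_coord v j (df _ Uy)).2.
Qed.

Lemma Cr1_J m n (U : set 'rV[R]_m) (p : 'rV[R]_m -> 'rV[R]_n) u :
  Cr 1 U p -> U u -> {for u, continuous (fun u => 'J p u)}.
Proof.
move=> [_ cp] Uu; apply/continuous_mxP => i j.
have -> : (fun u => 'J p u i j) = (fun u => 'd p u (delta_mx 0 i) 0 j).
  by apply/funext => w; rewrite JE.
by have /continuous_mxP := cp (delta_mx 0 i) _ Uu; exact.
Qed.

Lemma Cr1_mulmxr m n (A : 'M[R]_(m, n)) U : Cr 1 U (fun v : 'rV[R]_m => v *m A).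
Proof.
split=> [x _|v x _]; first exact: (diff_mulmxr _ _).1.
rewrite (_ : (fun _ => _) = cst (v *m A)); first exact: cst_continuous.
by apply/funext => y; rewrite (diff_mulmxr _ _).2.
Qed.

Lemma Cr1_id X (U : set X) : Cr 1 U id.
Proof.
split=> // v x _.
rewrite (_ : (fun _ => _) = cst v); first exact: cst_continuous.
by apply/funext => y; rewrite diff_val.
Qed.

Lemma Cr1_cst X W (U : set X) (w : W) : Cr 1 U (cst w).
Proof.
split=> // v x _.
rewrite (_ : (fun _ => _) = cst 0); first exact: cst_continuous.
by apply/funext => y; rewrite diff_cst.
Qed.

(** [diff_lift] gives differentiability at every point, the pseudo-inverse of the Jacobian matrix
    being the left inverse. This turns continuous inverses of immersions into C^1 ones, both for
    straightening maps and for transition maps of submanifolds. *)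
Lemma Cr1_lift X m n (U : set X) (V : set 'rV[R]_m) (p : 'rV[R]_m -> 'rV[R]_n)
    (u : X -> 'rV[R]_m) (c : X -> 'rV[R]_n) :
  open U -> (forall x, U x -> V (u x)) ->
  Cr 1 V p -> (forall y v, V y -> 'd p y v = 0 -> v = 0) ->
  Cr 1 U c -> (forall x, U x -> {for x, continuous u}) ->
  (forall x, U x -> p (u x) = c x) ->
  Cr 1 U u /\ forall x v, U x -> 'd p (u x) ('d u x v) = 'd c x v.
Proof.
move=> oU uV [dp cp] ip [dc cc] cu puc.
have du x : U x -> differentiable u x.
  move=> Ux; have Vx := uV _ Ux.
  have rf : row_free ('J p (u x)).
    by apply/inj_row_free => v; rewrite -mulJ; exact: ip.
  apply: (diff_lift (p := p) (c := c) (K := mulmxr (pinvmx ('J p (u x)))) _ _ _ _ _ _).1.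
  - exact: dp.
  - exact: mulmxr_continuous.
  - by move=> v; rewrite /= mulJ -mulmxA mulmxVp// mulmx1.
  - exact: cu.
  - move: (open_nbhs_nbhs (conj oU Ux)); apply: filterS => y Uy; exact: puc.
  - exact: dc.
have dpu x v : U x -> 'd p (u x) ('d u x v) = 'd c x v.
  move=> Ux.
  have [_ ->] : differentiable c x /\ 'd c x = 'd (p \o u) x :> (X -> _).
    apply: diff_near_eq; last by apply: differentiable_comp; [exact: du|apply/dp/uV].
    move: (open_nbhs_nbhs (conj oU Ux)); apply: filterS => y Uy; exact: puc.
  by rewrite [in RHS]diff_comp; [|exact: du|apply/dp/uV].
split=> //; split=> // v x Ux.
have Vx := uV _ Ux.
have rf : row_free ('J p (u x)).
  by apply/inj_row_free => w; rewrite -mulJ; exact: ip.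
(* The pseudo-inverse is frozen at [x]: then ['d u y v] solves a square system whose matrix
   ['J p (u y) *m K] tends to the identity as [y] tends to [x], hence stays invertible nearby. *)
pose K := pinvmx ('J p (u x)).
have JpE y : U y -> 'd u y v *m ('J p (u y) *m K) = 'd c y v *m K.
  by move=> Uy; rewrite mulmxA -mulJ dpu.
have cG : ('J p (u y) *m K) @[y --> x] --> 'J p (u x) *m K.
  apply: cvg_mulmx; last exact: cvg_cst.
  exact: cvg_comp (cu _ Ux) (Cr1_J (conj dp cp) Vx).
have uG : 'J p (u x) *m K \in unitmx by rewrite mulmxVp// unitmx1.
rewrite /prop_for/continuous_at.
have -> : 'd u x v = ('d c x v *m K) *m invmx ('J p (u x) *m K).
  by rewrite -JpE// mulmxK.
have H : (('d c y v *m K) *m invmx ('J p (u y) *m K)) @[y --> x] -->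
    ('d c x v *m K) *m invmx ('J p (u x) *m K).
  apply: cvg_mulmx; last exact: cvg_invmx.
  by apply: cvg_mulmx; [exact: cc|exact: cvg_cst].
apply: cvg_trans H; apply: near_eq_cvg.
near=> y.
have Uy : U y by near: y; exact: open_nbhs_nbhs.
have uy : 'J p (u y) *m K \in unitmx by near: y; exact: near_unitmx cG uG.
by rewrite -JpE// mulmxK.
Unshelve. all: by end_near. Qed.

End C1_functions.

Lemma continuous_ballP (R : realType) (T : topologicalType)
    (M : pseudoMetricType R) (f : T -> M) x :
  {for x, continuous f} <->
  forall d : R, 0 < d -> \forall y \near x, ball (f x) d (f y).
Proof. split=> [cf d d0|H A /nbhs_ballP[d /= d0 dA]]; first by apply: cf; exact: nbhsx_ballx.
by apply: filterS (H _ d0) => y; exact: dA. Qed.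

(** * Row vectors split into first coordinate and tail *)

Section first_coordinate.
Context (R : realType) (m : nat).
Implicit Types (u : 'rV[R]_m.+1) (t : 'rV[R]_m) (x : R).

Definition consr x t : 'rV[R]_m.+1 :=
  \row_i oapp (fun j => t 0 j) x (unlift ord0 i).
Definition tl u : 'rV[R]_m := \row_j u 0 (lift ord0 j).

Lemma consr0 x t : consr x t 0 ord0 = x.
Proof. by rewrite mxE unlift_none. Qed.

Lemma consrS x t j : consr x t 0 (lift ord0 j) = t 0 j.
Proof. by rewrite mxE liftK. Qed.

Lemma consr_tl u : consr (u 0 ord0) (tl u) = u.
Proof.
apply/rowP => i; case: (unliftP ord0 i) => [j ->|->]; last exact: consr0.
by rewrite consrS mxE.
Qed.

Lemma tl_consr x t : tl (consr x t) = t.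
Proof. by apply/rowP => j; rewrite mxE consrS. Qed.

Lemma consr_inj x t x' t' : consr x t = consr x' t' -> x = x' /\ t = t'.
Proof. by move=> e; rewrite -(consr0 x t) e consr0 -(tl_consr x t) e tl_consr. Qed.

Lemma ball_consr x t x' t' (e : R) :
  ball (consr x t) e (consr x' t') <-> ball x e x' /\ ball t e t'.
Proof.
split=> [[e0 h]|[h1 [e0 h2]]]; split => //.
- by have := h 0 ord0; rewrite !consr0.
- by split=> // i j; have := h 0 (lift ord0 j); rewrite !consrS ord1.
- move=> i j; rewrite ord1; case: (unliftP ord0 j) => [k ->|->].
    by rewrite !consrS.
  by rewrite !consr0.
Qed.

Lemma consr_continuous (T : topologicalType) (F : set_system T) {FF : Filter F}
    (f : T -> R) (g : T -> 'rV[R]_m) (x : R) t :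
  f @ F --> x -> g @ F --> t -> consr (f y) (g y) @[y --> F] --> consr x t.
Proof.
move=> fx /cvg_mxP gt; apply/cvg_mxP => i j; rewrite ord1.
case: (unliftP ord0 j) => [k ->|->].
  by rewrite consrS (_ : (fun _ => _) = fun y => g y 0 k)//; apply/funext => y; rewrite consrS.
by rewrite consr0 (_ : (fun _ => _) = f)//; apply/funext => y; rewrite consr0.
Qed.

Lemma tl_continuous : continuous tl.
Proof.
move=> u; apply/continuous_mxP => i j.
rewrite (_ : (fun _ => _) = fun u : 'rV[R]_m.+1 => u 0 (lift ord0 j)).
  exact: coord_continuous.
by apply/funext => w; rewrite mxE.
Qed.

Lemma Cr1_consr (X : normedModType R) (U : set X) (f : X -> R^o) (g : X -> 'rV[R]_m) :
  open U -> Cr 1 U f -> Cr 1 U g -> Cr 1 U (fun y => consr (f y) (g y)).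
Proof.
move=> oU fU gU; apply: (Cr1_row oU) => i.
case: (unliftP ord0 i) => [j ->|->].
  by rewrite (_ : (fun _ => _) = fun y => g y 0 j : R^o);
    [exact: Cr1_coord|apply/funext => y; rewrite consrS].
by rewrite (_ : (fun _ => _) = f)//; apply/funext => y; rewrite consr0.
Qed.

Lemma Cr1_tl U : open U -> Cr 1 U tl.
Proof.
move=> oU; apply: (Cr1_row oU) => j.
rewrite (_ : (fun _ => _) = fun u : 'rV[R]_m.+1 => u 0 (lift ord0 j) : R^o).
  by apply: (Cr1_coord (f := id)) => //; exact: Cr1_id.
by apply/funext => y; rewrite mxE.
Qed.

Lemma diff_tl (X : normedModType R) (h : X -> 'rV[R]_m.+1) (x v : X) :
  differentiable h x -> 'd (tl \o h) x v = tl ('d h x v).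
Proof.
move=> dh; have [dt _] := @Cr1_tl setT openT.
have dth : differentiable (tl \o h) x by apply: differentiable_comp => //; exact: dt.
apply/rowP => j; rewrite mxE -(diff_coord v j dth).2.
rewrite (_ : (fun y => _) = fun y => h y 0 (lift ord0 j) : R^o).
  exact: (diff_coord v (lift ord0 j) dh).2.
by apply/funext => y; rewrite /= mxE.
Qed.

End first_coordinate.
Arguments tl {R m}.
Arguments consr {R m}.

Definition diffeo (R : realType) m (U U' : set 'rV[R]_m) (h k : 'rV[R]_m -> 'rV[R]_m) :=
  [/\ open U, open U', Cr 1 U h, Cr 1 U' k &
   (forall u, U u -> U' (h u) /\ k (h u) = u) /\
   (forall v, U' v -> U (k v) /\ h (k v) = v)].

(** In use the factor [s] is 1 or -1, so that increasing and decreasing functions are handled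
    together. *)
Lemma MVT_lt (R : realType) (F dF : R -> R) (a b s : R) : a < b ->
  (forall x, x \in `[a, b] -> is_derive x 1 F (dF x)) ->
  (forall x, x \in `[a, b] -> 0 < s * dF x) -> s * F a < s * F b.
Proof.
move=> ab dF' dF0.
have cF : {within `[a, b], continuous F}.
  by apply: derivable_within_continuous => x /dF' dd; exact: ex_derive.
have dFo x : x \in `]a, b[ -> is_derive x 1 F (dF x).
  by move=> /subset_itv_oo_cc; exact: dF'.
have [c /subset_itv_oo_cc/dF0 cx fE] := MVT ab dFo cF.
by rewrite -subr_gt0 -mulrBr fE mulrA mulr_gt0 ?subr_gt0.
Qed.

(** * Straightening a function along the first coordinate *)

Section straightening.
Context (R : realType) (m : nat) (U : set 'rV[R]_m.+1) (f : 'rV[R]_m.+1 -> R^o).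
Hypotheses (oU : open U) (fU : Cr 1 U f).

Let e0 : 'rV[R]_m.+1 := delta_mx 0 0.
Let g u := consr (f u) (tl u).

Lemma slice_derive x t : U (consr x t) ->
  is_derive (x : R^o) 1 (fun x => f (consr x t)) ('d f (consr x t) e0).
Proof.
move=> Ux.
have dc : differentiable (fun y : R^o => consr y t) x /\
    'd (fun y : R^o => consr y t) x 1 = e0.
  have dd : differentiable (fun y : R^o => consr y t) x.
    have := @Cr1_consr R m R^o setT id (cst t) openT.
    by move=> /(_ (Cr1_id _) (Cr1_cst _ _)) [+ _]; apply.
  split=> //; apply/rowP => i; rewrite /e0 mxE eqxx/=.
  case: (unliftP ord0 i) => [j ->|->].
    rewrite -(diff_coord (1 : R^o) (lift ord0 j) dd).2.
    rewrite (_ : (fun y => _) = cst (t 0 j)); first by rewrite diff_cst.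
    by apply/funext => y; rewrite consrS.
  rewrite -(diff_coord (1 : R^o) ord0 dd).2 (_ : (fun y => _) = id); first by rewrite diff_val.
  by apply/funext => y; rewrite consr0.
have df := fU.1 _ Ux.
have dfc : differentiable (fun y : R^o => f (consr y t)) x.
  exact: (differentiable_comp dc.1 df).
apply: DeriveDef; first exact: diff_derivable.
rewrite deriveE// (_ : (fun y : R^o => f _) = f \o (fun y : R^o => consr y t))//.
by rewrite diff_comp//=; [rewrite dc.2|exact: dc.1].
Qed.

Lemma diff_straight u v : U u -> 'd g u v = consr ('d f u v) (tl v).
Proof.
move=> Uu.
have dg : differentiable g u := (Cr1_consr oU fU (Cr1_tl oU)).1 _ Uu.
have dt : tl ('d g u v) = tl v.
  rewrite -diff_tl// (_ : tl \o g = tl \o id).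
    by rewrite diff_tl//; congr tl; rewrite diff_val.
  by apply/funext => w; rewrite /= /g tl_consr.
rewrite -[LHS]consr_tl dt; congr consr.
rewrite -(diff_coord v ord0 dg).2.
rewrite (_ : (fun y => _) = f)//.
by apply/funext => y; rewrite /g consr0.
Qed.

(** On a ball where the first partial derivative keeps its sign, [f] is strictly monotone along the
    first coordinate while [g] fixes the tail. Monotonicity gives injectivity, intermediate values
    give openness of [g] and continuity of its inverse, and [Cr1_lift] upgrades the inverse to class
    C^1. *)
Lemma straighten u0 : U u0 -> 'd f u0 e0 != 0 ->
  exists e : R, exists k, [/\ 0 < e, ball u0 e `<=` U,
    (forall u, ball u0 e u -> 0 < 'd f u e0) \/
    (forall u, ball u0 e u -> 'd f u e0 < 0) &
    diffeo (ball u0 e) (g @` ball u0 e) g k].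
Proof.
move=> Uu0 df0.
have [s [s1 sdf0]] : exists s : R, s ^+ 2 = 1 /\ 0 < s * 'd f u0 e0.
  have [h|h] := ltP 0 ('d f u0 e0); first by exists 1; rewrite expr1n mul1r.
  exists (-1); rewrite sqrrN expr1n mulN1r oppr_gt0; split=> //.
  by rewrite lt_neqAle df0.
have sn0 : s != 0 by apply: contra_eq_neq s1 => ->; rewrite expr0n/= eq_sym oner_eq0.
have : \forall u \near u0, U u /\ 0 < s * 'd f u e0.
  apply: filterI; first exact: open_nbhs_nbhs.
  have : s * 'd f u e0 @[u --> u0] --> s * 'd f u0 e0.
    have h : ('d f u e0 : R) @[u --> u0] --> ('d f u0 e0 : R) by exact: (fU.2 e0 _ Uu0).
    exact: cvgMl_tmp h.
  by move=> /cvgr_gt; apply.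
move=> /nbhs_ballP[e /= e0' He].
have BU u : ball u0 e u -> U u by move=> /He[].
have Bd u : ball u0 e u -> 0 < s * 'd f u e0 by move=> /He[].
have oB : open (ball u0 e) by exact: ball_open.
pose W := ball u0 e.
have WE x t : W (consr x t) <-> ball (u0 0 ord0) e x /\ ball (tl u0) e t.
  by rewrite /W -{1}(consr_tl u0) ball_consr.
(* Balls of row vectors are boxes, so [W] contains the segments in the first direction that join two
   of its points. *)
have convex x1 x2 x t : W (consr x1 t) -> W (consr x2 t) -> x1 <= x <= x2 -> W (consr x t).
  move=> /WE[b1 bt] /WE[b2 _] /andP[x1x xx2]; apply/WE; split=> //.
  move: b1 b2; rewrite /ball/= !ltr_norml => /andP[h1 h2] /andP[h3 h4].
  apply/andP; split; lra.
have mono x1 x2 t : x1 < x2 -> W (consr x1 t) -> W (consr x2 t) ->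
    s * f (consr x1 t) < s * f (consr x2 t).
  move=> x12 W1 W2.
  pose F (x : R) : R := f (consr x t).
  pose dF (x : R) : R := 'd f (consr x t) e0.
  have dx (x : R) : x \in `[x1, x2] -> is_derive x 1 F (dF x).
    by rewrite in_itv/= => xx; apply: slice_derive; apply: BU; exact: convex W1 W2 xx.
  apply: (MVT_lt x12 dx) => x; rewrite in_itv/= => xx.
  by apply: Bd; exact: convex W1 W2 xx.
have ginj u u' : W u -> W u' -> g u = g u' -> u = u'.
  rewrite -(consr_tl u) -(consr_tl u'); move: (u _ _) (u' _ _) (tl u) (tl u') => x x' t t'.
  rewrite /g !tl_consr => W1 W2 /consr_inj[fE tE]; rewrite -tE in W2 fE *.
  have [xx|xx|->//] := ltgtP x x'.
    by have := mono _ _ _ xx W1 W2; rewrite fE ltxx.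
  by have := mono _ _ _ xx W2 W1; rewrite fE ltxx.
(* Intermediate values on a short segment in the first coordinate solve g u = y
   for every y close to g u1, with u close to u1. *)
have loc u1 (d : R) : W u1 -> 0 < d ->
    \forall y \near g u1, exists u, [/\ W u, ball u1 d u & g u = y].
  move=> Wu1 d0.
  have : \forall u \near u1, W u by exact: open_nbhs_nbhs.
  move=> /nbhs_ballP[d1 /= d10 d1W].
  (* Strictly below both radii: [d] keeps the solution near [u1], and [d1] keeps the segment inside
     [W], where [f] is monotone. *)
  pose r := Num.min d d1 / 2.
  have m0 : 0 < Num.min d d1 by rewrite lt_min d0 d10.
  have r0 : 0 < r by rewrite divr_gt0.
  have rm : r < Num.min d d1 by rewrite gtr_pMr// invf_lt1// ltr1n.
  have rd : r < d by apply: lt_le_trans rm _; rewrite ge_min lexx.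
  have rd1 : r < d1 by apply: lt_le_trans rm _; rewrite ge_min lexx orbT.
  pose x1 := u1 0 ord0; pose t1 := tl u1.
  have u1E : u1 = consr x1 t1 by rewrite consr_tl.
  have bx a : `|a| <= r -> ball x1 d (x1 + a) /\ ball x1 d1 (x1 + a).
    by move=> ar; rewrite /ball/= opprD addrA subrr add0r normrN !(le_lt_trans ar).
  have bx1 a : `|a| <= r -> W (consr (x1 + a) t1).
    move=> /bx[_ b]; apply: d1W; rewrite u1E; apply/ball_consr; split=> //.
    exact: ballxx.
  have Wm : W (consr (x1 + - r) t1) by apply: bx1; rewrite normrN gtr0_norm.
  have Wp : W (consr (x1 + r) t1) by apply: bx1; rewrite gtr0_norm.
  have Wu1' : W (consr x1 t1) by rewrite -u1E.
  have xm : x1 + - r < x1 by rewrite gtrDl oppr_lt0.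
  have xp : x1 < x1 + r by rewrite ltrDl.
  have lo : s * f (consr (x1 + - r) t1) < s * f u1 by rewrite u1E; exact: mono.
  have hi : s * f u1 < s * f (consr (x1 + r) t1) by rewrite u1E; exact: mono.
  have cf a : W (consr a t1) ->
      (fun y => f (consr a (tl y)) : R) @ g u1 --> (f (consr a t1) : R).
    move=> Wa; have c1 : consr a (tl y) @[y --> g u1] --> consr a t1.
      apply: (@consr_continuous R m _ (nbhs (g u1)) _ (cst a) tl); first exact: cvg_cst.
      by have := @tl_continuous R m (g u1); rewrite /continuous_at /g tl_consr.
    exact: cvg_comp c1 (Cr1_continuous fU (BU _ Wa)).
  have c0 : (fun y : 'rV[R]_m.+1 => y 0 ord0) @ g u1 --> (f u1 : R).
    by have := @coord_continuous R _ _ 0 ord0 (g u1); rewrite /continuous_at/= /g consr0.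
  have near1 : \forall y \near g u1, s * f (consr (x1 + - r) (tl y)) < s * y 0 ord0.
    have H : (fun y : 'rV[R]_m.+1 => s * y 0 ord0 - s * f (consr (x1 + - r) (tl y))) @ g u1 -->
       s * f u1 - s * f (consr (x1 + - r) t1).
      exact: cvgB (cvgMl_tmp (a := s) c0) (cvgMl_tmp (a := s) (cf _ Wm)).
    move: H => /cvgr_gt/(_ 0); rewrite subr_gt0 => /(_ lo).
    by apply: filterS => y; rewrite subr_gt0.
  have near2 : \forall y \near g u1, s * (y : 'rV[R]_m.+1) 0 ord0 < s * f (consr (x1 + r) (tl y)).
    have H : (fun y : 'rV[R]_m.+1 => s * f (consr (x1 + r) (tl y)) - s * y 0 ord0) @ g u1 -->
       s * f (consr (x1 + r) t1) - s * f u1.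
      exact: cvgB (cvgMl_tmp (a := s) (cf _ Wp)) (cvgMl_tmp (a := s) c0).
    move: H => /cvgr_gt/(_ 0); rewrite subr_gt0 => /(_ hi).
    by apply: filterS => y; rewrite subr_gt0.
  have near3 : \forall y \near g u1, ball t1 (Num.min d d1) (tl y).
    have := @tl_continuous R m (g u1); rewrite /continuous_at /g tl_consr.
    by move=> /(_ _ (nbhsx_ballx _ _ m0)).
  near=> y.
  have y1 : s * f (consr (x1 + - r) (tl y)) < s * y 0 ord0 by near: y.
  have y2 : s * y 0 ord0 < s * f (consr (x1 + r) (tl y)) by near: y.
  have y3 : ball t1 (Num.min d d1) (tl y) by near: y.
  have Wc x : x \in `[x1 + - r, x1 + r] -> W (consr x (tl y)) /\ ball u1 d (consr x (tl y)).
    rewrite in_itv/= => xr.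
    have [b1 b2] : ball x1 d (x1 + (x - x1)) /\ ball x1 d1 (x1 + (x - x1)).
      by apply: bx; rewrite ler_norml; move: xr => /andP[? ?]; apply/andP; split; lra.
    rewrite subrKC in b1 b2.
    split; first (apply: d1W); rewrite u1E; apply/ball_consr; split => //.
      by apply: le_ball y3; rewrite ge_min lexx orbT.
    by apply: le_ball y3; rewrite ge_min lexx.
  have [|||x xr fx] := @IVT R (fun x => s * f (consr x (tl y))) (x1 + - r) (x1 + r) (s * y 0 ord0).
  - by rewrite ltW// (lt_trans xm).
  - apply: derivable_within_continuous => x /Wc[Wx _].
    by apply: derivableZ; have := slice_derive (BU _ Wx) => dd; exact: ex_derive.
  - by rewrite ge_min le_max (ltW y1) (ltW y2)/= orbT.
  exists (consr x (tl y)); have [h1 h2] := Wc _ xr; split=> //.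
  by rewrite /g tl_consr (mulfI sn0 fx) consr_tl.
have gK y : (g @` W) y -> {u | W u /\ g u = y} by move=> h; apply: cid; case: h => u ? ?; exists u.
(* [u0] is a dummy value off the image of [W]. *)
pose k y := if pselect ((g @` W) y) is left h then sval (gK y h) else u0.
have kP y : (g @` W) y -> W (k y) /\ g (k y) = y.
  by move=> h; rewrite /k; case: pselect => [h'|//]; case: (gK y h').
have kg u : W u -> k (g u) = u.
  move=> Wu; have [Wk gk] := kP (g u) (ex_intro2 _ _ u Wu erefl); exact: ginj.
have ogW : open (g @` W).
  rewrite openE => _ [u1 Wu1 <-]; have := loc _ _ Wu1 ltr01.
  by apply: filterS => y [u [Wu _ <-]]; exists u.
have ck y : (g @` W) y -> {for y, continuous k}.
  move=> [u1 Wu1 <-]; apply/continuous_ballP => d d0; rewrite kg//.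
  have := loc _ _ Wu1 d0; apply: filterS => y' [u [Wu b <-]]; by rewrite kg.
have WU : W `<=` U by exact: BU.
have gC : Cr 1 W g by apply: (Cr1_sub WU); apply: Cr1_consr => //; exact: Cr1_tl.
exists e, k; split=> //.
  have [h|h] := ltP 0 s; [left|right] => u /Bd.
    by rewrite pmulr_rgt0.
  by rewrite nmulr_rgt0// lt_neqAle sn0.
split=> //; last by split=> [u Wu|y /kP//]; split; [exists u|exact: kg].
apply: (@Cr1_lift R _ _ _ (g @` W) W g k id ogW _ gC _ _ ck _).1.
- by move=> y /kP[].
(* Injectivity of the differential of [g]: a kernel vector has zero tail, hence is a multiple of
   [e0], on which ['d f u] does not vanish. *)
- move=> u v Wu; rewrite diff_straight; last exact: BU.
  move=> v0; have tv : tl v = 0.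
    by rewrite -[LHS](tl_consr ('d f u v)) v0; apply/rowP => j; rewrite !mxE.
  have vE : v = v 0 ord0 *: e0.
    rewrite -[LHS]consr_tl tv; apply/rowP => i; rewrite [RHS]mxE [X in _ * X]mxE eqxx/=.
    case: (unliftP ord0 i) => [j ->|->]; first by rewrite consrS mxE mulr0.
    by rewrite consr0 mulr1.
  have : 'd f u v = 0 by rewrite -[LHS](consr0 _ (tl v)) v0 mxE.
  rewrite vE linearZ/= => /eqP; rewrite scaler_eq0 => /orP[/eqP ->|/eqP fu0].
    by rewrite scale0r.
  by have := Bd _ Wu; rewrite fu0 mulr0 ltxx.
- exact: Cr1_id.
- by move=> y /kP[].
Unshelve. all: by end_near. Qed.

End straightening.

(** * Lebesgue measure and change of variables in R^m *)

Section rational_balls.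
Context (R : realType) (m : nat).

Definition rat_ball (p : 'rV[rat]_m * nat) : set 'rV[R]_m :=
  ball (map_mx ratr p.1 : 'rV[R]_m) p.2.+1%:R^-1.

Lemma rat_ball_basis (A : set 'rV[R]_m) x : open A -> A x ->
  exists p, rat_ball p x /\ rat_ball p `<=` A.
Proof.
move=> oA Ax; have /nbhs_ballP[e /= e0 eA] := open_nbhs_nbhs (conj oA Ax).
have e20 : 0 < e / 2 by rewrite divr_gt0.
have [k _ /(_ k (leqnn _)) ke] := near_infty_natSinv_lt (PosNum e20).
have k0 : 0 < k.+1%:R^-1 :> R by rewrite invr_gt0.
have qP j : exists q, `|x 0 j - ratr q| < k.+1%:R^-1.
  move: k0; set r : R := k.+1%:R^-1; move: (x 0 j) => a r0.
  have /rat_in_itvoo[q] : a - r < a + r by lra.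
  rewrite in_itv/= => /andP[h1 h2]; exists q.
  by rewrite ltr_norml; apply/andP; split; lra.
pose q : 'rV[rat]_m := \row_j sval (cid (qP j)).
have qx : ball (map_mx ratr q : 'rV[R]_m) k.+1%:R^-1 x.
  split=> // i j; rewrite ord1 !mxE /ball/= distrC.
  exact: (svalP (cid (qP j))).
exists (q, k); split=> // y qy; apply: eA.
rewrite [e]splitr; apply: (@ball_triangle _ _ (map_mx ratr q : 'rV[R]_m)).
  by apply: le_ball (ball_sym qx); exact: ltW.
by apply: le_ball qy; exact: ltW.
Qed.

Lemma rV_second_countable : @second_countable 'rV[R]_m.
Proof.
exists (rat_ball @` setT).
  exact: (sub_countable (card_image_le _ _) (countableP _)).
split=> [_ [p _ <-]|x A /= xA]; first exact: ball_open.
have [p [px pA]] := rat_ball_basis (open_interior A) xA.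
exists (rat_ball p); first by split=> //; exists p.
by apply: subset_trans pA _; exact: interior_subset.
Qed.

Lemma open_rV_bigcup (A : set 'rV[R]_m) : open A -> exists B : nat -> set 'rV[R]_m,
  A = \bigcup_k B k /\ forall k, B k = set0 \/ exists p, B k = rat_ball p.
Proof.
move=> oA.
pose B k := if unpickle k is Some p then
  (if `[< rat_ball p `<=` A >] then rat_ball p else set0) else set0.
exists B; split.
  apply/seteqP; split=> [x Ax|x [k _]]; rewrite /B.
    have [p [px pA]] := rat_ball_basis oA Ax; exists (pickle p) => //=.
    by rewrite pickleK; case: asboolP.
  by case: unpickle => [p|//]; case: asboolP => // pA /pA.
move=> k; rewrite /B; case: unpickle => [p|]; last by left.
by case: asboolP => _; [right; exists p|left].
Qed.

(** Tuples carry the product sigma-algebra, row vectors the Borel one. An open set is a countable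
    union of rational balls, and a ball is a finite intersection of conditions on single
    coordinates. *)
Lemma row_of_tuple_measurable : measurable_fun setT
  (@row_of_tuple R m : m.-tuple (measurableTypeR R) -> borel 'rV[R]_m).
Proof.
apply: (@measurability _ _ _ (borel 'rV[R]_m) _ _ (@open 'rV[R]_m)) => // _ [A oA <-].
have [B [-> Bp]] := open_rV_bigcup oA.
rewrite setTI preimage_bigcup; apply: bigcupT_measurable => k.
have [->|[p ->]] := Bp k; first by rewrite preimage_set0.
have -> : @row_of_tuple R m @^-1` rat_ball p =
    \bigcap_(j in [set: 'I_m]) ((@tnth m R)^~ j @^-1` ball (ratr (p.1 0 j) : R) p.2.+1%:R^-1).
  apply/seteqP; split=> [t [_ h] j _|t h].
    by have := h 0 j; rewrite !mxE.
  split; first by rewrite invr_gt0.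
  by move=> i j; rewrite ord1 !mxE; exact: h.
apply: fin_bigcap_measurable => [|j _]; first exact: finite_finset.
rewrite -[X in measurable X]setTI.
by apply: (@measurable_tnth _ (measurableTypeR R) m j) => //; exact: measurable_ball.
Qed.

End rational_balls.

Definition rot (R : realType) m : m.-tuple (measurableTypeR R) -> borel 'rV[R]_m :=
  @row_of_tuple R m.

HB.instance Definition _ (R : realType) m := isMeasurableFun.Build _ _ _ _
  (@rot R m) (@row_of_tuple_measurable R m).

(** Lebesgue measure transported to the Borel sets of row vectors, where parametrizations are
    defined; [ge0_integral_leb] returns to integrals over tuples. *)
Definition leb (R : realType) m : set (borel 'rV[R]_m) -> \bar R :=
  pushforward (lebesgue_tuple R m) (@rot R m).
Arguments leb : clear implicits.

Section leb_measure.
Context (R : realType) (m : nat).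
Let leb0 : leb R m set0 = 0%E.
Proof. by rewrite /leb /pushforward preimage_set0 measure0. Qed.
Let leb_ge0 A : (0 <= leb R m A)%E.
Proof. exact: measure_ge0. Qed.
Let leb_add : semi_sigma_additive (leb R m).
Proof.
exact: (@measure_semi_sigma_additive _ _ _
  (measure_function_pushforward__canonical__measure_function_Measure
    (lebesgue_tuple R m) (@row_of_tuple_measurable R m))).
Qed.
HB.instance Definition _ := isMeasure.Build _ _ _ (leb R m) leb0 leb_ge0 leb_add.
End leb_measure.

(** * Tonelli's theorem for Lebesgue measure on row vectors *)

Section leb_tonelli.
Local Open Scope ereal_scope.
Context (R : realType).

Lemma ge0_integral_leb m D (F : 'rV[R]_m -> \bar R) :
  measurable (D : set (borel _)) -> measurable_fun (D : set (borel _)) F ->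
  (forall y, D y -> 0 <= F y) ->
  \int[leb R m]_(y in D) F y =
  \int[lebesgue_tuple R m]_(t in @row_of_tuple R m @^-1` D) F (row_of_tuple t).
Proof.
move=> mD mF F0; rewrite /leb.
rewrite (@ge0_integral_pushforward _ _ _ _ _ (@rot R m))//.
by move=> y /[!inE]; exact: F0.
Qed.

Lemma consr_rot m (p : measurableTypeR R * m.-tuple (measurableTypeR R)) :
  consr p.1 (rot p.2) = rot (cons_tup p).
Proof.
apply/rowP => i; rewrite !mxE /cons_tup; case: (unliftP ord0 i) => [j ->|->] /=.
  by rewrite tnthS/= mxE.
by rewrite tnth0.
Qed.

Definition tuple_of_row m (y : borel 'rV[R]_m) : m.-tuple (measurableTypeR R) :=
  [tuple y ord0 i | i < m].

Lemma tuple_of_rowK m : cancel (@tuple_of_row m) (@rot R m).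
Proof. by move=> y; apply/rowP => i; rewrite mxE tnth_mktuple. Qed.

Lemma tuple_of_row_measurable m : measurable_fun setT (@tuple_of_row m).
Proof.
apply/measurable_fun_tnthP => i.
rewrite (_ : _ \o _ = (fun y : 'rV[R]_m => y ord0 i)); last first.
  by apply/funext => y /=; rewrite tnth_mktuple.
apply: within_continuous_borelR => //; apply: within_continuous => y _.
exact: coord_continuous.
Qed.

Variables (m : nat) (F : 'rV[R]_m.+1 -> \bar R).
Hypothesis mF : measurable_fun setT (F : borel 'rV[R]_m.+1 -> _).
Hypothesis F0 : forall u, 0 <= F u.

Let Ft (p : measurableTypeR R * m.-tuple (measurableTypeR R)) : \bar R :=
  F (consr p.1 (rot p.2)).

Let mFt : measurable_fun setT Ft.
Proof.
rewrite /Ft; under eq_fun do rewrite consr_rot.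
apply: (measurableT_comp (f := F : borel _ -> _)) => //.
apply: (measurableT_comp (f := @rot R m.+1)) => //.
by apply: measurable_cons; [exact: measurable_fst|exact: measurable_snd].
Qed.

Lemma measurable_slice1 x : measurable_fun setT (fun y : borel 'rV[R]_m => F (consr x y)).
Proof.
apply: (measurableT_comp (f := F : borel _ -> _)) => //.
apply: within_continuous_borel => //; apply: within_continuous => y _.
apply: (@consr_continuous R m _ (nbhs y) _ (cst x) id); last exact: cvg_id.
exact: cvg_cst.
Qed.

Lemma measurable_slice2 y : measurable_fun setT (fun x : measurableTypeR R => F (consr x y)).
Proof.
apply: (measurableT_comp (f := F : borel _ -> _)) => //.
apply: (@measurability _ _ (measurableTypeR R) (borel 'rV[R]_m.+1) _ _ (@open 'rV[R]_m.+1)) => // _ [A oA <-].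
rewrite setTI; apply: open_measurable.
move: A oA; apply/continuousP => x.
by apply: (@consr_continuous R m _ (nbhs x) _ id (cst y)); [exact: cvg_id|exact: cvg_cst].
Qed.

Let slice1E x : \int[leb R m]_y F (consr x y) =
  fubini_F (lebesgue_tuple R m) Ft x.
Proof.
rewrite ge0_integral_leb//; exact: measurable_slice1.
Qed.

Lemma measurable_leb_slice : measurable_fun setT
  (fun x : measurableTypeR R => \int[leb R m]_y F (consr x y)).
Proof.
under eq_fun do rewrite slice1E.
by apply: measurable_fun_fubini_tonelli_F => // p; exact: F0.
Qed.

Let lebSE : \int[leb R m.+1]_u F u =
  \int[(@lebesgue_measure R \x lebesgue_tuple R m)]_p Ft p.
Proof.
rewrite ge0_integral_leb//=.
rewrite (@ge0_integral_pushforward _ _ _ _ _ (@cons_tup _ (measurableTypeR R) m))//=.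
- by apply: eq_integral => p _; rewrite /Ft consr_rot.
- by apply: measurable_cons; [exact: measurable_fst|exact: measurable_snd].
- by rewrite preimage_setT.
- rewrite preimage_setT.
  exact: (measurableT_comp (f := F : borel _ -> _) mF (@row_of_tuple_measurable R m.+1)).
Qed.

Lemma leb_tonelli1 :
  \int[leb R m.+1]_u F u = \int[@lebesgue_measure R]_x \int[leb R m]_y F (consr x y).
Proof.
rewrite lebSE fubini_tonelli1//; last by move=> p; exact: F0.
by apply: eq_integral => x _; rewrite slice1E.
Qed.

Lemma leb_tonelli2 :
  \int[leb R m.+1]_u F u = \int[leb R m]_y \int[@lebesgue_measure R]_x F (consr x y).
Proof.
rewrite lebSE fubini_tonelli2//; last by move=> p; exact: F0.
rewrite ge0_integral_leb//; last by move=> y _; apply: integral_ge0.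
(* The inner integral is known to be measurable as a function of the tuple; [tuple_of_row] carries
   this over to Borel row vectors. *)
rewrite (_ : (fun y => _) = (fun y => fubini_G (@lebesgue_measure R) Ft (tuple_of_row y))).
  apply: measurableT_comp; last exact: tuple_of_row_measurable.
  by apply: measurable_fun_fubini_tonelli_G => // p; exact: F0.
by apply/funext => y; apply: eq_integral => x _; rewrite /Ft/= tuple_of_rowK.
Qed.

End leb_tonelli.

Section image_density.
Local Open Scope ereal_scope.
Context d1 d2 (T1 : measurableType d1) (T2 : measurableType d2) (R : realType).
Context (nu : {measure set T2 -> \bar R}) (D : set T2) (f : T2 -> T1) (rho : T2 -> R).
Hypothesis mD : measurable D.
Hypothesis mf : measurable_fun D f.
Hypothesis mrho : measurable_fun D rho.
Hypothesis rho0 : forall x, D x -> (0 <= rho x)%R.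

Definition image_density (B : set T1) := \int[nu]_(x in D `&` f @^-1` B) (rho x)%:E.

Lemma image_density0 : image_density set0 = 0.
Proof. by rewrite /image_density preimage_set0 setI0 integral_set0. Qed.

Lemma image_density_ge0 B : 0 <= image_density B.
Proof. by apply: integral_ge0 => x [Dx _]; rewrite lee_fin rho0. Qed.

Lemma image_density_sigma_additive : semi_sigma_additive image_density.
Proof.
move=> F mF tF mUF; rewrite /image_density preimage_bigcup setI_bigcupr.
rewrite ge0_integral_bigcup//=.
- apply: is_cvg_ereal_nneg_natsum_cond => n _ _.
  exact: image_density_ge0.
- by move=> k; exact: mf.
- apply: (measurable_funS (E := D)) => //; first by move=> x [k _ []].
  exact/measurable_EFinP.
- by move=> x [k _ [Dx _]]; rewrite lee_fin rho0.
- apply/trivIsetP => i j _ _ ij; move/trivIsetP : tF => /(_ i j Logic.I Logic.I ij) F0.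
  by rewrite setIACA setIid -preimage_setI F0 preimage_set0 setI0.
Qed.

Definition image_density_measure : {measure set T1 -> \bar R} :=
  HB.pack image_density (isMeasure.Build _ T1 R image_density
    image_density0 image_density_ge0 image_density_sigma_additive).

End image_density.

(** * Change of variables on an interval *)

Section change_of_variable1.
Local Open Scope ereal_scope.
Context (R : realType) (a a' : R -> R) (c d : R).
Hypothesis cd : (c < d)%R.
Hypothesis da : forall x, x \in `[c, d] -> is_derive x 1%R a (a' x).
Hypothesis ca' : {within `[c, d], continuous a'}.
Hypothesis a'0 : forall x, x \in `[c, d] -> (0 < a' x)%R.

Let ca : {within `[c, d], continuous a}.
Proof. by apply: derivable_within_continuous => x /da h; exact: ex_derive. Qed.

Let incr x y : x \in `[c, d] -> y \in `[c, d] -> (x < y)%R -> (a x < a y)%R.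
Proof.
rewrite !in_itv/= => /andP[cx xd] /andP[cy yd] xy.
rewrite -[a x]mul1r -[a y]mul1r.
have sub z : z \in `[x, y] -> z \in `[c, d].
  by rewrite !in_itv/= => /andP[xz zy]; rewrite (le_trans cx)// (le_trans zy).
have h1 (z : R) : z \in `[x, y] -> is_derive z 1%R a (a' z) by move=> /sub/da.
have h2 (z : R) : z \in `[x, y] -> (0 < 1 * a' z)%R by move=> /sub/a'0; rewrite mul1r.
exact: (MVT_lt xy h1 h2).
Qed.

Let D := `[c, d]%classic : set (measurableTypeR R).

Let mD : measurable D. Proof. exact: measurable_itv. Qed.
Let ma : measurable_fun D (a : measurableTypeR R -> measurableTypeR R).
Proof. exact: subspace_continuous_measurable_fun. Qed.
Let ma' : measurable_fun D a'.
Proof. exact: subspace_continuous_measurable_fun. Qed.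
Let a'ge0 x : D x -> (0 <= a' x)%R. Proof. by move=> Dx; rewrite ltW// a'0. Qed.

Let mu2 : {measure set (measurableTypeR R) -> \bar R} :=
  image_density_measure (@lebesgue_measure R) mD ma ma' a'ge0.

Let E := `[a c, a d]%classic : set (measurableTypeR R).
Let mE : measurable E. Proof. exact: measurable_itv. Qed.
Let mu1 : {measure set (measurableTypeR R) -> \bar R} := mrestr (@lebesgue_measure R) mE.

Let cD : c \in `[c, d]. Proof. by rewrite in_itv/= lexx ltW. Qed.
Let dD : d \in `[c, d]. Proof. by rewrite in_itv/= lexx ltW. Qed.

Let ftc z : z \in `[c, d] -> \int[@lebesgue_measure R]_(x in `[c, z]) (a' x)%:E = (a z)%:E - (a c)%:E.
Proof.
rewrite in_itv/= => /andP[]; rewrite le_eqVlt => /predU1P[<- _|cz zd].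
  by rewrite set_itv1 integral_set1 subee.
have sub : {subset `[c, z] <= `[c, d]}.
  by move=> x; rewrite !in_itv/= => /andP[-> xz]; rewrite (le_trans xz).
have cfor x : x \in `[c, d] -> {for x, continuous a}.
  move=> /da h; apply: differentiable_continuous; apply/derivable1_diffP.
  exact: ex_derive.
apply: continuous_FTC2 => //.
- by apply: continuous_subspaceW ca' => x; exact: sub.
- split.
  + by move=> x /subset_itv_oo_cc/sub/da h; exact: ex_derive.
  + by apply: cvg_at_right_filter; exact: cfor.
  + by apply: cvg_at_left_filter; apply: cfor; apply: sub; rewrite in_itv/= lexx ltW.
- by move=> x /subset_itv_oo_cc/sub/da h; rewrite derive1E; exact: derive_val.
Qed.

Let EE x : E x = (a c <= x <= a d)%R :> Prop.
Proof. by rewrite /E/= in_itv. Qed.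
Let DE x : D x = (c <= x <= d)%R :> Prop.
Proof. by rewrite /D/= in_itv. Qed.

Let mono x y : (c <= x <= d)%R -> (c <= y <= d)%R -> (x <= y)%R -> (a x <= a y)%R.
Proof.
move=> xD yD; rewrite le_eqVlt => /predU1P[->//|xy].
by apply/ltW/incr => //; rewrite in_itv.
Qed.

Let mono' x y : (c <= x <= d)%R -> (c <= y <= d)%R -> (a x < a y)%R -> (x < y)%R.
Proof. by move=> xD yD; rewrite !ltNge; apply: contra; exact: mono. Qed.

Let cDD : (c <= c <= d)%R. Proof. by rewrite lexx ltW. Qed.
Let dDD : (c <= d <= d)%R. Proof. by rewrite lexx ltW. Qed.

(** The fundamental theorem of calculus computes the density side: according to the position of [v]
    relative to [a c] and [a d], both measures of the ray are zero, [v - a c] or [a d - a c]. *)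
Let mu12 v : mu1 `]-oo, v[%classic = mu2 `]-oo, v[%classic.
Proof.
rewrite /mu1 /mu2 /image_density_measure/= /mrestr /image_density.
have [vac|acv] := leP v (a c).
  rewrite (_ : _ `&` E = set0); last first.
    rewrite -subset0 => x [/=]; rewrite EE in_itv/= => xv /andP[acx _].
    by move: (lt_le_trans xv vac); rewrite ltNge acx.
  rewrite (_ : D `&` _ = set0) ?measure0 ?integral_set0// -subset0 => x [/=].
  rewrite DE in_itv/= => Dx axv; have := mono cDD Dx; move: (Dx) => /andP[-> _] /(_ isT).
  by rewrite leNgt (lt_le_trans axv).
have [adv|vad] := ltP (a d) v.
  rewrite (_ : _ `&` E = E); last first.
    by apply/setIidPr => x; rewrite /= EE in_itv/= => /andP[_ xad]; exact: le_lt_trans adv.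
  rewrite (_ : D `&` _ = D); last first.
    apply/setIidPl => x /=; rewrite DE in_itv/= => xD.
    by apply: le_lt_trans adv; apply: mono => //; case/andP: xD.
  by rewrite ftc// lebesgue_measure_itv/= lte_fin incr// EFinB.
have [|z zD az] := @IVT R a c d v (ltW cd) ca.
  by rewrite ge_min le_max (ltW acv) vad orbT.
have zDD : (c <= z <= d)%R by move: zD; rewrite in_itv.
rewrite (_ : _ `&` E = `[a c, a z[%classic); last first.
  apply/seteqP; split=> x /=; rewrite EE !in_itv/= az.
    by move=> [-> /andP[->]].
  by move=> /andP[-> xv]; rewrite xv (le_trans (ltW xv)).
rewrite (_ : D `&` _ = `[c, z[%classic); last first.
  apply/seteqP; split=> x /=; rewrite DE !in_itv/= -?az.
    by move=> [xD /(mono' xD zDD) ->]; case/andP: xD => ->.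
  move=> /andP[cx xz]; have xd : (x <= d)%R by case/andP: zDD => _; exact/le_trans/ltW.
  by split; [rewrite cx|apply: incr => //; rewrite in_itv/= cx].
rewrite integral_itv_bndo_bndc ?ftc//; last first.
  apply/measurable_EFinP; apply: (measurable_funS (E := D)) => // x/=.
  rewrite DE in_itv/= => /andP[-> xz]/=.
  by case/andP: zDD => _; exact/le_trans/ltW.
by rewrite lebesgue_measure_itv/= lte_fin az acv.
Qed.

(** Both sides are measures of [B]: Lebesgue measure restricted to the image interval, and the image
    under [a] of the density [a']. They agree on left rays, a generating family stable under
    intersection, hence on all Borel sets. *)
Lemma change_of_variable1 (B : set R) : measurable (B : set (measurableTypeR R)) ->
  lebesgue_measure (B `&` `[a c, a d]%classic) =
  \int[@lebesgue_measure R]_(x in `[c, d]%classic `&` a @^-1` B) (a' x)%:E.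
Proof.
move=> mB.
change (mu1 B = mu2 B).
have mu12A (A : set R) : measurable_realfun.RGenInftyO.G A -> mu1 A = mu2 A.
  by move=> [v ->]; exact: mu12.
have GI : setI_closed (@measurable_realfun.RGenInftyO.G R).
  move=> _ _ [x ->] [y ->]; exists (Num.min x y).
  by apply/seteqP; split=> z /=; rewrite !in_itv/= lt_min => /andP.
pose g (n : nat) : set R := `]-oo, n%:R[%classic.
have Gg n : (@measurable_realfun.RGenInftyO.G R) (g n) by exists n%:R.
have gT : \bigcup_n g n = setT.
  rewrite -subTset => x _; exists (Num.trunc x).+1 => //=.
  by rewrite /g/= in_itv/= truncnS_gt.
have goo n : mu1 (g n) < +oo.
  rewrite (le_lt_trans (y := @lebesgue_measure R E))//.
    by apply: le_measure; rewrite ?inE//; apply: measurableI => //; exact: measurable_itv.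
  by rewrite /E lebesgue_measure_itv/= lte_fin incr// -EFinB ltry.
exact: (@measure_unique _ R (measurableTypeR R) _ g
  (@measurable_realfun.RGenInftyO.measurableE R) GI Gg gT mu1 mu2 mu12A goo B mB).
Qed.

Lemma change_of_variable1_image (V : set R) : V `<=` `[c, d]%classic ->
  measurable (a @` V : set (measurableTypeR R)) ->
  lebesgue_measure (a @` V) = \int[@lebesgue_measure R]_(x in V) (a' x)%:E.
Proof.
move=> VD maV; have := change_of_variable1 maV.
rewrite (_ : _ `&` a @^-1` _ = V); last first.
  apply/seteqP; split=> [x [Dx [y Vy ayx]]|x Vx]; last first.
    by split; [exact: VD|exists x].
  have [xy|xy|->//] := ltgtP x y.
    by have := incr Dx (VD _ Vy) xy; rewrite ayx ltxx.
  by have := incr (VD _ Vy) Dx xy; rewrite ayx ltxx.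
rewrite (_ : _ `&` `[a c, a d]%classic = a @` V)//.
apply/setIidPl => _ [x /VD Dx <-].
have Dx' : (c <= x <= d)%R by move: Dx; rewrite /= in_itv.
by case/andP: (Dx') => cx xd; rewrite /= in_itv/= !mono.
Qed.

End change_of_variable1.

(** The decreasing case is the increasing one for [- a], Lebesgue measure being invariant under
    reflection. *)
Lemma change_of_variable1_abs (R : realType) (a a' : R -> R) (c d : R) (V : set R) :
  c < d -> (forall x, x \in `[c, d] -> is_derive x 1 a (a' x)) ->
  {within `[c, d], continuous a'} ->
  (forall x, x \in `[c, d] -> 0 < a' x) \/ (forall x, x \in `[c, d] -> a' x < 0) ->
  V `<=` `[c, d]%classic -> measurable (a @` V : set (measurableTypeR R)) ->
  lebesgue_measure (a @` V) = (\int[@lebesgue_measure R]_(x in V) `|a' x|%:E)%E.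
Proof.
move=> cd da ca' [a0|a0] VD maV.
  rewrite (change_of_variable1_image cd da ca' a0 VD maV).
  by apply: eq_integral => x /[!inE] /VD/a0/gtr0_norm ->.
have da2 (x : R) : x \in `[c, d] -> is_derive x 1 (- a) (- a' x).
  by move=> /da h; exact: is_deriveN.
have ca2 : {within `[c, d], continuous (fun x => - a' x)}.
  by move=> x; apply: continuousN; exact: ca'.
have a02 (x : R) : x \in `[c, d] -> 0 < - a' x by move=> /a0; rewrite oppr_gt0.
have NV : (- a) @` V = -%R @^-1` (a @` V).
  apply/seteqP; split=> [_ [x Vx <-]|y [x Vx axy]]; exists x => //=; rewrite ?opprK//.
  by rewrite -[LHS]/(- (a x)) axy opprK.
have mNV : measurable ((- a) @` V : set (measurableTypeR R)).
  rewrite NV -[X in measurable X]setTI; exact: (oppr_measurable measurableT).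
have := change_of_variable1_image cd da2 ca2 a02 VD mNV.
rewrite NV [LHS](_ : _ = lebesgue_measure (a @` V)).
  by move=> ->; apply: eq_integral => x /[!inE] /VD/a0/ltr0_norm ->.
by have := lebesgue_measureN maV.
Qed.

Section integral_density_on.
Local Open Scope ereal_scope.
Context d1 d2 (T1 : measurableType d1) (T2 : measurableType d2) (R : realType).
Context (mu : {measure set T1 -> \bar R}) (nu : {measure set T2 -> \bar R}).
Context (E : set T1) (D : set T2) (f : T2 -> T1) (rho : T2 -> R).
Hypotheses (mE : measurable E) (mD : measurable D).
Hypothesis mf : measurable_fun D f.
Hypothesis mrho : measurable_fun D rho.
Hypothesis rho0 : forall x, D x -> (0 <= rho x)%R.
Hypothesis fDE : forall x, D x -> E (f x).
Hypothesis muE : forall B, measurable B -> B `<=` E ->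
  mu B = \int[nu]_(x in D `&` f @^-1` B) (rho x)%:E.

Let muD : {measure set T1 -> \bar R} := mrestr mu mE.

Let integral_muD (g : T1 -> \bar R) : measurable_fun setT g -> (forall y, 0 <= g y) ->
  \int[muD]_y g y = \int[mu]_(y in E) g y.
Proof.
move=> mg g0.
rewrite (@ge0_integral_density _ _ T1 T1 R muD mu E id (fun=> 1%R))//.
  by apply: eq_integral => y _; rewrite mule1.
move=> B mB; rewrite -[muD B]/(mu (B `&` E)) setIC integral_cst ?mul1e//; exact: measurableI.
Qed.

(** [muE] is available only for subsets of [E]; restricting [mu] to [E] reduces to
    [ge0_integral_density]. *)
Lemma ge0_integral_density_on (g : T1 -> \bar R) :
  measurable_fun setT g -> (forall y, 0 <= g y) ->
  \int[mu]_(y in E) g y = \int[nu]_(x in D) (g (f x) * (rho x)%:E).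
Proof.
move=> mg g0; rewrite -integral_muD//.
apply: (@ge0_integral_density _ _ T1 T2 R muD nu D f rho) => // B mB.
rewrite -[muD B]/(mu (B `&` E)) muE//; last exact: measurableI.
by congr (integral _ _ _); apply/seteqP; split=> x [Dx]; [case|split=> //; split=> //; exact: fDE].
Qed.

End integral_density_on.

#[local] Opaque derive.jacobian derive.diff.

Section jacobian_matrices.
Context (R : realType).

Lemma J_comp m n p (h : 'rV[R]_m -> 'rV[R]_n) (g : 'rV[R]_n -> 'rV[R]_p) u :
  differentiable h u -> differentiable g (h u) ->
  'J (g \o h) u = 'J h u *m 'J g (h u).
Proof.
move=> dh dg; apply/row_matrixP => i.
by rewrite row_mul !rowJ diff_comp//= mulJ.
Qed.

Lemma J_near_eq m n (g h : 'rV[R]_m -> 'rV[R]_n) (U : set 'rV[R]_m) u :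
  open U -> (forall w, U w -> g w = h w) -> U u -> differentiable g u ->
  'J h u = 'J g u.
Proof.
move=> oU gh Uu dg.
have ghu : {near u, g =1 h}.
  by move: (open_nbhs_nbhs (conj oU Uu)); apply: filterS.
have E := (diff_near_eq ghu dg).2.
apply/matrixP => i j.
rewrite [LHS]JE.
rewrite [RHS]JE.
exact: (congr1 (fun F : _ -> 'rV[R]_n => F (delta_mx 0 i) 0 j) E).
Qed.

Lemma measurable_detJ m (U : set 'rV[R]_m) (h : 'rV[R]_m -> 'rV[R]_m) :
  open U -> Cr 1 U h ->
  measurable_fun (U : set (borel _)) (fun u : borel _ => `|\det ('J h u)|).
Proof.
move=> oU hU; apply: (within_continuous_borelR (open_borel oU)).
apply: within_continuous => u Uu.
have cJ := Cr1_J hU Uu.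
have cd : {for u, continuous (fun u => \det ('J h u))} by exact: cvg_det cJ.
exact: (cvg_comp _ _ cd (@norm_continuous _ R^o (\det ('J h u)))).
Qed.

Lemma Cr1_measurable m n (U : set 'rV[R]_m) (h : 'rV[R]_m -> 'rV[R]_n) :
  open U -> Cr 1 U h ->
  measurable_fun (U : set (borel _)) (h : borel _ -> borel 'rV[R]_n).
Proof.
move=> oU hU; apply: (within_continuous_borel (open_borel oU)).
by apply: within_continuous => u Uu; exact: Cr1_continuous hU Uu.
Qed.

End jacobian_matrices.

(** * C^1 diffeomorphisms and their change of variables formula *)

Section diffeomorphisms.
Context (R : realType) (m : nat).
Implicit Types (U V : set 'rV[R]_m) (h k : 'rV[R]_m -> 'rV[R]_m).

Lemma diffeo_sym U U' h k : diffeo U U' h k -> diffeo U' U k h.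
Proof. by move=> [oU oU' hU kU' [h1 h2]]. Qed.

Lemma diffeo_inj U U' h k : diffeo U U' h k -> {in U &, injective h}.
Proof.
move=> [_ _ _ _ [h1 _]] x y /[!inE] Ux Uy hxy.
by rewrite -(h1 _ Ux).2 hxy (h1 _ Uy).2.
Qed.

Lemma diffeo_image U U' h k V : diffeo U U' h k -> V `<=` U ->
  h @` V = U' `&` k @^-1` V.
Proof.
move=> [_ _ _ _ [h1 h2]] VU; apply/seteqP; split=> [_ [u Vu <-]|v [U'v Vkv]].
  by have [U'h kh] := h1 _ (VU _ Vu); split; rewrite //= kh.
by exists (k v) => //; exact: (h2 _ U'v).2.
Qed.

Lemma diffeo_image_measurable U U' h k V : diffeo U U' h k -> V `<=` U ->
  measurable (V : set (borel _)) -> measurable (h @` V : set (borel _)).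
Proof.
move=> d VU mV; rewrite (diffeo_image d VU).
case: d => _ oU' _ kU' _; exact: (Cr1_measurable oU' kU' (open_borel oU') mV).
Qed.

Lemma diffeo_sub U U' h k W : diffeo U U' h k -> open W -> W `<=` U ->
  diffeo W (h @` W) h k.
Proof.
move=> d oW WU; have hW := diffeo_image d WU.
case: d => oU oU' hU kU' [h1 h2].
split=> //.
- rewrite hW; rewrite openE => v [U'v Wkv].
  apply: filterI; first by apply: open_nbhs_nbhs.
  by apply: (Cr1_continuous kU' U'v); exact: open_nbhs_nbhs.
- exact: Cr1_sub hU.
- by apply: Cr1_sub kU' => v; rewrite hW => -[].
- split=> [u Wu|_ [u Wu <-]]; first by split; [exists u|exact: (h1 _ (WU _ Wu)).2].
  by rewrite (h1 _ (WU _ Wu)).2.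
Qed.

Lemma diffeo_comp U U' U'' h k h' k' : diffeo U U' h k -> diffeo U' U'' h' k' ->
  diffeo U U'' (h' \o h) (k \o k').
Proof.
move=> [oU oU' hU kU' [h1 h2]] [_ oU'' hU' kU'' [h1' h2']].
split; [exact: oU|exact: oU''| | |].
- by apply: (Cr1_comp oU _ hU hU') => u /h1[].
- by apply: (Cr1_comp oU'' _ kU'' kU') => u /h2'[].
- split=> [u Uu|v Uv] /=.
    have [U'h kh] := h1 _ Uu; have [? ->] := h1' _ U'h; by split.
  have [U'h kh] := h2' _ Uv; have [? ->] := h2 _ U'h; by split.
Qed.

Lemma diffeo_J_unit U U' h k u : diffeo U U' h k -> U u -> 'J h u \in unitmx.
Proof.
move=> [oU oU' [hU _] [kU' _] [h1 h2]] Uu.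
have [U'hu khu] := h1 _ Uu.
have dh := hU _ Uu; have dk := kU' _ U'hu.
have : 'J h u *m 'J k (h u) = 1%:M.
  rewrite -J_comp//.
  rewrite (@J_near_eq R m m id _ U u)//; last by move=> w /h1[].
  by apply/row_matrixP => i; rewrite rowJ diff_val/= row1.
by move=> H; exact: (mulmx1_unit H).1.
Qed.

End diffeomorphisms.

(** The change of variables formula as a property of a map on a set, so that it can be composed,
    localized and glued. [cov_integral] extends it from sets to integrals. *)
Definition cov (R : realType) m (U : set 'rV[R]_m) (h : 'rV[R]_m -> 'rV[R]_m) :=
  forall V, measurable (V : set (borel _)) -> V `<=` U ->
  measurable (h @` V : set (borel _)) /\
  leb R m (h @` V) = (\int[leb R m]_(u in V) `|\det ('J h u)|%:E)%E.

Section cov_calculus.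
Local Open Scope ereal_scope.
Context (R : realType) (m : nat).
Implicit Types (U V : set 'rV[R]_m) (h g k : 'rV[R]_m -> 'rV[R]_m).

Lemma cov_integral U h V (F : 'rV[R]_m -> \bar R) : cov U h -> open U -> Cr 1 U h ->
  measurable (V : set (borel _)) -> V `<=` U ->
  measurable_fun setT (F : borel _ -> \bar R) -> (forall y, 0 <= F y) ->
  \int[leb R m]_(y in h @` V) F y =
  \int[leb R m]_(u in V) (F (h u) * `|\det ('J h u)|%:E).
Proof.
move=> ch oU hU mV VU mF F0.
apply: (@ge0_integral_density_on _ _ (borel 'rV[R]_m) (borel 'rV[R]_m) R
  (leb R m) (leb R m) (h @` V) V h (fun u => `|\det ('J h u)|)%R) => //.
- exact: (ch V mV VU).1.
- exact: (measurable_funS (open_borel oU) VU (Cr1_measurable oU hU)).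
- exact: (measurable_funS (open_borel oU) VU (measurable_detJ oU hU)).
- move=> B mB BhV.
  have mVB : measurable (V `&` h @^-1` B : set (borel _)).
    exact: (measurable_funS (open_borel oU) VU (Cr1_measurable oU hU) mV mB).
  have [_ <-] := ch _ mVB (subset_trans (@subIsetl _ _ _) VU).
  congr (leb R m); apply/seteqP; split=> [y By|_ [x [Vx Bx] <-]//].
  by have [x Vx xy] := BhV _ By; exists x => //; split=> //; rewrite /= xy.
Qed.

Lemma cov_eq U h g : open U -> (forall u, U u -> h u = g u) -> Cr 1 U h ->
  cov U h -> cov U g.
Proof.
move=> oU hg [dh _] ch V mV VU.
have -> : g @` V = h @` V.
  by apply/seteqP; split=> _ [x Vx <-]; exists x => //; rewrite hg//; exact: VU.
have [mhV ->] := ch V mV VU; split; first exact: mhV.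
apply: eq_integral => u /[!inE] /VU Uu.
exact: (congr1 (fun J => `|\det J|%:E) (esym (J_near_eq oU hg Uu (dh _ Uu)))).
Qed.

(** The formula for [g] integrates its Jacobian factor over the image of [V] under [h], the formula
    for [h] pulls this integral back to [V], and determinants multiply by the chain rule. *)
Lemma cov_comp U U' h g : open U -> open U' -> Cr 1 U h -> Cr 1 U' g ->
  (forall u, U u -> U' (h u)) -> cov U h -> cov U' g -> cov U (g \o h).
Proof.
move=> oU oU' hU gU' hUU' ch cg V mV VU.
have [mhV hV] := ch V mV VU.
have hVU' : h @` V `<=` U' by move=> _ [u /VU/hUU' ? <-].
have [mghV ghV] := cg _ mhV hVU'.
rewrite -image_comp; split; [exact: mghV|rewrite ghV].
(* Extended by zero off the image, since [cov_integral] takes a function that is measurable on the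
   whole space. *)
pose F : 'rV[R]_m -> \bar R := (EFin \o (fun u => `|\det ('J g u)|)%R) \_ (h @` V).
have F0 y : 0 <= F y by rewrite /F patchE; case: ifPn => // _; rewrite lee_fin.
have mF : measurable_fun setT (F : borel _ -> \bar R).
  apply/(measurable_restrictT _ mhV); apply/measurable_EFinP.
  exact: (measurable_funS (open_borel oU') hVU' (measurable_detJ oU' gU')).
transitivity (\int[leb R m]_(y in h @` V) F y).
  by apply: eq_integral => y yV; rewrite /F patchE yV.
rewrite (cov_integral ch oU hU mV VU mF F0).
apply: eq_integral => u /[!inE] Vu; rewrite /F patchE mem_set; last by exists u.
rewrite J_comp; [|exact: (hU.1 _ (VU _ Vu))|exact: (gU'.1 _ (hUU' _ (VU _ Vu)))].
by rewrite det_mulmx normrM mulrC EFinM.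
Qed.

(** The cover is cut into disjoint pieces by [seqDU]; injectivity keeps their images disjoint, so
    both sides are countably additive over the pieces. *)
Lemma cov_bigcup U (W : nat -> set 'rV[R]_m) h : open U -> Cr 1 U h ->
  {in U &, injective h} ->
  (forall i, open (W i)) -> (forall i, cov (W i) h) -> U `<=` \bigcup_i W i ->
  cov U h.
Proof.
move=> oU hU hinj oW cW UW V mV VU.
pose D := seqDU W.
have mD i : measurable (D i : set (borel _)).
  apply: (@measurableD _ (borel 'rV[R]_m)); first exact: open_borel.
  apply: (@bigsetU_measurable _ (borel 'rV[R]_m)) => j _; exact: open_borel.
have VE : V = \bigcup_i (V `&` D i).
  rewrite -setI_bigcupr -seqDU_bigcup_eq; apply/esym/setIidPl.
  exact: subset_trans UW.
have mVD i : measurable (V `&` D i : set (borel _)) by exact: measurableI.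
have VDW i : V `&` D i `<=` W i by move=> x [_ []].
have tVD : trivIset setT (fun i => V `&` D i).
  by apply: trivIset_setIl; exact: trivIset_seqDU.
have thVD : trivIset setT (fun i => h @` (V `&` D i)).
  move=> i j _ _ [_ [[x [Vx Dx] <-] [y [Vy Dy] hyx]]].
  apply: tVD => //; exists x; split=> //.
  by have <- : y = x by apply: hinj; rewrite ?inE//; exact: VU.
have chD i := cW i _ (mVD i) (VDW i).
have hVE : h @` V = \bigcup_i (h @` (V `&` D i)) by rewrite {1}VE image_bigcup.
have mhV : measurable (h @` V : set (borel _)).
  by rewrite hVE; apply: bigcupT_measurable => i; exact: (chD i).1.
split=> //; rewrite hVE measure_semi_bigcup//; last 2 first.
- by move=> i; exact: (chD i).1.
- by rewrite -hVE.
rewrite [in RHS]VE ge0_integral_bigcup//; last first.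
- rewrite -VE; apply/measurable_EFinP.
  exact: (measurable_funS (open_borel oU) VU (measurable_detJ oU hU)).
- by apply: eq_eseriesr => i _; exact: (chD i).2.
Qed.

Lemma cov_local U h : open U -> Cr 1 U h -> {in U &, injective h} ->
  (forall u, U u -> exists W, [/\ open W, W u & cov W h]) -> cov U h.
Proof.
move=> oU hU hinj H.
have [|W [oW cW UW]] := @second_countable_cover 'rV[R]_m U (fun W => cov W h)
    (@rV_second_countable R m) _ H.
  move=> V mV; rewrite subset0 => ->; rewrite image_set0 measure0 integral_set0.
  by split.
exact: (cov_bigcup oU hU hinj oW cW UW).
Qed.

End cov_calculus.

Section slices.
Local Open Scope ereal_scope.
Context (R : realType) (m : nat).
Implicit Types (A V : set 'rV[R]_m.+1).

Definition slice1 A (x : R) : set 'rV[R]_m := [set t | A (consr x t)].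
Definition slice2 A (t : 'rV[R]_m) : set R := [set x | A (consr x t)].

Let indic A (mA : measurable (A : set (borel _))) :
  leb R m.+1 A = \int[leb R m.+1]_u (\1_A u)%:E.
Proof. by rewrite integral_indic// setIT. Qed.

Let m1 A (mA : measurable (A : set (borel _))) :
  measurable_fun setT (fun u : borel 'rV[R]_m.+1 => (\1_A u)%:E : \bar R).
Proof. by apply/measurable_EFinP; exact: measurable_indic. Qed.

Lemma measurable_slice1_set A x : measurable (A : set (borel _)) ->
  measurable (slice1 A x : set (borel _)).
Proof.
move=> mA; have := measurable_slice1 (m1 mA) x.
move=> /measurable_EFinP/measurable_indicP; exact.
Qed.

Lemma measurable_slice2_set A t : measurable (A : set (borel _)) ->
  measurable (slice2 A t : set (measurableTypeR R)).
Proof.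
move=> mA; have := measurable_slice2 (m1 mA) t.
move=> /measurable_EFinP/measurable_indicP; exact.
Qed.

Lemma leb_slice1 A : measurable (A : set (borel _)) ->
  leb R m.+1 A = \int[@lebesgue_measure R]_x leb R m (slice1 A x).
Proof.
move=> mA; rewrite indic// leb_tonelli1//; last exact: m1.
apply: eq_integral => x _.
transitivity (\int[leb R m]_y (\1_(slice1 A x) y)%:E); first by [].
rewrite integral_indic ?setIT//; exact: measurable_slice1_set.
Qed.

Lemma leb_slice2 A : measurable (A : set (borel _)) ->
  leb R m.+1 A = \int[leb R m]_t lebesgue_measure (slice2 A t).
Proof.
move=> mA; rewrite indic// leb_tonelli2//; last exact: m1.
apply: eq_integral => t _.
transitivity (\int[@lebesgue_measure R]_x (\1_(slice2 A t) x)%:E); first by [].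
rewrite integral_indic ?setIT//; exact: measurable_slice2_set.
Qed.

Lemma patch_slice1 (F : 'rV[R]_m.+1 -> \bar R) A x :
  (fun t => (F \_ A) (consr x t)) = (fun t => F (consr x t)) \_ (slice1 A x).
Proof. by apply/funext => t; rewrite !patchE; congr (if _ then _ else _); apply/asbool_equiv_eq. Qed.

Lemma patch_slice2 (F : 'rV[R]_m.+1 -> \bar R) A t :
  (fun x => (F \_ A) (consr x t)) = (fun x => F (consr x t)) \_ (slice2 A t).
Proof. by apply/funext => x; rewrite !patchE; congr (if _ then _ else _); apply/asbool_equiv_eq. Qed.

Lemma integral_slice1 A (F : 'rV[R]_m.+1 -> \bar R) : measurable (A : set (borel _)) ->
  measurable_fun (A : set (borel _)) F -> (forall u, A u -> 0 <= F u) ->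
  \int[leb R m.+1]_(u in A) F u =
  \int[@lebesgue_measure R]_x \int[leb R m]_(t in slice1 A x) F (consr x t).
Proof.
move=> mA mF F0; rewrite integral_mkcond leb_tonelli1.
- by apply: eq_integral => x _; rewrite [RHS]integral_mkcond patch_slice1.
- exact/(measurable_restrictT _ mA).
- by move=> u; exact: erestrict_ge0.
Qed.

Lemma integral_slice2 A (F : 'rV[R]_m.+1 -> \bar R) : measurable (A : set (borel _)) ->
  measurable_fun (A : set (borel _)) F -> (forall u, A u -> 0 <= F u) ->
  \int[leb R m.+1]_(u in A) F u =
  \int[leb R m]_t \int[@lebesgue_measure R]_(x in slice2 A t) F (consr x t).
Proof.
move=> mA mF F0; rewrite integral_mkcond leb_tonelli2.
- by apply: eq_integral => t _; rewrite [RHS]integral_mkcond patch_slice2.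
- exact/(measurable_restrictT _ mA).
- by move=> u; exact: erestrict_ge0.
Qed.

End slices.

Section cov_first.
Context (R : realType) (m : nat) (U : set 'rV[R]_m.+1) (f : 'rV[R]_m.+1 -> R^o).
Hypotheses (oU : open U) (fU : Cr 1 U f).
Let e0 : 'rV[R]_m.+1 := delta_mx 0 0.
Let g u := consr (f u) (tl u).
Hypothesis df0 : forall u, U u -> 'd f u e0 != 0.
Hypothesis ginj : {in U &, injective g}.

Lemma det_straight u : U u -> \det ('J g u) = 'd f u e0.
Proof.
move=> Uu; rewrite (expand_det_row _ ord0) big_ord_recl big1 ?addr0; last first.
  move=> j _; rewrite [X in X * _](_ : _ = 0) ?mul0r// JE (diff_straight oU fU _ Uu) consrS.
  by rewrite !mxE.
rewrite JE (diff_straight oU fU _ Uu) consr0 /cofactor expr0 mul1r.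
rewrite (_ : row' _ _ = 1%:M) ?det1 ?mulr1//.
apply/matrixP => i j; rewrite [LHS]mxE [LHS]mxE JE (diff_straight oU fU _ Uu) consrS !mxE.
by rewrite (inj_eq lift_inj) eq_sym.
Qed.

(** On each line parallel to [e0] the map [g] acts by a function of one variable whose derivative
    is, by [det_straight], the Jacobian determinant of [g]; Tonelli reduces the claim to the
    interval case. *)
Lemma cov_first : cov U g.
Proof.
have gU : Cr 1 U g by exact: Cr1_consr oU fU (Cr1_tl oU).
apply: (cov_local oU gU ginj) => u0 Uu0.
have [e [k [e_gt0 eU sgn dg]]] := straighten oU fU Uu0 (df0 Uu0).
(* Half the radius, so that the closed interval from [c] to [d], which contains the slices of [W],
   still lies in the ball where the derivative keeps its sign. *)
have e2 : 0 < e / 2 by rewrite divr_gt0.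
have e2e : e / 2 < e by rewrite gtr_pMr// invf_lt1// ltr1n.
pose W := ball u0 (e / 2).
have WB : W `<=` ball u0 e by apply: le_ball; exact: ltW.
exists W; split; [exact: ball_open|exact: ballxx|] => V mV VW.
have VB : V `<=` ball u0 e by exact: subset_trans WB.
have VU : V `<=` U by exact: subset_trans eU.
have mgV := diffeo_image_measurable dg VB mV.
split; first exact: mgV.
rewrite leb_slice2// integral_slice2//; last first.
  apply/measurable_EFinP.
  exact: (measurable_funS (open_borel oU) VU (measurable_detJ oU gU)).
apply: eq_integral => t _.
have slE : slice2 (g @` V) t = (fun x => f (consr x t)) @` slice2 V t.
  apply/seteqP; split=> [x [u Vu]|_ [x Vx <-]].
    move=> /(congr1 (fun w : 'rV[R]_m.+1 => (w ord0 ord0, tl w))).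
    rewrite /g !consr0 !tl_consr => -[fx tu]; exists (u ord0 ord0).
      by rewrite /slice2/= -tu consr_tl.
    by rewrite -tu consr_tl.
  by exists (consr x t); rewrite // /g tl_consr.
have [V0|/set0P[x1 Vx1]] := eqVneq (slice2 V t) set0.
  by rewrite slE V0 image_set0 measure0 integral_set0.
have WE x s : W (consr x s) <-> ball (u0 0 ord0) (e / 2) x /\ ball (tl u0) (e / 2) s.
  by rewrite /W -{1}(consr_tl u0) ball_consr.
have BE x s : ball u0 e (consr x s) <-> ball (u0 0 ord0) e x /\ ball (tl u0) e s.
  by rewrite -{1}(consr_tl u0) ball_consr.
have [_ bt] := (WE _ _).1 (VW _ Vx1).
pose c := u0 0 ord0 - e / 2; pose d := u0 0 ord0 + e / 2.
have cd : c < d by rewrite /c /d; lra.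
have cdB x : x \in `[c, d] -> ball u0 e (consr x t).
  rewrite in_itv/= /c /d => /andP[cx xd]; apply/BE; split.
    by rewrite /ball/= ltr_norml; apply/andP; split; lra.
  by apply: le_ball bt; exact: ltW.
have cdU x : x \in `[c, d] -> U (consr x t) by move=> /cdB/eU.
pose a (x : R) : R := f (consr x t); pose a' (x : R) : R := 'd f (consr x t) e0.
have da (x : R) : x \in `[c, d] -> is_derive x 1 a (a' x).
  by move=> /cdU; exact: slice_derive.
have ca' : {within `[c, d], continuous a'}.
  apply: continuous_in_subspaceT => x /[!inE] xcd.
  have c1 : consr y t @[y --> x] --> consr x t.
    by apply: (@consr_continuous R m _ (nbhs x) _ id (cst t)); [exact: cvg_id|exact: cvg_cst].
  exact: cvg_comp _ _ c1 (fU.2 e0 _ (cdU _ xcd)).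
have a0 : (forall x, x \in `[c, d] -> 0 < a' x) \/ (forall x, x \in `[c, d] -> a' x < 0).
  by case: sgn => h; [left|right] => x /cdB; exact: h.
have Vcd : slice2 V t `<=` `[c, d]%classic.
  move=> x Vx; have [+ _] := (WE _ _).1 (VW _ Vx).
  rewrite /ball/= ltr_norml in_itv/= /c /d => /andP[h1 h2].
  by apply/andP; split; lra.
rewrite slE.
have maV : measurable (a @` slice2 V t : set (measurableTypeR R)).
  by rewrite /a -slE; exact: measurable_slice2_set.
rewrite (change_of_variable1_abs cd da ca' a0 Vcd maV).
by apply: eq_integral => x /[!inE] Vx; rewrite det_straight//; exact: VU.
Qed.

End cov_first.

Section cov_rest.
Context (R : realType) (m : nat) (U U' : set 'rV[R]_m.+1)
  (h k : 'rV[R]_m.+1 -> 'rV[R]_m.+1).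
Hypothesis dh : diffeo U U' h k.
Hypothesis h0 : forall u, U u -> h u ord0 ord0 = u ord0 ord0.
Hypothesis IH : forall (V V' : set 'rV[R]_m) p q, diffeo V V' p q -> cov V p.

Let hs x (t : 'rV[R]_m) := tl (h (consr x t)).
Let ks x (t : 'rV[R]_m) := tl (k (consr x t)).

Lemma consr_slice_continuous x : continuous (fun t : 'rV[R]_m => consr x t).
Proof.
move=> t; apply: (@consr_continuous R m _ (nbhs t) _ (cst x) id); last exact: cvg_id.
exact: cvg_cst.
Qed.

Lemma open_slice1 (A : set 'rV[R]_m.+1) x : open A -> open (slice1 A x).
Proof. by move: A; apply/continuousP; exact: consr_slice_continuous. Qed.

Lemma Cr1_consr_slice x (V : set 'rV[R]_m) : open V -> Cr 1 V (fun t => consr x t).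
Proof. by move=> oV; apply: Cr1_consr => //; [exact: Cr1_cst|exact: Cr1_id]. Qed.

Let hsE x t : U (consr x t) -> h (consr x t) = consr x (hs x t).
Proof. by move=> Ux; rewrite -[LHS]consr_tl h0// consr0. Qed.

Let ksE x t : U' (consr x t) -> k (consr x t) = consr x (ks x t).
Proof.
case: dh => _ _ _ _ [_ h2] U'x; have [Uk hk] := h2 _ U'x.
by rewrite -[LHS]consr_tl -(h0 Uk) hk consr0.
Qed.

Lemma diffeo_slice x : diffeo (slice1 U x) (slice1 U' x) (hs x) (ks x).
Proof.
case: (dh) => oU oU' hU kU' [h1 h2].
have o1 : open (slice1 U x) := open_slice1 oU; have o2 : open (slice1 U' x) := open_slice1 oU'.
have tlC := @Cr1_tl R m setT openT.
split=> //.
- apply: (Cr1_comp o1 _ (Cr1_comp o1 _ (Cr1_consr_slice x o1) hU) tlC) => //.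
- apply: (Cr1_comp o2 _ (Cr1_comp o2 _ (Cr1_consr_slice x o2) kU') tlC) => //.
- split=> t Ut; rewrite /slice1/=.
    have [] := h1 _ Ut; rewrite hsE// => U'h kh; split=> //.
    by rewrite /ks kh tl_consr.
  have [] := h2 _ Ut; rewrite ksE// => U'h kh; split=> //.
  by rewrite /hs kh tl_consr.
Qed.

Lemma diff_consr_slice x t v : 'd (fun t : 'rV[R]_m => consr x t) t v = consr 0 v.
Proof.
have dc := (Cr1_consr_slice x openT).1 t Logic.I.
apply/rowP => i; case: (unliftP ord0 i) => [j ->|->].
  rewrite consrS -(diff_coord v (lift ord0 j) dc).2.
  rewrite (_ : (fun y => _) = (fun y : 'rV[R]_m => id y 0 j : R^o)).
    have di : differentiable (id : 'rV[R]_m -> _) t by [].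
    by rewrite (diff_coord v j di).2 diff_val.
  by apply/funext => y; rewrite consrS.
rewrite consr0 -(diff_coord v ord0 dc).2.
rewrite (_ : (fun y => _) = cst x); first by rewrite diff_cst.
by apply/funext => y; rewrite consr0.
Qed.

(** As [h] preserves the first coordinate, the first column of its Jacobian matrix is that of the
    identity; expanding along it leaves the Jacobian determinant of the slice. *)
Lemma det_slice x t : U (consr x t) -> \det ('J h (consr x t)) = \det ('J (hs x) t).
Proof.
move=> Ux; case: (dh) => oU _ [dhU _] _ _.
have dhx := dhU _ Ux.
have J0 i : 'J h (consr x t) i ord0 = (i == ord0)%:R.
  rewrite JE -(diff_coord _ ord0 dhx).2.
  have H : {near consr x t, (fun y : 'rV[R]_m.+1 => y ord0 ord0 : R^o) =1
      (fun y => h y ord0 ord0 : R^o)}.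
    move: (open_nbhs_nbhs (conj oU Ux)); apply: filterS => y Uy.
    by rewrite h0.
  have di : differentiable (id : 'rV[R]_m.+1 -> _) (consr x t) by [].
  have [d1 e1] := diff_coord (delta_mx 0 i) ord0 di.
  rewrite (diff_near_eq H d1).2 e1 diff_val mxE eqxx/=.
  by rewrite eq_sym.
rewrite (expand_det_col _ ord0) big_ord_recl big1 ?addr0; last first.
  by move=> j _; rewrite J0 mul0r.
rewrite J0 mul1r /cofactor expr0 mul1r; congr (\det _).
apply/matrixP => i j; rewrite [LHS]mxE [LHS]mxE [LHS]JE [RHS]JE.
have dc := (Cr1_consr_slice x openT).1 t Logic.I.
have dhc : differentiable (h \o consr x) t by exact: differentiable_comp.
rewrite /hs (_ : (fun t => _) = tl \o (h \o consr x))// (diff_tl _ dhc) mxE.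
rewrite (diff_comp dc dhx)/= diff_consr_slice.
suff -> : consr 0 (delta_mx 0 i) = delta_mx 0 (lift ord0 i) :> 'rV[R]_m.+1 by [].
apply/rowP => l; rewrite [RHS]mxE eqxx/=; case: (unliftP ord0 l) => [p ->|->].
  by rewrite consrS mxE eqxx/= (inj_eq lift_inj).
by rewrite consr0.
Qed.

(** Within each hyperplane of constant first coordinate, [h] is a diffeomorphism in one dimension
    less, to which [IH] applies; Tonelli integrates the slices. *)
Lemma cov_rest : cov U h.
Proof.
move=> V mV VU; have mhV := diffeo_image_measurable dh VU mV.
case: (dh) => oU oU' hU kU' [h1 h2].
split; first exact: mhV.
rewrite leb_slice1// integral_slice1//; last first.
  apply/measurable_EFinP.
  exact: (measurable_funS (open_borel oU) VU (measurable_detJ oU hU)).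
apply: eq_integral => x _.
have slE : slice1 (h @` V) x = hs x @` slice1 V x.
  apply/seteqP; split=> [t [u Vu hu]|_ [t Vt <-]].
    have u0 : u ord0 ord0 = x by rewrite -h0 ?hu ?consr0//; exact: VU.
    exists (tl u); first by rewrite /slice1/= -u0 consr_tl.
    by rewrite /hs -u0 consr_tl hu tl_consr.
  by exists (consr x t) => //; rewrite hsE//; exact: VU.
have mVx := measurable_slice1_set x mV.
have VxU : slice1 V x `<=` slice1 U x by move=> t; exact: VU.
have [_ lE] := IH (diffeo_slice x) mVx VxU.
rewrite slE lE; apply: eq_integral => t /[!inE] Vt.
by rewrite det_slice//; exact: VU.
Qed.

End cov_rest.

Section shear.
Context (R : realType) (m : nat).
Implicit Types (l : 'rV[R]_m) (u v : 'rV[R]_m.+1).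

(** The first coefficient 1 makes [shear l] invertible with inverse [shear (- l)]; the other
    coefficients [l] are free, to move a given vector off the kernel of the form. *)
Definition shear_form l u : R := u ord0 ord0 + (tl u *m l^T) 0 0.
Definition shear l u := consr (shear_form l u) (tl u).

Lemma shear_formE l u : shear_form l u = (u *m (consr 1 l)^T) 0 0.
Proof.
rewrite /shear_form [RHS]mxE big_ord_recl [_^T ord0 0]mxE consr0 mulr1.
congr (_ + _); rewrite mxE; apply: eq_bigr => j _.
by rewrite !mxE liftK.
Qed.

Lemma shearK l : cancel (shear l) (shear (- l)).
Proof.
move=> u; rewrite /shear /shear_form consr0 tl_consr linearN/= mulmxN.
by rewrite [X in _ + X]mxE addrK consr_tl.
Qed.

Lemma shearNK l : cancel (shear (- l)) (shear l).
Proof. by move=> u; rewrite -{1}[l]opprK shearK. Qed.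

Lemma Cr1_shear_form l (X : normedModType R) (U : set X) (h : X -> 'rV[R]_m.+1) :
  open U -> Cr 1 U h -> Cr 1 U (fun x => shear_form l (h x) : R^o).
Proof.
move=> oU hU.
rewrite (_ : (fun x => _) = (fun x => (h x *m (consr 1 l)^T) 0 0 : R^o)); last first.
  by apply/funext => x; rewrite shear_formE.
apply: (Cr1_coord _ oU).
exact: (Cr1_comp (U' := setT) oU (fun _ _ => Logic.I) hU (Cr1_mulmxr _ _)).
Qed.

Lemma diff_shear_form l (X : normedModType R) (h : X -> 'rV[R]_m.+1) (x v : X) :
  differentiable h x ->
  'd (fun x => shear_form l (h x) : R^o) x v = shear_form l ('d h x v).
Proof.
move=> dhx.
rewrite (_ : (fun x => _) = (fun x => (h x *m (consr 1 l)^T) 0 0 : R^o)); last first.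
  by apply/funext => y; rewrite shear_formE.
have [dm em] := diff_mulmxr (consr 1 l)^T (h x).
have dc : differentiable (fun x => h x *m (consr 1 l)^T) x.
  exact: (differentiable_comp dhx dm).
rewrite (diff_coord v 0 dc).2 shear_formE.
rewrite (_ : (fun x => h x *m _) = (fun v => v *m (consr 1 l)^T) \o h)//.
by rewrite (diff_comp dhx dm)/= em.
Qed.

Lemma Cr1_shear l U : open U -> Cr 1 U (shear l).
Proof.
move=> oU; apply: Cr1_consr => //; last exact: Cr1_tl.
exact: (@Cr1_shear_form l _ _ id oU (@Cr1_id _ _ _)).
Qed.

Lemma diffeo_shear l : diffeo setT setT (shear l) (shear (- l)).
Proof.
split; [exact: openT|exact: openT|exact: Cr1_shear openT|exact: Cr1_shear openT|].
by split=> u _; [rewrite shearK|rewrite shearNK].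
Qed.

Lemma cov_shear l : cov setT (shear l).
Proof.
apply: cov_first; [exact: openT|exact: (@Cr1_shear_form l _ _ id openT (@Cr1_id _ _ _))| |].
  move=> u _; rewrite (@diff_shear_form l _ id)// diff_val/= /shear_form.
  rewrite (_ : tl _ = 0) ?mul0mx ?[X in _ + X]mxE ?addr0 ?mxE ?eqxx ?oner_neq0//.
  by apply/rowP => j; rewrite !mxE.
exact: (diffeo_inj (diffeo_shear l)).
Qed.

End shear.

(* A C^1 diffeomorphism is locally [shear (- l) \o kappa \o g] where g changes
   the first coordinate only and kappa preserves it; Fubini reduces g to
   dimension 1 and kappa to the previous dimension. *)
Theorem change_of_variables (R : realType) m (U U' : set 'rV[R]_m) h k :
  diffeo U U' h k -> cov U h.
Proof.
elim: m U U' h k => [|m IH] U U' h k dh.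
  (* In dimension 0 there is a single point, so [h] fixes every set, and the empty determinant is
     1. *)
  move=> V mV VU.
  have hV : h @` V = V.
    apply/seteqP; split=> [_ [x Vx <-]|x Vx]; last exists x => //;
      by rewrite [h x]thinmx0// -[0](thinmx0 x).
  rewrite hV; split; first exact: mV.
  under eq_integral do rewrite det_mx00 normr1.
  by rewrite integral_cst// mul1e.
case: (dh) => oU oU' hU kU' [h1 h2].
apply: (cov_local oU hU (diffeo_inj dh)) => u0 Uu0.
pose e0 : 'rV[R]_m.+1 := delta_mx 0 0.
have dh0 : differentiable h u0 by exact: hU.1.
have [l dl] : exists l, shear_form l ('d h u0 e0) != 0.
  have w0 : 'd h u0 e0 != 0.
    apply/eqP; rewrite mulJ => /(congr1 (mulmx^~ (invmx ('J h u0)))).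
    rewrite mulmxK ?(diffeo_J_unit dh)// mul0mx => /rowP/(_ ord0).
    by rewrite !mxE eqxx/= => /eqP; rewrite oner_eq0.
  have [z0|z0] := eqVneq ('d h u0 e0 0 ord0) 0; last first.
    by exists 0; rewrite /shear_form trmx0 mulmx0 mxE addr0.
  (* With this [l] the form takes the sum of the squares of the tail as value; it is nonzero because
     the vector is nonzero while its first coordinate vanishes. *)
  exists (tl ('d h u0 e0)); rewrite /shear_form z0 add0r.
  apply: contra w0 => /eqP; rewrite mxE => /eqP; rewrite psumr_eq0; last first.
    by move=> j _; rewrite [_^T _ _]mxE -expr2 sqr_ge0.
  move=> /allP t0; apply/eqP/rowP => i; rewrite [RHS]mxE.
  case: (unliftP ord0 i) => [j ->|->//].
  have := t0 j (mem_index_enum _); rewrite [_^T _ _]mxE -expr2 sqrf_eq0 => /eqP.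
  by rewrite mxE.
pose f u : R^o := shear_form l (h u).
have fU : Cr 1 U f by exact: Cr1_shear_form.
have df0 : 'd f u0 e0 != 0 by rewrite (diff_shear_form l e0 dh0).
have [e [k0 [e_gt0 eU sgn dg]]] := straighten oU fU Uu0 df0.
pose g u := consr (f u) (tl u).
pose B := ball u0 e.
have oB : open B by exact: ball_open.
have gU : Cr 1 U g by exact: Cr1_consr oU fU (Cr1_tl oU).
have dhB := diffeo_sub dh oB eU.
have dsh := diffeo_sub (diffeo_shear l) (let: And5 _ o _ _ _ := dhB in o) (@subsetT _ _).
(* [g] replaces the first coordinate of [u] by [f u], which is also the first coordinate of
   [shear l (h u)]; hence [kappa] preserves first coordinates. *)
pose kappa := shear l \o (h \o k0).
have dkappa : diffeo (g @` B) (shear l @` (h @` B)) kappa (g \o k \o shear (- l)).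
  exact: (diffeo_comp (diffeo_comp (diffeo_sym dg) dhB) dsh).
have ogB : open (g @` B) by case: dg.
exists B; split; [exact: oB|exact: ballxx|].
have cg : cov B g.
  apply: (cov_first oB (Cr1_sub eU fU)) => [u Bu|]; last exact: (diffeo_inj dg).
  by case: sgn => /(_ _ Bu) h3; apply/eqP => E; rewrite E ltxx in h3.
have ck : cov (g @` B) kappa.
  apply: (cov_rest dkappa _ IH) => _ [u Bu <-].
  rewrite /kappa/= /shear consr0.
  case: dg => _ _ _ _ [/(_ _ Bu)[_ kg] _].
  by rewrite kg /g consr0.
have kappaC : Cr 1 (g @` B) kappa by case: dkappa.
have ckg : cov B (kappa \o g).
  apply: (cov_comp oB ogB (Cr1_sub eU gU) kappaC _ cg ck) => u Bu.
  by exists u.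
have kgC : Cr 1 B (kappa \o g).
  by apply: (Cr1_comp oB _ (Cr1_sub eU gU) kappaC) => u Bu; exists u.
have shC := @Cr1_shear R m (- l) setT openT.
have ckgs : cov B (shear (- l) \o (kappa \o g)).
  exact: (cov_comp oB openT kgC shC (fun _ _ => Logic.I) ckg (cov_shear (- l))).
have C1 : Cr 1 B (shear (- l) \o (kappa \o g)).
  exact: (Cr1_comp oB (fun _ _ => Logic.I) kgC shC).
apply: (cov_eq oB _ C1 ckgs) => u Bu.
case: dg => _ _ _ _ [/(_ _ Bu)[_ kg] _].
by rewrite /kappa/= kg shearK.
Qed.

Lemma continuous_near_eq (T Z : topologicalType) (f g : T -> Z) x :
  {for x, continuous f} -> {near x, f =1 g} -> {for x, continuous g}.
Proof.
move=> cf fg; rewrite /prop_for /continuous_at -(nbhs_singleton fg).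
by apply: cvg_trans cf; exact: near_eq_cvg.
Qed.

(** * Left-invariant frames *)

Section charts.
Context (R : realType) (n : nat) (M : topologicalType) (c : chart R n M).
Hypothesis hc : is_chart c.

Lemma chart_dom_open : open (chart_dom c). Proof. by case: hc. Qed.
Lemma chart_cod_open : open (chart_cod c). Proof. by case: hc. Qed.

Lemma chartK x : chart_dom c x -> chart_inv c (c x) = x.
Proof. by case: hc => _ _ _ _ K cx; apply: K; rewrite inE. Qed.

Lemma chart_cod_chart x : chart_dom c x -> chart_cod c (c x).
Proof. by exists x. Qed.

Lemma chart_invK y : chart_cod c y -> c (chart_inv c y) = y.
Proof. by move=> [x cx <-]; rewrite chartK. Qed.

Lemma chart_continuous x : chart_dom c x -> {for x, continuous c}.
Proof.
case: hc => oD _ cc _ _ Dx; move: cc; rewrite continuous_open_subspace//.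
by move=> /(_ x); rewrite inE; apply.
Qed.

Lemma chart_inv_continuous y : chart_cod c y -> {for y, continuous (chart_inv c)}.
Proof.
case: hc => _ oC _ cc _ Cy; move: cc; rewrite continuous_open_subspace//.
by move=> /(_ y); rewrite inE; apply.
Qed.

End charts.

Section frames.
Context (R : realType) (n : nat) (G : lieGroup R n).
Local Notation g := 'rV[R]_n.
Local Notation e := (unit_chart G).

(* [A x] is the matrix, in the chart c, of the differential at x of the left
   translation by the inverse of x, read in [unit_chart]. *)
Definition frame (c : chart R n G) (O : set G) (A : G -> 'M[R]_n) :=
  [/\ lie_atlas c, open O /\ O `<=` chart_dom c,
    forall x, O x -> {for x, continuous A},
    forall x, O x -> A x \in unitmx &
    forall (V : normedModType R) (P : V -> G) u, O (P u) ->
      {for u, continuous P} -> differentiable (c \o P) u ->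
      forall v, left_diff P u v = 'd (c \o P) u v *m A (P u)].

Lemma mulg_continuous (T : topologicalType) (F : set_system T) {FF : Filter F}
    (f h : T -> G) (a b : G) :
  f @ F --> a -> h @ F --> b -> (f x * h x)%g @[x --> F] --> (a * b)%g.
Proof.
move=> fa hb.
exact: (cvg_comp2 fa hb (@lie_mul_continuous R n G (a, b))).
Qed.

Lemma diff_pair_snd (V1 V2 W : normedModType R) (M : V1 * V2 -> W) a y v :
  differentiable M (a, y) ->
  differentiable (fun y => M (a, y)) y /\
  'd (fun y => M (a, y)) y v = 'd M (a, y) (0, v).
Proof.
move=> dM.
have da : differentiable (fun _ : V2 => a) y by exact: differentiable_cst.
have di : differentiable (fun z : V2 => z) y.
  by have [] := @is_diff_id R V2 y.
have dp : differentiable (fun z : V2 => (a, z)) y by exact: differentiable_pair.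
split; first exact: differentiable_comp dp dM.
have -> : 'd (fun y => M (a, y)) y v = ('d M (a, y) \o 'd (fun z : V2 => (a, z)) y) v.
  by rewrite -(diff_comp dp dM).
rewrite /= (diff_pair da di) /=.
have -> : 'd (fun _ : V2 => a) y v = 0 by have -> := diff_cst a y.
by have -> : 'd (fun z : V2 => z) y v = v by have [_ ->] := @is_diff_id R V2 y.
Qed.

(** Left translation by the inverse of [x] is multiplication with its first argument frozen, so
    [A x] is a partial Jacobian of one smooth map [M] at a point depending continuously on [x].
    Frames replace [left_diff], whose translation moves with the point, by an ordinary differential
    times a continuous matrix. *)
Lemma exists_frame (x0 : G) : exists c O A, frame c O A /\ O x0.
Proof.
have [c ac cx0] := lie_atlas_cover x0.
have [b ab bx0] := lie_atlas_cover (x0^-1)%g.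
have hc := lie_atlas_chart ac; have hb := lie_atlas_chart ab.
have ae := unit_chart_atlas G; have he := lie_atlas_chart ae.
pose O := chart_dom c `&` (fun x : G => x^-1)%g @^-1` chart_dom b.
have oO : open O.
  apply: openI; first exact: chart_dom_open.
  by apply: open_comp (chart_dom_open hb) => x _; exact: lie_inv_continuous.
pose M (p : g * g) := e (chart_inv b p.1 * chart_inv c p.2)%g.
have [dM cM] : Cr 1 [set u : g * g | [/\ chart_cod b u.1, chart_cod c u.2 &
    chart_dom e (chart_inv b u.1 * chart_inv c u.2)%g]] M.
  exact: (@lie_mul_smooth _ _ G b c e ab ac ae 1%N).
(* Contains the left translation by [x] itself, read from [unit_chart] to [c]; it inverts [F x] and
   yields the invertibility of [A x]. *)
pose N (p : g * g) := c (chart_inv c p.1 * chart_inv e p.2)%g.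
have [dN _] : Cr 1 [set u : g * g | [/\ chart_cod c u.1, chart_cod e u.2 &
    chart_dom c (chart_inv c u.1 * chart_inv e u.2)%g]] N.
  exact: (@lie_mul_smooth _ _ G c e c ac ae ac 1%N).
pose p (x : G) : g * g := (b (x^-1)%g, c x).
have pP x : O x -> [/\ chart_cod b (p x).1, chart_cod c (p x).2 &
    chart_dom e (chart_inv b (p x).1 * chart_inv c (p x).2)%g].
  move=> [cx bx]; split; [exact: chart_cod_chart|exact: chart_cod_chart|].
  by rewrite /= !chartK// mulVg; exact: unit_chart_dom.
pose F x y := M (b (x^-1)%g, y).
have dF x v : O x -> differentiable (F x) (c x) /\
    'd (F x) (c x) v = 'd M (p x) (0, v).
  by move=> /pP /dM dMp; exact: diff_pair_snd dMp.
pose A x : 'M[R]_n := 'J (F x) (c x).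
have Fc x y : O x -> chart_dom c y -> F x (c y) = e (x^-1 * y)%g.
  by move=> [cx bx] cy; rewrite /F /M /= !chartK.
have cp x : O x -> {for x, continuous p}.
  move=> [cx bx].
  have c1 : b (y^-1)%g @[y --> x] --> b (x^-1)%g.
    exact: (cvg_comp _ _ (@lie_inv_continuous _ _ G x) (chart_continuous hb bx)).
  have c2 : c y @[y --> x] --> c x by exact (chart_continuous hc cx).
  exact: (cvg_pair c1 c2).
exists c, O, A; split; last by [].
split; [by []|by split => // x []| | |].
- move=> x Ox; apply/continuous_mxP => i j.
  have AE y : O y -> 'd M (p y) (0, delta_mx 0 i) 0 j = A y i j.
    by move=> Oy; rewrite [RHS]JE (dF y _ Oy).2.
  have c1 : {for p x, continuous (fun q => 'd M q (0, delta_mx 0 i))}.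
    by apply: cM; exact: pP.
  have c2 : 'd M (p y) (0, delta_mx 0 i) @[y --> x] --> 'd M (p x) (0, delta_mx 0 i).
    exact: (cvg_comp _ _ (cp x Ox) c1).
  have c3 : {for x, continuous (fun y => 'd M (p y) (0, delta_mx 0 i) 0 j)}.
    exact: (cvg_comp _ _ c2 (@coord_continuous R _ _ 0 j _)).
  refine (continuous_near_eq c3 _).
  near=> y; apply: AE.
  by near: y; exact: open_nbhs_nbhs.
- move=> x Ox.
  have [cx bx] := Ox.
  have F1 : F x (c x) = e 1%g by rewrite Fc// mulVg.
  have dH : differentiable N (c x, e 1%g).
    apply: dN; split; [exact: chart_cod_chart|exact/chart_cod_chart/unit_chart_dom|].
    by rewrite /= (chartK he (@unit_chart_dom _ _ G)) mulg1 chartK.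
  pose H z := N (c x, z).
  have [dH1 _] := diff_pair_snd 0 dH.
  rewrite -/H -F1 in dH1.
  have [dF1 _] := dF x 0 Ox.
  have E : 'J (H \o F x) (c x) = 1%:M.
    have HF : {near c x, id =1 H \o F x}.
      have o1 : chart_cod c (c x) by exact: chart_cod_chart.
      have k1 : (x^-1 * chart_inv c y)%g @[y --> c x] --> (x^-1 * x)%g.
        have ci : chart_inv c y @[y --> c x] --> x.
          by have := chart_inv_continuous hc o1; rewrite /prop_for /continuous_at chartK.
        refine (mulg_continuous _ ci); exact: cvg_cst.
      have k2 : \forall y \near c x, chart_dom e (x^-1 * chart_inv c y)%g.
        apply: k1; rewrite mulVg; apply: open_nbhs_nbhs; split.
          exact: chart_dom_open he.
        exact: unit_chart_dom.
      near=> y.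
      have Cy : chart_cod c y.
        near: y; apply: open_nbhs_nbhs; split => //; exact: chart_cod_open hc.
      have ey : chart_dom e (x^-1 * chart_inv c y)%g by near: y.
      rewrite /= /H /N /F /M /= (chartK hb bx) (chartK he ey) (chartK hc cx).
      by rewrite mulgA mulgV mul1g chart_invK.
    have di : differentiable (id : g -> g) (c x) by have [] := @is_diff_id R g (c x).
    have [_ E] := diff_near_eq HF di.
    apply/row_matrixP => i; rewrite rowJ E row1.
    by have [_ ->] := @is_diff_id R g (c x).
  have := J_comp dF1 dH1; rewrite E => /esym/mulmx1_unit; exact: (@proj1 _ _).
- move=> V P u Ou cP dP v.
  have [cu bu] := Ou.
  have [dF1 _] := dF _ 0 Ou.
  have near_e : {near u, F (P u) \o (c \o P) =1 (fun w => e ((P u)^-1 * P w)%g)}.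
    have k : \forall w \near u, chart_dom c (P w).
      apply: cP; apply: open_nbhs_nbhs; split => //; exact: chart_dom_open hc.
    by near=> w; rewrite /= Fc//; near: w.
  have dFP : differentiable (F (P u) \o (c \o P)) u.
    exact: (@differentiable_comp _ _ _ _ (c \o P) (F (P u)) u dP dF1).
  have [_ E] := diff_near_eq near_e dFP.
  have E2 := @diff_comp _ _ _ _ (c \o P) (F (P u)) u dP dF1.
  exact: (etrans (f_equal (fun h : V -> g => h v) (etrans E E2)) (mulJ _ _ _)).
Unshelve. all: by end_near.
Qed.

End frames.

Section left_differential.
Context (R : realType) (n : nat) (G : lieGroup R n).
Local Notation g := 'rV[R]_n.
Local Notation e := (unit_chart G).
Implicit Types X V W : normedModType R.

Lemma Cr1_local X W (U : set X) (f : X -> W) :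
  (forall x, U x -> exists2 O, O x & Cr 1 (U `&` O) f) -> Cr 1 U f.
Proof.
move=> fU; split=> [x Ux|v x Ux]; have [Z Zx [df cf]] := fU x Ux.
  by apply: df; split.
by apply: cf; split.
Qed.

Lemma open_preim (X Y : topologicalType) (U : set X) (O : set Y) (P : X -> Y) :
  open U -> (forall u, U u -> {for u, continuous P}) -> open O ->
  open (U `&` P @^-1` O).
Proof.
move=> oU cP oO; rewrite openE => u [Uu Ou].
rewrite /interior; near=> w; split; near: w; first exact: open_nbhs_nbhs.
by apply: cP => //; apply: open_nbhs_nbhs.
Unshelve. all: by end_near.
Qed.

Lemma CrG1_frame V (U : set V) (P : V -> G) c O A :
  frame c O A -> CrG 1 U P -> Cr 1 (U `&` P @^-1` O) (c \o P).
Proof.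
move=> [ac [_ Oc] _ _ _] [_ cP]; apply: Cr1_sub (cP c ac) => u [Uu Ou].
by split => //; exact: Oc.
Qed.

Lemma CrG1_diff V (U : set V) (P : V -> G) c O A u :
  frame c O A -> CrG 1 U P -> U u -> O (P u) -> differentiable (c \o P) u.
Proof. by move=> fr cP Uu Ou; have [d _] := CrG1_frame fr cP; apply: d; split. Qed.

Lemma left_diff_frame V (U : set V) (P : V -> G) c O A u v :
  frame c O A -> CrG 1 U P -> U u -> O (P u) ->
  left_diff P u v = 'd (c \o P) u v *m A (P u).
Proof.
move=> fr cP Uu Ou; have dP := CrG1_diff fr cP Uu Ou.
have [_ _ _ _ H] := fr; apply: H => //; exact: cP.1.
Qed.

Definition left_mx m (P : 'rV[R]_m -> G) (u : 'rV[R]_m) : 'M[R]_(m, n) :=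
  'J (fun w => e ((P u)^-1 * P w)%g) u.

Lemma left_diffE m (P : 'rV[R]_m -> G) u v : left_diff P u v = v *m left_mx P u.
Proof. exact: mulJ. Qed.

Lemma left_mx_frame m (U : set 'rV[R]_m) (P : 'rV[R]_m -> G) c O A u :
  frame c O A -> CrG 1 U P -> U u -> O (P u) ->
  left_mx P u = 'J (c \o P) u *m A (P u).
Proof.
move=> fr cP Uu Ou; apply/row_matrixP => i.
rewrite [LHS]rowE -left_diffE (left_diff_frame _ fr cP Uu Ou) mulJ.
by rewrite [RHS]rowE mulmxA.
Qed.

Lemma left_mx_continuous m (U : set 'rV[R]_m) (P : 'rV[R]_m -> G) u :
  open U -> CrG 1 U P -> U u -> {for u, continuous (left_mx P)}.
Proof.
move=> oU cP Uu; have [c [Z [A [fr Ou]]]] := exists_frame (P u).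
have [ac [oO Oc] cA _ _] := fr.
have c1 : {for u, continuous (fun w => 'J (c \o P) w)}.
  by apply: Cr1_J (CrG1_frame fr cP) _; split.
have c2 : A (P w) @[w --> u] --> A (P u).
  exact: (cvg_comp _ _ (cP.1 u Uu) (cA _ Ou)).
have c3 : {for u, continuous (fun w => 'J (c \o P) w *m A (P w))}.
  exact: (cvg_mulmx c1 c2).
refine (continuous_near_eq c3 _).
near=> w; symmetry; apply: (left_mx_frame fr cP); near: w.
  exact: open_nbhs_nbhs.
by apply: cP.1 => //; exact: open_nbhs_nbhs.
Unshelve. all: by end_near.
Qed.

Lemma CrG1_sub V (U U' : set V) (P : V -> G) : U' `<=` U -> CrG 1 U P -> CrG 1 U' P.
Proof.
move=> UU [cP dP]; split=> [u /UU|c ac]; first exact: cP.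
by apply: Cr1_sub (dP c ac) => u [/UU].
Qed.

Lemma CrG1_comp X p (W : set X) (U : set 'rV[R]_p) (P : 'rV[R]_p -> G)
    (h : X -> 'rV[R]_p) :
  open W -> Cr 1 W h -> CrG 1 U P -> (forall x, W x -> U (h x)) ->
  CrG 1 W (P \o h).
Proof.
move=> oW hW [cP dP] WU; have ch x : W x -> {for x, continuous h}.
  exact: Cr1_continuous.
have cPh x : W x -> {for x, continuous (P \o h)}.
  by move=> Wx; apply: continuous_comp; [exact: ch|apply: cP; exact: WU].
split=> // c ac.
have -> : c \o (P \o h) = (c \o P) \o h by [].
apply: (Cr1_comp _ _ (Cr1_sub _ hW) (dP c ac)) => [|x [Wx]|x []] //.
  by apply: open_preim => //; exact: chart_dom_open (lie_atlas_chart ac).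
by split => //; exact: WU.
Qed.

Lemma left_diff_comp V X (U : set V) (P : V -> G) (h : X -> V) (f : X -> G) x v :
  open U -> CrG 1 U P -> U (h x) -> differentiable h x ->
  {near x, P \o h =1 f} -> left_diff f x v = left_diff P (h x) ('d h x v).
Proof.
move=> oU cP Uh dh Phf; have fx := nbhs_singleton Phf; rewrite /= in fx.
have [c [Z [A [fr Oh]]]] := exists_frame (P (h x)).
have dP := CrG1_diff fr cP Uh Oh.
have dcPh : differentiable ((c \o P) \o h) x by exact: differentiable_comp.
have cPhf : {near x, (c \o P) \o h =1 c \o f}.
  by apply: filterS Phf => y /= ->.
have [df E] := diff_near_eq cPhf dcPh.
have [_ _ _ _ H] := fr.
have cf : {for x, continuous f}.
  refine (continuous_near_eq _ Phf); apply: continuous_comp.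
    exact: differentiable_continuous.
  exact: cP.1.
have Of : Z (f x) by rewrite -fx.
have L1 := H _ f x Of cf df v.
have L2 := left_diff_frame ('d h x v) fr cP Uh Oh.
have E2 := f_equal (fun k : X -> g => k v) (etrans E (diff_comp dh dP)).
by rewrite L1 L2 fx E2.
Qed.

(** In a chart [c] around [f x], the map [c \o P] is an immersion of Euclidean spaces and its
    composition with [Q \o f] is [c \o f], so [Cr1_lift] promotes [Q \o f] from continuous to
    C^1. *)
Lemma transition X m (U : set 'rV[R]_m) (P : 'rV[R]_m -> G) (Q : G -> 'rV[R]_m)
    (W : set X) (f : X -> G) :
  open U -> CrG 1 U P -> (forall u, U u -> injective (left_diff P u)) ->
  {within P @` U, continuous Q} -> {in U, cancel P Q} ->
  open W -> CrG 1 W f -> (forall x, W x -> (P @` U) (f x)) ->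
  Cr 1 W (Q \o f) /\ forall x v, W x ->
    left_diff f x v = left_diff P (Q (f x)) ('d (Q \o f) x v).
Proof.
move=> oU cP iP cQ K oW cf WU.
have UQ x : W x -> U (Q (f x)) /\ P (Q (f x)) = f x.
  by move=> /WU [u Uu <-]; rewrite K ?inE.
have cQf x : W x -> {for x, continuous (Q \o f)}.
  move=> Wx; have Qx : Q @ within (P @` U) (nbhs (f x)) --> Q (f x).
    have := cQ (f x); rewrite {1}/continuous_at.
    by rewrite (nbhs_subspace_in (WU x Wx)).
  move=> B /Qx QB.
  have {}QB : \forall z \near f x, (P @` U) z -> B (Q z) by exact: QB.
  have cfx : f y @[y --> x] --> f x by exact: (cf.1 x Wx).
  have {}QB : \forall y \near x, (P @` U) (f y) -> B (Q (f y)) := cfx _ QB.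
  suff : \forall y \near x, B (Q (f y)) by [].
  near=> y.
  have : (P @` U) (f y) by apply: WU; near: y; exact: open_nbhs_nbhs.
  by near: y.
have CQ : Cr 1 W (Q \o f).
  apply: Cr1_local => x Wx; have [c [Z [A [fr Ox]]]] := exists_frame (f x).
  have [_ [oO _] _ uA _] := fr.
  exists (f @^-1` Z) => //.
  have o1 : open (W `&` f @^-1` Z) by apply: open_preim => //; exact: cf.1.
  have WU' y : (W `&` f @^-1` Z) y -> (U `&` P @^-1` Z) ((Q \o f) y).
    by move=> [Wy Oy]; have [UQy PQ] := UQ y Wy; split=> //; rewrite /preimage/= PQ.
  have p1 := CrG1_frame fr cP; have f1 := CrG1_frame fr cf.
  have inj y (v : 'rV[R]_m) : (U `&` P @^-1` Z) y -> 'd (c \o P) y v = 0 -> v = 0.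
    move=> [Uy Oy] dv0; apply: (iP y Uy).
    rewrite (left_diff_frame _ fr cP Uy Oy) dv0 mul0mx.
    by rewrite left_diffE mul0mx.
  have cQf' y : (W `&` f @^-1` Z) y -> {for y, continuous (Q \o f)}.
    by move=> [Wy _]; exact (cQf y Wy).
  have PQf y : (W `&` f @^-1` Z) y -> (c \o P) ((Q \o f) y) = (c \o f) y.
    by move=> [Wy _] /=; have [_ ->] := UQ y Wy.
  exact: (Cr1_lift o1 WU' p1 inj f1 cQf' PQf).1.
split=> // x v Wx; apply: (left_diff_comp _ oU cP).
- by have [] := UQ x Wx.
- exact: CQ.1.
- near=> y => /=; apply: (UQ _ _).2; near: y; exact: open_nbhs_nbhs.
Unshelve. all: by end_near.
Qed.

End left_differential.

(** * Parametrized submanifolds of a Carnot group *)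

Section carnot_metric.
Context (R : realType) (n k : nat) (G : carnotGroup R n k).
Implicit Types (a : R) (u v w : 'rV[R]_n).

Definition metric_mx : 'M[R]_n :=
  \matrix_(i, j) metric G (delta_mx 0 i) (delta_mx 0 j).
Local Notation Gam := metric_mx.

Lemma metric0l w : metric G 0 w = 0.
Proof.
have := metric_linear G 1 0 0 w; rewrite scale1r addr0 mul1r => E.
by apply: (@addrI _ (metric G 0 w)); rewrite addr0 -[in LHS]E.
Qed.

Lemma metricDl u v w : metric G (u + v) w = metric G u w + metric G v w.
Proof. by rewrite -[u]scale1r metric_linear mul1r scale1r. Qed.

Lemma metricZl a u w : metric G (a *: u) w = a * metric G u w.
Proof. by rewrite -[a *: u]addr0 metric_linear metric0l addr0. Qed.

Lemma metric_suml (I : Type) (r : seq I) (F : I -> 'rV[R]_n) w :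
  metric G (\sum_(i <- r) F i) w = \sum_(i <- r) metric G (F i) w.
Proof.
elim: r => [|i r IH]; first by rewrite !big_nil metric0l.
by rewrite !big_cons metricDl IH.
Qed.

Lemma metricE u v : metric G u v = (u *m Gam *m v^T) 0 0.
Proof.
have mr w z : metric G w z = \sum_i w 0 i * metric G (delta_mx 0 i) z.
  rewrite [w in LHS]row_sum_delta metric_suml.
  by apply: eq_bigr => i _; rewrite metricZl.
rewrite Defs.metric_sym mr mxE; apply: eq_bigr => j _.
rewrite Defs.metric_sym mr !mxE mulrC; congr (_ * _).
by apply: eq_bigr => i _; rewrite !mxE.
Qed.

Lemma metric_mx_sym : Gam^T = Gam.
Proof. by apply/matrixP => i j; rewrite !mxE Defs.metric_sym. Qed.

Lemma metric_ge0 u : 0 <= metric G u u.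
Proof.
have [->|u0] := eqVneq u 0; first by rewrite metric0l.
by rewrite ltW// metric_pos.
Qed.

Lemma metric_eq0 u : (metric G u u == 0) = (u == 0).
Proof.
have [->|u0] := eqVneq u 0; first by rewrite metric0l eqxx.
by rewrite gt_eqF// metric_pos.
Qed.

Lemma gram_form m (B : 'M[R]_(m, n)) (v w : 'rV[R]_m) :
  (v *m (B *m Gam *m B^T) *m w^T) 0 0 = metric G (v *m B) (w *m B).
Proof. by rewrite metricE trmx_mul !mulmxA. Qed.

(** By positivity of the metric: a vector killed by the Gram matrix is sent by [B] to a vector of
    norm zero. *)
Lemma gram_unit m (B : 'M[R]_(m, n)) : row_free B -> B *m Gam *m B^T \in unitmx.
Proof.
move=> fB; rewrite -row_free_unit; apply/inj_row_free => v v0.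
have /eqP : metric G (v *m B) (v *m B) == 0 by rewrite -gram_form v0 mul0mx mxE.
by move/eqP; rewrite metric_eq0 => /eqP vB; apply: (row_free_inj fB); rewrite vB mul0mx.
Qed.

Lemma metric_mx_unit : Gam \in unitmx.
Proof.
have := @gram_unit n 1%:M; rewrite trmx1 mulmx1 mul1mx; apply.
by rewrite row_free_unit unitmx1.
Qed.

Lemma gramE m (B : 'M[R]_(m, n)) i j :
  (B *m Gam *m B^T) i j = metric G (row i B) (row j B).
Proof. by rewrite !rowE -gram_form trmx_delta -rowE -colE !mxE. Qed.

Lemma cvg_gram (T : Type) (F : set_system T) {FF : Filter F} m
    (B : T -> 'M[R]_(m, n)) (L : 'M[R]_(m, n)) :
  B x @[x --> F] --> L ->
  (B x *m Gam *m (B x)^T) @[x --> F] --> L *m Gam *m L^T.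
Proof.
move=> BL; apply: cvg_mulmx (cvg_trmx BL); apply: cvg_mulmx BL _; exact: cvg_cst.
Qed.

Lemma jacobianE m (P : 'rV[R]_m -> G) (u : 'rV[R]_m) :
  Defs.jacobian P u = Num.sqrt (\det (left_mx P u *m Gam *m (left_mx P u)^T)).
Proof.
congr (Num.sqrt (\det _)); apply/matrixP => i j.
by rewrite gramE !mxE !left_diffE -!rowE.
Qed.

Lemma jacobian_ge0 m (P : 'rV[R]_m -> G) (u : 'rV[R]_m) : 0 <= Defs.jacobian P u.
Proof. exact: sqrtr_ge0. Qed.

Lemma jacobian_continuous m (U : set 'rV[R]_m) (P : 'rV[R]_m -> G) (u : 'rV[R]_m) :
  open U -> CrG 1 U P -> U u -> {for u, continuous (Defs.jacobian P)}.
Proof.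
move=> oU cP Uu; have c1 : (left_mx P w *m Gam *m (left_mx P w)^T) @[w --> u] -->
    left_mx P u *m Gam *m (left_mx P u)^T.
  exact (cvg_gram (left_mx_continuous oU cP Uu)).
have c2 := cvg_comp _ _ (cvg_det c1) (@sqrt_continuous R _).
have -> : Defs.jacobian P = fun w : 'rV[R]_m => Num.sqrt (\det (left_mx P w *m Gam *m (left_mx P w)^T)).
  by apply/funext => w; exact: jacobianE.
exact (c2 _).
Qed.

Lemma left_mx_comp m p (U : set 'rV[R]_m) (P : 'rV[R]_m -> G)
    (h : 'rV[R]_p -> 'rV[R]_m) (f : 'rV[R]_p -> G) x :
  open U -> CrG 1 U P -> U (h x) -> differentiable h x ->
  {near x, P \o h =1 f} -> left_mx f x = 'J h x *m left_mx P (h x).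
Proof.
move=> oU cP Uh dh Phf; apply/row_matrixP => i.
rewrite [LHS]rowE -left_diffE (left_diff_comp _ oU cP Uh dh Phf) left_diffE.
by rewrite mulJ [RHS]rowE mulmxA.
Qed.

(** The Gram matrix changes by congruence with ['J h x], so its determinant gains the square of
    [\det ('J h x)]. *)
Lemma jacobian_comp m (U : set 'rV[R]_m) (P : 'rV[R]_m -> G)
    (h : 'rV[R]_m -> 'rV[R]_m) (f : 'rV[R]_m -> G) x :
  open U -> CrG 1 U P -> U (h x) -> differentiable h x ->
  {near x, P \o h =1 f} -> Defs.jacobian f x = `|\det ('J h x)| * Defs.jacobian P (h x).
Proof.
move=> oU cP Uh dh Phf; rewrite !jacobianE (left_mx_comp oU cP Uh dh Phf).
rewrite trmx_mul -!mulmxA; set L := left_mx P (h x); set J := 'J h x.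
have -> : J *m (L *m (Gam *m (L^T *m J^T))) = J *m (L *m Gam *m L^T) *m J^T.
  by rewrite !mulmxA.
rewrite !det_mulmx det_tr mulrC mulrA -expr2 sqrtrM ?sqr_ge0//.
by rewrite sqrtr_sqr mulmxA.
Qed.

End carnot_metric.

Section local_parametrizations.
Context (R : realType) (n k : nat) (G : carnotGroup R n k).

Lemma local_paramW m (N : set G) U (P : 'rV[R]_m -> G) :
  local_param 2 N U P -> local_param 1 N U P.
Proof.
move=> [oU [cP sP] iP im Q]; split=> //; split=> // c ac.
exact: CrW (sP c ac).
Qed.

(** [Q] makes [P] a homeomorphism onto its image, which is itself relatively open in [N]. *)
Lemma open_param_image m (N : set G) U (P : 'rV[R]_m -> G) V :
  local_param 1 N U P -> open V -> V `<=` U ->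
  exists2 Z, open Z & P @` V = N `&` Z.
Proof.
move=> [oU cP iP [Z oZ PZ] [Q [cQ K]]] oV VU.
have oQ : open (Q @^-1` V : set (subspace (P @` U))).
  by apply: open_comp oV => x _; exact: cQ.
have [Y oY YQ] := (open_subspaceP _ _).1 oQ.
exists (Z `&` Y); first exact: openI.
rewrite setIA -PZ; apply/seteqP; split=> [_ [u Vu <-]|x [[u Uu <-] Yx]].
  have Uu := VU u Vu; split; first by exists u.
  have : ((Q @^-1` V) `&` (P @` U)) (P u).
    by split; [rewrite /preimage/= K ?inE|exists u].
  by rewrite -YQ => -[].
exists u => //.
have : (Y `&` (P @` U)) (P u) by split => //; exists u.
by rewrite YQ => -[]; rewrite /preimage/= K ?inE.
Qed.

Lemma local_param_diffeo m (N : set G) U (P : 'rV[R]_m -> G) U1 U2 h k' :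
  local_param 1 N U P -> diffeo U1 U2 h k' -> U2 `<=` U ->
  local_param 1 N U1 (P \o h).
Proof.
move=> hP [p1 p2 c1 c2 [h12 h21]] UU.
have [Z oZ PZ] := open_param_image hP p2 UU.
have [oU cP iP _ [Q [cQ K]]] := hP.
have im : (P \o h) @` U1 = P @` U2.
  apply/seteqP; split=> [_ [u Uu <-]|_ [v Uv <-]].
    by exists (h u) => //; have [] := h12 u Uu.
  by exists (k' v); [have [] := h21 v Uv|rewrite /= (h21 v Uv).2].
split => //.
- by apply: (CrG1_comp p1 c1 cP) => x /h12 [/UU].
- move=> u Uu; have [Uhu kh] := h12 u Uu.
  have dh : differentiable h u by exact: c1.1.
  have Ph : {near u, P \o h =1 P \o h} by near=> w.
  have lP := left_diff_comp _ oU cP (UU _ Uhu) dh Ph.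
  have uJ : 'J h u \in unitmx.
    by apply: (@diffeo_J_unit _ _ U1 U2 h k').
  move=> v w; rewrite !lP => /(iP _ (UU _ Uhu)); rewrite !mulJ.
  by apply: (row_free_inj _); rewrite row_free_unit.
- by exists Z => //; rewrite im.
- exists (k' \o Q); split; last first.
    move=> u; rewrite inE => Uu; have [Uhu kh] := h12 u Uu.
    by rewrite /= K ?kh// inE; exact: UU.
  rewrite im; apply/subspace_continuousP => _ [v Vv <-] B /= nB.
  have cQv : Q y @[y --> within (P @` U) (nbhs (P v))] --> Q (P v).
    exact: ((subspace_continuousP _ _).1 cQ) (P v) (imageP _ (UU _ Vv)).
  have Qv : Q (P v) = v by rewrite K// inE; exact: UU.
  have ck : {for v, continuous k'} by exact: (Cr1_continuous c2).
  have {}nB : nbhs (k' v) B by rewrite -Qv.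
  rewrite Qv in cQv.
  have nB' : \forall w \near v, B (k' w) := ck _ nB.
  have QB : \forall y \near P v, (P @` U) y -> B (k' (Q y)) := cQv _ nB'.
  rewrite /= nbhs_simpl /within /=.
  apply: filterS QB => y yB [w Vw Pw]; apply: yB; exists w => //.
  exact: UU.
Unshelve. all: by end_near.
Qed.

End local_parametrizations.

(** * The area measure on Borel sets *)

Section integral_off_null.
Local Open Scope ereal_scope.
Context d (T : measurableType d) (R : realType) (mu : {measure set T -> \bar R}).

Import HBNNSimple.

Let nnint (f : T -> \bar R) := ereal_sup [set sintegral mu h |
  h in [set h : {nnsfun T >-> R} | forall x, (h x)%:E <= f x]].

Let sintegral_off_null (Z : set T) (mZ : measurable Z) (h : {nnsfun T >-> R}) :
  mu Z = 0 -> sintegral mu h = sintegral mu (proj_nnsfun h (measurableC mZ)).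
Proof.
move=> Z0; rewrite -mrestrict -integral_nnsfun; last exact: measurableC.
rewrite -integralT_nnsfun -(setvU Z) ge0_integral_setU//=.
- rewrite [X in _ + X]null_set_integral ?adde0//.
  exact/measurable_EFinP/measurable_funTS.
- exact: measurableC.
- by rewrite setvU; exact/measurable_EFinP/measurable_funTS.
- by move=> x _; rewrite lee_fin; exact: fun_ge0.
- by rewrite disj_set2E setICl.
Qed.

Let le_nnint (Z : set T) (f g : T -> \bar R) : measurable Z -> mu Z = 0 ->
  (forall x, ~ Z x -> f x = g x) -> (forall x, 0 <= g x) -> nnint f <= nnint g.
Proof.
move=> mZ Z0 fg g0; apply: ge_ereal_sup => _ [h /= hf <-].
rewrite (sintegral_off_null mZ)//; apply: ereal_sup_ubound.
exists (proj_nnsfun h (measurableC mZ)) => // x /=.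
rewrite mindicE; case: (boolP (x \in ~` Z)) => [|_]; last by rewrite mulr0.
by rewrite inE mulr1 => /fg <-.
Qed.

(** The integral of any function is a difference of suprema over simple functions, and a simple
    function can be set to zero on [Z] without changing its integral. It serves to alter integrands
    involving [psi] and [grad_H], which are controlled only off a null set. *)
Lemma integral_off_null (D Z : set T) (f g : T -> \bar R) :
  measurable Z -> mu Z = 0 -> (forall x, D x -> ~ Z x -> f x = g x) ->
  \int[mu]_(x in D) f x = \int[mu]_(x in D) g x.
Proof.
move=> mZ Z0 fg.
have E x : ~ Z x -> (f \_ D) x = (g \_ D) x.
  by move=> Zx; rewrite /patch; case: ifPn => //; rewrite inE => Dx; exact: fg.
rewrite /integral; congr (_ - _); apply/eqP; rewrite eq_le; apply/andP; split;
  by apply: (le_nnint mZ Z0) => // x Zx; rewrite ?funeposE ?funenegE E.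
Qed.

End integral_off_null.

Section outer_from_measurable.
Local Open Scope ereal_scope.
Context d (T : measurableType d) (R : realType) (m0 : set T -> \bar R).
Hypotheses (m00 : m0 set0 = 0) (m0_ge0 : forall B, 0 <= m0 B).

Lemma mu_ext_le B : measurable B -> mu_ext m0 B <= m0 B.
Proof.
move=> mB; apply: ereal_inf_lbound; exists (fun i => if i == 0%N then B else set0).
  split; first by case=> [|i] /=; [exact: mB|exact: measurable0].
  by move=> x Bx; exists 0%N.
rewrite nneseries_recl//= eseries0 ?adde0//.
by case=> [|i].
Qed.

(** When the outer measure is finite, [X] has covers of excess [1 / (k + 1)] for all [k]; the
    intersection of their unions is the hull. *)
Lemma mu_ext_hull X : exists B,
  [/\ measurable B, X `<=` B & mu_ext m0 B = mu_ext m0 X].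
Proof.
have [Xoo|Xoo] := eqVneq (mu_ext m0 X) +oo.
  exists setT; split => //; apply/eqP; rewrite eq_le Xoo leey/= -Xoo.
  exact: le_mu_ext.
have Xfin : mu_ext m0 X \is a fin_num.
  by rewrite ge0_fin_numE ?mu_ext_ge0// ltey.
have C k : exists F : (set T)^nat, measurable_cover X F /\
    \sum_(i <oo) m0 (F i) <= mu_ext m0 X + (k.+1%:R^-1)%:E.
  have k0 : (0 < k.+1%:R^-1 :> R)%R by rewrite invr_gt0.
  have [_ [F cF <-] lF] := lb_ereal_inf_adherent k0 Xfin.
  by exists F; split => //; exact: ltW.
have [F FP] := choice C.
pose B := \bigcap_k \bigcup_i F k i.
have mB : measurable B.
  apply: bigcapT_measurable => k; apply: bigcupT_measurable => i.
  by have [[mF _] _] := FP k.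
have XB : X `<=` B by move=> x Xx k _; have [[_ XF] _] := FP k; exact: XF.
exists B; split => //; apply/eqP; rewrite eq_le; apply/andP; split; last exact: le_mu_ext.
apply/lee_addgt0Pr => e e0.
have [k ke] : exists k, (k.+1%:R^-1 <= e)%R.
  have /= := @near_infty_natSinv_lt R (PosNum e0).
  by move=> [k _ /(_ k (leqnn _))] /= /ltW; exists k.
have [[mF XF] lF] := FP k.
apply: (@le_trans _ _ (\sum_(i <oo) m0 (F k i))).
  apply: ereal_inf_lbound; exists (F k) => //; split => // x Bx.
  exact: (Bx k I).
by apply: (le_trans lF); rewrite leeD2l// lee_fin.
Qed.

(** A cover of [X], intersected with [A] and with its complement, covers the two parts, so the
    inequality passes from [m0] on measurable sets to the outer measure of arbitrary sets. *)
Lemma mu_ext_split A X : measurable A ->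
  (forall B, measurable B -> m0 (B `&` A) + m0 (B `&` ~` A) <= m0 B) ->
  mu_ext m0 (X `&` A) + mu_ext m0 (X `&` ~` A) <= mu_ext m0 X.
Proof.
move=> mA split_le; apply: le_ereal_inf_tmp => _ [F [mF XF] <-].
have le C : measurable C -> mu_ext m0 (X `&` C) <= \sum_(i <oo) m0 (F i `&` C).
  move=> mC; apply: ereal_inf_lbound; exists (fun i => F i `&` C) => //; split.
    by move=> i; exact: measurableI.
  by move=> x [/XF[i _ Fx] Cx]; exists i.
apply: (le_trans (leeD (le _ mA) (le _ (measurableC mA)))).
rewrite -nneseriesD//; apply: lee_nneseries => [i _ _|i _]; [exact: adde_ge0|exact: split_le].
Qed.

End outer_from_measurable.

Section area_pieces.
Local Open Scope ereal_scope.
Context (R : realType) (n k : nat) (G : carnotGroup R n k) (m : nat).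
Context (N : set G) (w : G -> {nonneg R}).
Implicit Types (U V : set 'rV[R]_m) (P : 'rV[R]_m -> G).
Hypothesis mw : forall U P, local_param 1 N U P ->
  measurable_fun (U : set (borel _)) (fun u : borel 'rV[R]_m => (w (P u))%:num%R).

Definition density P (u : 'rV[R]_m) : R := ((w (P u))%:num * Defs.jacobian P u)%R.

Definition mass P V := \int[leb R m]_(u in V) (density P u)%:E.

Lemma density_ge0 P u : (0 <= density P u)%R.
Proof. by rewrite mulr_ge0// jacobian_ge0. Qed.

Lemma density_measurable U P : local_param 1 N U P ->
  measurable_fun (U : set (borel _)) (density P : borel _ -> R).
Proof.
move=> hP; have [oU cP _ _ _] := hP; apply: measurable_funM; first exact: mw.
apply: within_continuous_borelR; first exact: open_borel.
apply: within_continuous => u Uu; exact (jacobian_continuous oU cP Uu).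
Qed.

Lemma mass_ge0 P V : 0 <= mass P V.
Proof. by apply: integral_ge0 => u _; rewrite lee_fin density_ge0. Qed.

Lemma tuple_borel V :
  measurable (@row_of_tuple R m @^-1` V : set (m.-tuple (measurableTypeR R))) ->
  measurable (V : set (borel _)).
Proof.
move=> mV; have := @tuple_of_row_measurable R m measurableT _ mV.
rewrite setTI (_ : _ @^-1` _ = V)//; apply/seteqP.
by split => v; rewrite /preimage/= (tuple_of_rowK v : row_of_tuple _ = v).
Qed.

Lemma mass_tuple U P V : local_param 1 N U P -> V `<=` U ->
  measurable (V : set (borel _)) ->
  mass P V = \int[lebesgue_tuple R m]_(t in @row_of_tuple R m @^-1` V)
    ((w (P (row_of_tuple t)))%:num * Defs.jacobian P (row_of_tuple t))%:E.
Proof.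
move=> hP VU mV; rewrite /mass ge0_integral_leb//.
- apply/measurable_EFinP; apply: measurable_funS (density_measurable hP) => //.
  by apply: open_borel; case: hP.
- by move=> u _; rewrite lee_fin density_ge0.
Qed.

(** One half of the symmetric claim that the transition map [Q' \o P] is a diffeomorphism between
    the overlap domains; it is used in both directions. *)
Let half U U' P P' Z Z' (Q Q' : G -> 'rV[R]_m) :
  local_param 1 N U P -> local_param 1 N U' P' ->
  P @` U = N `&` Z -> P' @` U' = N `&` Z' -> open Z' ->
  {in U, cancel P Q} -> {within P' @` U', continuous Q'} -> {in U', cancel P' Q'} ->
  [/\ open (U `&` P @^-1` Z'), Cr 1 (U `&` P @^-1` Z') (Q' \o P) &
   forall u, (U `&` P @^-1` Z') u ->
     [/\ (U' `&` P' @^-1` Z) (Q' (P u)), Q (P' (Q' (P u))) = u & P' (Q' (P u)) = P u]].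
Proof.
move=> [oU cP _ _ _] [oU' cP' iP' _ _] PZ PZ' oZ' K cQ' K'.
have oW : open (U `&` P @^-1` Z') by apply: open_preim => //; exact: cP.1.
have WP u : (U `&` P @^-1` Z') u -> (P' @` U') (P u).
  move=> [Uu Zu]; rewrite PZ'; split=> //.
  by have [] : (N `&` Z) (P u) by rewrite -PZ; exists u.
split => //.
- have sWU : U `&` P @^-1` Z' `<=` U by move=> u [].
  exact: (transition oU' cP' iP' cQ' K' oW (CrG1_sub sWU cP) WP).1.
- move=> u Wu; have [u' Uu' Pu'] := WP u Wu; have [Uu Zu] := Wu.
  rewrite -Pu' K' ?inE//; split => //; last by rewrite Pu' K ?inE.
  split=> //; rewrite /preimage/= Pu'.
  by have [] : (N `&` Z) (P u) by rewrite -PZ; exists u.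
Qed.

(** Under the transition map, [density P'] pulls back with its Jacobian factor to [density P]. Hence
    the mass of [V] is the mass in [P'] of its image under the transition, a subset of [V']. With
    the roles exchanged this contains the independence of the parametrization. *)
Lemma le_mass U U' P P' V V' : local_param 1 N U P -> local_param 1 N U' P' ->
  measurable (V : set (borel _)) -> measurable (V' : set (borel _)) ->
  V `<=` U -> V' `<=` U' -> P @` V `<=` P' @` V' -> mass P V <= mass P' V'.
Proof.
move=> hP hP' mV mV' VU VU' PV.
have [oU cP iP [Z oZ PZ] [Q [cQ K]]] := hP.
have [oU' cP' iP' [Z' oZ' PZ'] [Q' [cQ' K']]] := hP'.
have [oW hW WW] := half hP hP' PZ PZ' oZ' K cQ' K'.
have [oW' hW' WW'] := half hP' hP PZ' PZ oZ K' cQ K.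
set W := U `&` P @^-1` Z' in oW hW WW *.
set W' := U' `&` P' @^-1` Z in oW' hW' WW' *.
have dh : diffeo W W' (Q' \o P) (Q \o P').
  split => //; split => [u /WW|v /WW'] [? ? ?]; by split.
have cv := change_of_variables dh.
have VW : V `<=` W.
  move=> u Vu; split; first exact: VU.
  have [v Vv Pv] := PV _ (imageP _ Vu).
  have [] : (N `&` Z') (P u) by rewrite -PZ' -Pv; exists v => //; exact: VU'.
  by [].
have hV : (Q' \o P) @` V `<=` V'.
  move=> _ [u Vu <-]; have [v Vv /= <-] := PV _ (imageP _ Vu).
  by rewrite K' // inE; exact: VU'.
pose F := (EFin \o density P') \_ U'.
have mF : measurable_fun setT (F : borel _ -> \bar R).
  apply/(measurable_restrictT _ _).1; first exact: open_borel.
  by apply/measurable_EFinP; exact: density_measurable.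
have F0 u : 0 <= F u.
  by rewrite /F /patch; case: ifP => // _; rewrite lee_fin density_ge0.
have FE u : U' u -> F u = (density P' u)%:E by move=> Uu; rewrite /F /patch mem_set.
have [mhV _] := cv V mV VW.
have -> : mass P V = \int[leb R m]_(u in V) (F ((Q' \o P) u) * `|\det ('J (Q' \o P) u)|%:E).
  apply: eq_integral => u; rewrite inE => /VW Wu.
  have [[Uh _] _ PhP] := WW u Wu.
  rewrite FE//= -EFinM; congr EFin; rewrite /density PhP.
  have nh : {near u, P' \o (Q' \o P) =1 P}.
    near=> y => /=; have [] := WW y _ => //; near: y; exact: open_nbhs_nbhs.
  have dhu : differentiable (Q' \o P) u by exact: hW.1.
  rewrite (jacobian_comp oU' cP' Uh dhu nh) /=.
  by rewrite [RHS]mulrAC mulrA.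
rewrite -(cov_integral cv oW hW mV VW mF F0).
have -> : mass P' V' = \int[leb R m]_(u in V') F u.
  by apply: eq_integral => u; rewrite inE => /VU' Uu; rewrite FE.
by apply: ge0_subset_integral => //; exact: measurable_funTS.
Unshelve. all: by end_near.
Qed.

Lemma param_preim_measurable U P (B : set G) : local_param 1 N U P ->
  measurable (B : set (borel G)) ->
  measurable (U `&` P @^-1` B : set (borel _)).
Proof.
move=> [oU cP _ _ _] mB.
have := @within_continuous_borel _ G U P (open_borel oU)
  (within_continuous (fun u Uu => cP.1 u Uu)).
by apply => //; exact: open_borel.
Qed.

Lemma piece_area_mass U P V (B : set G) : local_param 1 N U P -> V `<=` U ->
  measurable (V : set (borel _)) -> N `&` B `<=` P @` V ->
  piece_area m N w B <= mass P V.
Proof.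
move=> hP VU mV NB; apply: ereal_inf_lbound; exists U, P, V; split => //.
  by have := @row_of_tuple_measurable R m measurableT _ mV; rewrite setTI.
exact: mass_tuple hP VU mV.
Qed.

Lemma piece_area_cover (B : set G) (x : \bar R) :
  (forall U P V, local_param 1 N U P -> V `<=` U ->
    measurable (V : set (borel _)) -> N `&` B `<=` P @` V -> x <= mass P V) ->
  x <= piece_area m N w B.
Proof.
move=> H; apply: le_ereal_inf_tmp => _ [U [P [V [hP VU mV NB ->]]]].
have mV' := tuple_borel mV.
by rewrite -(mass_tuple hP VU mV'); exact: H hP VU mV' NB.
Qed.

Lemma param0 : local_param 1 N set0 (fun _ : 'rV[R]_m => point : G).
Proof.
split => //.
- by split=> // c _; rewrite set0I; split => [x []|v x []].
- by exists set0; [exact: open0|rewrite image_set0 setI0].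
- exists (fun=> point); split; last by move=> u; rewrite inE.
  by rewrite image_set0; exact: continuous_subspace0.
Qed.

(** Covering [B] by itself gives one inequality. For the other, each set of a competing cover, in
    whatever parametrization it is measured, weighs at least the mass in [P] of its trace on [B] by
    [le_mass], and this mass is countably subadditive. *)
Lemma area_ext_piece U P (B : set G) : local_param 1 N U P ->
  measurable (B : set (borel G)) -> N `&` B `<=` P @` U ->
  area_ext m N w B = mass P (U `&` P @^-1` B).
Proof.
move=> hP mB NB; have mUB := param_preim_measurable hP mB.
apply/eqP; rewrite eq_le; apply/andP; split.
  apply: le_trans (mu_ext_le _ _ mB) _.
  - exact: piece_area0.
  - by move=> C; exact: piece_area_ge0.
  - apply: piece_area_mass hP _ mUB _; first exact: subIsetl.
    by move=> x Bx; have [u Uu Pu] := NB x Bx; exists u => //; split => //;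
      rewrite /preimage/= Pu; case: Bx.
apply: le_ereal_inf_tmp => _ [F [mF BF] <-].
apply: (@le_trans _ _ (\sum_(i <oo) mass P (U `&` P @^-1` (B `&` F i)))).
  have mU : measurable (U : set (borel _)) by apply: open_borel; case: hP.
  have mBF i : measurable (U `&` P @^-1` (B `&` F i) : set (borel _)).
    by apply: param_preim_measurable hP _; exact: measurableI.
  pose nu := image_density_measure (leb R m) mU (@measurable_id _ (borel 'rV[R]_m) U)
    (density_measurable hP) (fun u _ => density_ge0 P u).
  have nuE V : V `<=` U -> nu V = mass P V.
    by move=> VU; congr (\int[_]_(_ in _) _); apply/setIidPr.
  rewrite -nuE; last exact: subIsetl.
  rewrite (eq_eseriesr (g := fun i => nu (U `&` P @^-1` (B `&` F i)))); last first.
    by move=> i _; rewrite nuE//; exact: subIsetl.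
  apply: measure_sigma_subadditive => //.
  by move=> u [Uu Bu]; have [i _ Fi] := BF _ Bu; exists i.
apply: lee_nneseries => [i _ _|i _]; first exact: mass_ge0.
apply: piece_area_cover => U' P' V hP' VU mV NF.
apply: (le_mass hP hP' _ mV _ VU).
- by apply: param_preim_measurable hP _; exact: measurableI.
- exact: subIsetl.
- move=> _ [u [Uu [Bu Fu]] <-]; apply: NF; split=> //.
  have [_ _ _ [Z oZ PZ] _] := hP.
  by have [] : (N `&` Z) (P u) by rewrite -PZ; exists u.
Qed.

(** Any domain [V] used to bound a piece is split by the preimage of [A] into two disjoint Borel
    domains whose masses add up; [mu_ext_split] extends this to all sets. *)
Lemma borel_caratheodory (A : set G) : measurable (A : set (borel G)) ->
  (area_outer m N w).-caratheodory A.
Proof.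
move=> mA; apply: le_caratheodory_measurable => X.
apply: (mu_ext_split (d := _) (T := borel G)) => //.
  by move=> C; exact: piece_area_ge0.
move=> B mB; apply: piece_area_cover => U P V hP VU mV NB.
have mVA : measurable (V `&` P @^-1` A : set (borel _)).
  have -> : V `&` P @^-1` A = V `&` (U `&` P @^-1` A).
    by apply/seteqP; split => [u [Vu Au]|u [Vu [_ Au]]] //; split=> //; split=> //; exact: VU.
  by apply: measurableI => //; exact: param_preim_measurable hP mA.
have mVA' : measurable (V `&` P @^-1` (~` A) : set (borel _)).
  have -> : V `&` P @^-1` (~` A) = V `\` (V `&` P @^-1` A).
    by apply/seteqP; split => [u [Vu Au]|u [Vu Au]]; split => //;
      [case|move=> Au'; apply: Au].
  exact: measurableD.
have -> : mass P V = mass P (V `&` P @^-1` A) + mass P (V `&` P @^-1` (~` A)).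
  rewrite /mass -ge0_integral_setU//.
  - by rewrite -setIUr -preimage_setU setUv preimage_setT setIT.
  - rewrite -setIUr -preimage_setU setUv preimage_setT setIT.
    apply/measurable_EFinP; apply: measurable_funS (density_measurable hP) => //.
    by apply: open_borel; case: hP.
  - by move=> u _; rewrite lee_fin density_ge0.
  - rewrite disj_set2E; apply/eqP/seteqP; split=> // u [[_ Au] [_ /= nAu]].
    exact: nAu.
have cover C : N `&` (B `&` C) `<=` P @` (V `&` P @^-1` C).
  move=> x [Nx [Bx Cx]]; have [u Vu Pu] := NB x (conj Nx Bx).
  by exists u => //; split=> //; rewrite /preimage/= Pu.
by apply: leeD; apply: (piece_area_mass hP) => //; move=> u [] /VU.
Qed.

(** The identity, changing only the sigma-algebra: pushing [area] forward along it restricts it to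
    Borel sets, where the lemmas on densities apply. *)
Let to_borel : caratheodory_type (area_outer m N w) -> borel G := id.

Let to_borel_measurable : measurable_fun setT to_borel.
Proof. by move=> _ B mB; rewrite setTI; exact: borel_caratheodory. Qed.

Let pushed : set (borel G) -> \bar R := pushforward (area m N w) to_borel.

Let pushed0 : pushed set0 = 0. Proof. exact: outer_measure0. Qed.

Let pushed_ge0 A : 0 <= pushed A. Proof. exact: outer_measure_ge0. Qed.

Let pushed_sigma_additive : semi_sigma_additive pushed.
Proof.
move=> F mF tF mUF.
apply: (@measure_semi_sigma_additive _ _ _ (area m N w)) => //.
- by move=> i; exact (borel_caratheodory (mF i)).
- exact (borel_caratheodory mUF).
Qed.

Let borel_area : {measure set (borel G) -> \bar R} :=
  HB.pack pushed (isMeasure.Build _ _ _ pushed pushed0 pushed_ge0 pushed_sigma_additive).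

Let integral_borel_area (D : set G) (f : G -> \bar R) :
  measurable (D : set (borel G)) -> measurable_fun (D : set (borel G)) f ->
  (forall x, 0 <= f x) ->
  \int[area m N w]_(x in D) f x = \int[borel_area]_(x in D) f x.
Proof. by move=> mD mf f0; rewrite /= /pushed ge0_integral_pushforward. Qed.

Lemma integral_piece U P (D : set G) (f : G -> \bar R) : local_param 1 N U P ->
  measurable (D : set (borel G)) -> N `&` D `<=` P @` U ->
  measurable_fun setT (f : borel G -> \bar R) -> (forall x, 0 <= f x) ->
  \int[area m N w]_(x in D) f x =
  \int[leb R m]_(u in U `&` P @^-1` D) (f (P u) * (density P u)%:E).
Proof.
move=> hP mD ND mf f0; rewrite integral_borel_area//; last exact: measurable_funTS.
have mU : measurable (U : set (borel _)) by apply: open_borel; case: hP.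
have [oU cP _ _ _] := hP.
apply: (@ge0_integral_density_on _ _ _ _ R borel_area (leb R m) D
  (U `&` P @^-1` D) P (density P)) => //.
- exact: param_preim_measurable hP mD.
- apply: (measurable_funS mU); first exact: subIsetl.
  apply: within_continuous_borel => //; apply: within_continuous => u Uu.
  exact: cP.1.
- by apply: (measurable_funS mU) (density_measurable hP); exact: subIsetl.
- by move=> u _; exact: density_ge0.
- by move=> u [].
- move=> B mB BD.
  have -> : borel_area B = area_ext m N w B by [].
  have NB : N `&` B `<=` P @` U by move=> x [Nx /BD Dx]; exact: ND.
  rewrite (area_ext_piece hP mB NB) /mass; congr (\int[_]_(_ in _) _).
  apply/seteqP; split=> u; first by move=> [Uu Bu]; split=> //; split=> //; exact: BD.
  by move=> [[Uu _] Bu].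
Qed.

(** The trace of [D] on [N] being empty, the empty parametrization covers it, with mass zero. *)
Lemma area_disjoint (D : set G) : measurable (D : set (borel G)) ->
  N `&` D = set0 -> area_ext m N w D = 0.
Proof.
move=> mD ND; rewrite (area_ext_piece param0 mD) ?ND ?image_set0//.
by rewrite /mass set0I integral_set0.
Qed.

(** [B] is a Borel hull of [E]. Finiteness permits subtraction, so [B] exceeds [E] by a null set; a
    Borel hull [Z] of this excess is null too, and outside [Z] the sets [E] and [B] coincide. *)
Lemma area_null (E : set G) : (area_outer m N w).-caratheodory E ->
  area_ext m N w E < +oo -> exists Z : set G,
  [/\ measurable (Z : set (borel G)), area_ext m N w Z = 0 &
      measurable (E `\` Z : set (borel G))].
Proof.
move=> mE Efin.
have p0 := @piece_area0 R n k G m N w; have p1 := @piece_area_ge0 R n k G m N w.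
have [B [mB EB BE]] := @mu_ext_hull _ (borel G) R _ p1 E.
have [Z [mZ BZ ZB]] := @mu_ext_hull _ (borel G) R _ p1 (B `\` E).
exists Z; split => //; last first.
  rewrite (_ : E `\` Z = B `\` Z); first exact: measurableD.
  apply/seteqP; split=> x [Ex nZ]; split => //; first exact: EB.
  by apply: contrapT => nE; apply: nZ; apply: BZ; split.
rewrite [LHS]ZB; have := mE B; rewrite setIC (setIidl EB).
rewrite [X in X = _](BE : area_outer m N w B = area_outer m N w E).
have Ef : area_outer m N w E \is a fin_num by rewrite ge0_fin_numE// outer_measure_ge0.
by move=> /(congr1 (fun x => x - area_outer m N w E)); rewrite subee// addeC addeA [X in _ = X + _]addeC subee// add0e => <-.
Qed.

Lemma integral_area_bigcup (Z : nat -> set G) (U : nat -> set 'rV[R]_m)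
    (P : nat -> 'rV[R]_m -> G) (D : set G) (f : G -> \bar R) :
  (forall i, measurable (Z i : set (borel G))) ->
  (forall i, local_param 1 N (U i) (P i)) ->
  (forall i, N `&` Z i `<=` P i @` U i) ->
  measurable (D : set (borel G)) ->
  measurable_fun setT (f : borel G -> \bar R) -> (forall x, 0 <= f x) ->
  \int[area m N w]_(x in D `&` \bigcup_i Z i) f x =
  \sum_(i <oo) \int[leb R m]_(u in U i `&` P i @^-1` (D `&` seqDU Z i))
    (f (P i u) * (density (P i) u)%:E).
Proof.
move=> mZ hP NZ mD mf f0.
have mS i : measurable (seqDU Z i : set (borel G)).
  by apply: measurableD => //; exact: bigsetU_measurable.
rewrite seqDU_bigcup_eq setI_bigcupr integral_borel_area//; last 2 first.
- by apply: bigcupT_measurable => i; exact: measurableI.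
- exact: measurable_funTS.
rewrite ge0_integral_bigcup//; last 3 first.
- by move=> i; exact: measurableI.
- exact: measurable_funTS.
- by apply: trivIset_setIl; exact: trivIset_seqDU.
apply: eq_eseriesr => i _; rewrite -integral_borel_area//; last 2 first.
- exact: measurableI.
- exact: measurable_funTS.
apply: integral_piece => //; first exact: measurableI.
move=> x [Nx [_ Zx]]; apply: NZ; split => //.
exact: (@subset_seqDU _ Z i).
Qed.

End area_pieces.

(** * Tangent spaces, normals and gradients of a hypersurface *)

Section tangent_space.
Context (R : realType) (n k : nat) (G : carnotGroup R n k) (m : nat).
Context (S : set G) (U : set 'rV[R]_m) (P : 'rV[R]_m -> G).
Hypothesis hP : local_param 1 S U P.

Lemma param_row_free u : U u -> row_free (left_mx P u).
Proof.
have [_ _ iP _ _] := hP.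
move=> Uu; apply/inj_row_free => v v0; apply: (iP u Uu).
by rewrite !left_diffE v0 mul0mx.
Qed.

Lemma within_param (Z : topologicalType) (F : G -> Z) u : U u ->
  {for u, continuous (F \o P)} -> F y @[y --> within S (nbhs (P u))] --> F (P u).
Proof.
have [oU cP iP [Z0 oO PO] [Q [cQ K]]] := hP => Uu cF B nB.
have Qu : Q (P u) = u by rewrite K// inE.
have OPu : (S `&` Z0) (P u) by rewrite -PO; exists u.
have cQu : Q y @[y --> within (P @` U) (nbhs (P u))] --> Q (P u).
  by apply: ((subspace_continuousP _ _).1 cQ); exists u.
rewrite Qu in cQu.
have nB' : \forall w \near u, B (F (P w)) := cF _ nB.
have QB : \forall y \near P u, (P @` U) y -> B (F (P (Q y))) := cQu _ nB'.
have nO : \forall y \near P u, Z0 y by apply: open_nbhs_nbhs; case: OPu.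
rewrite /= nbhs_simpl /within /=.
apply: filterS2 nO QB => y Oy yB Sy.
have PUy : (P @` U) y by rewrite PO.
have [w Uw Pw] := PUy.
by have := yB PUy; rewrite -Pw K ?inE.
Qed.

(** By [transition], [Q] lifts the curve to a C^1 curve in coordinates, and [v] is its velocity
    there. The same [v] gives the velocity in the group and the derivative of [f] along the curve,
    which is what identifies the gradient. *)
Lemma tangent_curve (c : R -> G) (f : G -> R) u : U u -> curve_at S (P u) c ->
  Cr 1 U (f \o P : _ -> R^o) -> exists v, velocity c = v *m left_mx P u /\
    derive1 (f \o c : R^o -> R^o) 0 = 'd (f \o P : _ -> R^o) u v.
Proof.
have [oU cP iP [Z0 oO PO] [Q [cQ K]]] := hP.
move=> Uu [c0 [eps eps0 [cc cS]]] cf.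
pose I : set R^o := `]- eps, eps[%classic.
have oI : open I by exact: interval_open.
pose W := I `&` (c : R^o -> G) @^-1` Z0.
have oW : open W by apply: open_preim => //; exact: cc.1.
have W0 : W 0.
  split; first by rewrite /I /= in_itv/= oppr_lt0 eps0.
  rewrite /preimage /= c0.
  by have [] : (S `&` Z0) (P u) by rewrite -PO; exists u.
have WP t : W t -> (P @` U) (c t) by move=> [It Ot]; rewrite PO; split => //; exact: cS.
have sWI : W `<=` I by move=> t [].
have [hW hd] := transition oU cP iP cQ K oW (CrG1_sub sWI cc) WP.
have Q0 : Q (c 0) = u by rewrite c0 K// inE.
exists ('d (Q \o c) (0 : R^o) 1); split.
  by rewrite -left_diffE -Q0; exact: hd.
have dh : differentiable (Q \o c : R^o -> _) 0 by exact: hW.1.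
have df : differentiable (f \o P : _ -> R^o) ((Q \o c) 0) by rewrite /= Q0; exact: cf.1.
have E : {near (0 : R^o), (f \o P : _ -> R^o) \o (Q \o c) =1 (f \o c : R^o -> R^o)}.
  near=> t => /=; have [w Uw Pw] : (P @` U) (c t).
    by apply: WP; near: t; exact: open_nbhs_nbhs.
  by rewrite -Pw K ?inE.
have [d1 E1] := diff_near_eq E (differentiable_comp dh df).
rewrite (derive1E' d1) E1 (diff_comp dh df) /=.
by rewrite Q0.
Unshelve. all: by end_near.
Qed.

Lemma Cr1_line (u v : 'rV[R]_m) (W : set R^o) :
  Cr 1 W (fun t : R^o => u + t *: v) /\
  forall t, 'd (fun t : R^o => u + t *: v) t 1 = v.
Proof.
have H (t : R^o) : differentiable (fun t : R^o => u + t *: v) t /\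
    'd (fun t : R^o => u + t *: v) t = ( *:%R ^~ v) :> (R^o -> _).
  have lin : linear ( *:%R ^~ v : R^o -> 'rV[R]_m).
    by move=> a y z; rewrite scalerDl -scalerA.
  pose L : {linear R^o -> 'rV[R]_m} :=
    HB.pack ( *:%R ^~ v) (GRing.isLinear.Build _ _ _ _ _ lin).
  apply: (near_le_diff (L := L)); first exact: scalel_continuous.
  move=> d d0; near=> s.
  rewrite /= opprD addrACA subrr add0r -scalerBl subrr normr0.
  by rewrite mulr_ge0// ltW.
split; last by move=> t; rewrite (H t).2 scale1r.
split=> [t _|s t _]; first exact: (H t).1.
have -> : (fun t : R^o => 'd (fun t : R^o => u + t *: v) t s) = fun=> s *: v.
  by apply/funext => r; rewrite (H r).2.
exact: cst_continuous.
Unshelve. all: by end_near.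
Qed.

(** The curve is the image under [P] of the line [u + t *: v], on a time interval short enough to
    stay in [U]. *)
Lemma tangent_line (f : G -> R) u v : U u ->
  Cr 1 U (f \o P : _ -> R^o) -> exists c, [/\ curve_at S (P u) c,
    velocity c = v *m left_mx P u &
    derive1 (f \o c : R^o -> R^o) 0 = 'd (f \o P : _ -> R^o) u v].
Proof.
have [oU cP iP [Z0 oO PO] _] := hP.
move=> Uu cf; pose h := fun t : R^o => u + t *: v.
have h0 : h 0 = u by rewrite /h scale0r addr0.
have [Ch dh1] := Cr1_line u v setT.
have dh : differentiable h 0 by exact: Ch.1.
have ch : {for 0, continuous h} by exact: (Cr1_continuous Ch).
have nU : \forall t \near (0 : R^o), U (h t).
  by apply: ch; rewrite h0; exact: open_nbhs_nbhs.
have [eps /= eps0 Ueps] := (nbhs_ballP _ _).1 nU.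
have IU (t : R^o) : `]- eps, eps[%classic t -> U (h t).
  rewrite /= in_itv/= => teps; apply: Ueps.
  by rewrite -ball_normE /ball_ /= sub0r normrN ltr_norml.
pose I : set R^o := `]- eps, eps[%classic.
have oI : open I by exact: interval_open.
exists (P \o h); split.
- split; first by rewrite /= h0.
  exists eps => //; split; last first.
    move=> t /IU Uh; have [] // : (S `&` Z0) (P (h t)).
    by rewrite -PO; exists (h t).
  by apply: (CrG1_comp oI _ cP) => //; exact: Cr1_sub Ch.
- rewrite -left_diffE /velocity.
  have Uh0 : U (h 0) by rewrite h0.
  have PE : {near (0 : R^o), P \o h =1 P \o h} by near=> t.
  have E := left_diff_comp (1 : R^o) oU cP Uh0 dh PE.
  by rewrite E dh1 h0.
- have df : differentiable (f \o P : _ -> R^o) (h 0) by rewrite h0; exact: cf.1.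
  rewrite (_ : f \o (P \o h) = (f \o P) \o h)// (derive1E' (differentiable_comp dh df)).
  by rewrite (diff_comp dh df) /= dh1 h0.
Unshelve. all: by end_near.
Qed.

Lemma tangentE u : U u -> tangent S (P u) = [set v | (v <= left_mx P u)%MS].
Proof.
(* Only velocities matter here, so the function followed along the curves is taken constant. *)
move=> Uu; have cf : Cr 1 U ((fun _ : G => 0) \o P : _ -> R^o).
  exact: (@Cr1_cst R 'rV[R]_m R^o).
apply/seteqP; split => [_ [c hc <-]|v /submxP[D ->]].
  by have [v [-> _]] := tangent_curve Uu hc cf; exact: submxMl.
by have [c [hc vc _]] := tangent_line D Uu cf; exists c.
Qed.

End tangent_space.

(** * Orthogonal projections and the unit normal *)

Section orthogonal_projections.
Context (R : realType) (n k : nat) (G : carnotGroup R n k).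
Local Notation Gam := (metric_mx G).
Implicit Types (v w z : 'rV[R]_n).

Lemma metricBl u v w : metric G (u - v) w = metric G u w - metric G v w.
Proof. by rewrite metricDl -scaleN1r metricZl mulN1r. Qed.

Lemma metricDr u v w : metric G w (u + v) = metric G w u + metric G w v.
Proof. by rewrite ![metric G w _]Defs.metric_sym metricDl. Qed.

Lemma metricZr a u w : metric G w (a *: u) = a * metric G w u.
Proof. by rewrite ![metric G w _]Defs.metric_sym metricZl. Qed.

Lemma metricBr u v w : metric G w (u - v) = metric G w u - metric G w v.
Proof. by rewrite ![metric G w _]Defs.metric_sym metricBl. Qed.

(** [orth_proj] picks a solution with [get], so uniqueness is what matters: two solutions differ by
    an element of [E] orthogonal to itself. *)
Lemma orth_projE (E : set 'rV[R]_n) v w :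
  (forall x y, E x -> E y -> E (x - y)) -> E w ->
  (forall z, E z -> metric G (v - w) z = 0) -> orth_proj G E v = w.
Proof.
move=> Esub Ew vw; rewrite /orth_proj.
have [] : [set w | E w /\ forall z, E z -> metric G (v - w) z = 0]
  (get [set w | E w /\ forall z, E z -> metric G (v - w) z = 0]).
  exact: (@getPex _ [set w | E w /\ forall z, E z -> metric G (v - w) z = 0])
    (ex_intro _ w (conj Ew vw)).
set w' := get _ => Ew' vw'; apply/eqP; rewrite -subr_eq0 -(metric_eq0 G).
have Eww : E (w' - w) by exact: Esub.
have -> : metric G (w' - w) (w' - w) = metric G ((v - w) - (v - w')) (w' - w).
  by congr (metric G _ _); rewrite opprB [RHS]addrC addrA subrK.
by rewrite metricBl vw// vw'// subrr.
Qed.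

(** The orthogonal projection on the row space of a matrix [B] of full row rank, with
    [B *m Gam *m B^T] as Gram matrix, acting on row vectors from the right. It depends continuously
    on such [B]. *)
Definition rowproj p (B : 'M[R]_(p, n)) : 'M[R]_n :=
  Gam *m B^T *m invmx (B *m Gam *m B^T) *m B.

Lemma rowprojP p (B : 'M[R]_(p, n)) v w : row_free B -> (w <= B)%MS ->
  metric G (v - v *m rowproj B) w = 0.
Proof.
move=> fB /submxP[D ->]; rewrite metricE trmx_mul.
have -> : (v - v *m rowproj B) *m Gam *m (B^T *m D^T) =
    (v *m (Gam *m B^T - Gam *m B^T *m (invmx (B *m Gam *m B^T) *m (B *m Gam *m B^T)))) *m D^T.
  rewrite mulmxBl mulmxBl mulmxBr mulmxBl /rowproj !mulmxA; congr (_ - _).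
by rewrite mulVmx ?gram_unit// mulmx1 subrr mulmx0 mul0mx mxE.
Qed.

Lemma rowproj_sub p (B : 'M[R]_(p, n)) v : (v *m rowproj B <= B)%MS.
Proof. by rewrite /rowproj !mulmxA submxMl. Qed.

(** [row_base] discards dependent rows of [K], which makes the Gram matrix in [rowproj]
    invertible. *)
Lemma orth_proj_mx p (K : 'M[R]_(p, n)) v :
  orth_proj G [set v | (v <= K)%MS] v = v *m rowproj (row_base K).
Proof.
apply: orth_projE => [x y xK yK||z zK] /=.
- by rewrite addmx_sub// eqmx_opp.
- by rewrite -(eq_row_base K); exact: rowproj_sub.
- by apply: rowprojP; [exact: row_base_free|rewrite eq_row_base].
Qed.

Lemma orth_proj_mxP p (K : 'M[R]_(p, n)) v z : (z <= K)%MS ->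
  metric G (v - orth_proj G [set v | (v <= K)%MS] v) z = 0.
Proof.
by move=> zK; rewrite orth_proj_mx; apply: rowprojP;
  [exact: row_base_free|rewrite eq_row_base].
Qed.

Lemma orth_proj_mx_sub p (K : 'M[R]_(p, n)) v :
  (orth_proj G [set v | (v <= K)%MS] v <= K)%MS.
Proof. by rewrite orth_proj_mx (submx_trans (rowproj_sub _ _))// eq_row_base. Qed.

Lemma vspace_mx (E : {vspace 'rV[R]_n}) : exists K : 'M[R]_(\dim E, n),
  [set v | v \in E] = [set v | (v <= K)%MS].
Proof.
pose K : 'M[R]_(\dim E, n) := \matrix_i (vbasis E)`_i; exists K.
apply/seteqP; split => v /=.
  move=> vE; rewrite (coord_vbasis vE); apply: summx_sub => i _.
  by apply: scalemx_sub; rewrite -(rowK (fun i : 'I_(\dim E) => (vbasis E)`_i) i) row_sub.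
move=> /submxP[D ->]; rewrite mulmx_sum_row; apply: rpred_sum => i _.
by rewrite rpredZ// rowK; apply: vbasis_mem; rewrite mem_nth// size_tuple.
Qed.

End orthogonal_projections.

Section unit_normal.
Context (R : realType) (n k : nat) (G : carnotGroup R n k) (m : nat).
Hypothesis nm : n = m.+1.
Local Notation Gam := (metric_mx G).
Context (L : 'M[R]_(m, n)).
Hypothesis fL : row_free L.

(** The vectors orthogonal to the rows of [L] form the kernel of [Gam *m L^T], which is a line
    because [L] has rank [n - 1]. *)
Lemma exists_normal : exists v, metric G v v = 1 /\
  forall w, (w <= L)%MS -> metric G v w = 0.
Proof.
have rk : \rank (kermx (Gam *m L^T)) = 1%N.
  rewrite mxrank_ker -mxrank_tr trmx_mul trmxK metric_mx_sym.
  by rewrite mxrankMfree ?row_free_unit ?metric_mx_unit// (eqP fL) nm subSnn.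
have /rowV0Pn[v vK v0] : kermx (Gam *m L^T) != 0 by rewrite -mxrank_eq0 rk.
have vL w : (w <= L)%MS -> metric G v w = 0.
  move=> /submxP[D ->]; rewrite metricE trmx_mul.
  have /sub_kermxP vL0 := vK.
  by rewrite !mulmxA -(mulmxA v) vL0 mul0mx mxE.
have p := @Defs.metric_pos _ _ _ G _ v0.
exists ((Num.sqrt (metric G v v))^-1 *: v); split; last first.
  by move=> w /vL vw; rewrite metricZl vw mulr0.
rewrite metricZl metricZr mulrA -expr2 exprVn sqr_sqrtr ?ltW//.
by rewrite mulVf// gt_eqF.
Qed.

Lemma normal_decomposition nu w : metric G nu nu = 1 ->
  (forall w, (w <= L)%MS -> metric G nu w = 0) ->
  w = w *m rowproj G L + metric G w nu *: nu.
Proof.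
move=> nn nL.
have rk : \rank (kermx (Gam *m L^T)) = 1%N.
  rewrite mxrank_ker -mxrank_tr trmx_mul trmxK metric_mx_sym.
  by rewrite mxrankMfree ?row_free_unit ?metric_mx_unit// (eqP fL) nm subSnn.
have kerP v : (forall w, (w <= L)%MS -> metric G v w = 0) ->
    (v <= kermx (Gam *m L^T))%MS.
  move=> vL; apply/sub_kermxP/rowP => j.
  have := vL (row j L) (row_sub _ _); rewrite metricE => E.
  rewrite [RHS]mxE -[RHS]E rowE trmx_mul trmx_delta !mulmxA -colE.
  by rewrite [RHS]mxE.
have nu0 : nu != 0.
  by apply: contra_eq_neq nn => ->; rewrite metric0l eq_sym oner_eq0.
have sub : (kermx (Gam *m L^T) <= nu)%MS.
  have [_ E] := mxrank_leqif_sup (kerP _ nL).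
  by rewrite -E rk rank_rV nu0.
have /sub_rVP[a E] : (w - w *m rowproj G L <= nu)%MS.
  apply: (submx_trans _ sub); apply: kerP => z zL; exact: rowprojP.
have -> : metric G w nu = a.
  have := congr1 (fun x => metric G x nu) E.
  rewrite metricBl metricZl nn mulr1 => <-.
  by rewrite [X in _ - X]Defs.metric_sym nL ?subr0// rowproj_sub.
by rewrite -E addrC subrK.
Qed.

End unit_normal.

Section horizontal_part.
Context (R : realType) (n k : nat) (G : carnotGroup R n k) (m p : nat).
Hypothesis nm : n = m.+1.
Local Notation Gam := (metric_mx G).
Context (L : 'M[R]_(m, n)) (K : 'M[R]_(p, n)) (nu : 'rV[R]_n).
Hypothesis fL : row_free L.
Hypothesis nn : metric G nu nu = 1.
Hypothesis nL : forall w, (w <= L)%MS -> metric G nu w = 0.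
Let Hr := [set v : 'rV[R]_n | (v <= K)%MS].
Let HS := [set v : 'rV[R]_n | (v <= K :&: L)%MS].

(** The right side is free of [nu]. The sign of the normal is chosen anew at each point, so the
    normal need not vary continuously; the tangent projection does. *)
Lemma sqr_metric_normal a :
  metric G a nu ^+ 2 = metric G (a - a *m rowproj G L) a.
Proof.
have -> : a - a *m rowproj G L = metric G a nu *: nu.
  by rewrite {1}(normal_decomposition nm fL a nn nL) addrAC subrr add0r.
rewrite metricZl.
by rewrite [metric G nu a]Defs.metric_sym expr2.
Qed.

(** Again [nu] is eliminated: the rank one matrix [nu^T *m nu] equals the inverse of [Gam] times the
    complement of the tangent projection, and the trace makes the quadratic expression in [nu]
    linear in that matrix. *)
Lemma metric_normal_proj (M : 'M[R]_n) : metric G (nu *m M) (nu *m M) =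
  \tr (M *m Gam *m M^T *m (invmx Gam *m (1%:M - rowproj G L))).
Proof.
have -> : invmx Gam *m (1%:M - rowproj G L) = nu^T *m nu.
  have E : 1%:M - rowproj G L = Gam *m nu^T *m nu.
    apply/row_matrixP => i; rewrite !rowE mulmxBr mulmx1.
    rewrite {1}(normal_decomposition nm fL (delta_mx 0 i) nn nL).
    rewrite addrAC subrr add0r metricE !mulmxA [_ *m nu^T]mx11_scalar.
    by rewrite mul_scalar_mx mxE eqxx mulr1n.
  by rewrite E -!mulmxA mulKmx// metric_mx_unit.
rewrite mulmxA mxtrace_mulC !mulmxA metricE trmx_mul !mulmxA.
by rewrite trace_mx11.
Qed.

(* Multiplying by [|q|^2] avoids the division by the horizontal part [q] of the
   normal, which vanishes at characteristic points. *)
Lemma sqr_hor_tangent_proj v (q := orth_proj G Hr nu) (a := orth_proj G Hr v) :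
  metric G q q * metric G (orth_proj G HS v) (orth_proj G HS v) =
  metric G q q * metric G a a - metric G a nu ^+ 2.
Proof.
have qK : (q <= K)%MS by exact: orth_proj_mx_sub.
have aK : (a <= K)%MS by exact: orth_proj_mx_sub.
have qP z : (z <= K)%MS -> metric G q z = metric G nu z.
  by move=> zK; apply/eqP; rewrite eq_sym -subr_eq0 -metricBl orth_proj_mxP.
have aP z : (z <= K)%MS -> metric G a z = metric G v z.
  by move=> zK; apply/eqP; rewrite eq_sym -subr_eq0 -metricBl orth_proj_mxP.
set b := orth_proj G HS v.
have anu : metric G a nu = metric G a q.
  by rewrite ![metric G a _]Defs.metric_sym qP.
have qnu : metric G q nu = metric G q q by rewrite [LHS]Defs.metric_sym -qP.
set Q := metric G q q; set s := metric G a q in anu.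
(* Up to the factor [Q], the component of [a] orthogonal to [q]. It is horizontal and orthogonal to
   [nu], hence lies in the horizontal tangent space, and [bE] identifies it with [Q *: b]. *)
pose r := Q *: a - s *: q.
have rnu : metric G r nu = 0.
  by rewrite metricBl !metricZl anu qnu -/s -/Q mulrC subrr.
have rHS : (r <= K :&: L)%MS.
  rewrite sub_capmx; apply/andP; split.
    by rewrite addmx_sub ?eqmx_opp ?scalemx_sub.
  by rewrite (normal_decomposition nm fL r nn nL) rnu scale0r addr0 rowproj_sub.
have bE : Q *: b = r.
  have Esub x y : HS x -> HS y -> HS (x - y).
    by move=> xK yK; rewrite /HS/= addmx_sub// eqmx_opp.
  have <- : orth_proj G HS (Q *: v) = Q *: b.
    apply: orth_projE => //; first by rewrite /HS/= scalemx_sub// orth_proj_mx_sub.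
    by move=> z zE; rewrite -scalerBr metricZl orth_proj_mxP// mulr0.
  apply: orth_projE => // z; rewrite /HS/= sub_capmx => /andP[zK zL].
  by rewrite /r !metricBl !metricZl aP// qP// nL// mulr0 subr0 subrr.
(* At a characteristic point both sides vanish; elsewhere the identity is multiplied by [Q * Q], so
   that [Q *: b] can be replaced by [r]. *)
have [Q0|Q0] := eqVneq Q 0.
  have q0 : q = 0 by apply/eqP; rewrite -(metric_eq0 G) -/Q Q0.
  by rewrite Q0 !mul0r anu /s q0 Defs.metric_sym metric0l expr0n subrr.
apply: (mulfI (mulf_neq0 Q0 Q0)).
have -> : Q * Q * (Q * metric G b b) = Q * metric G r r.
  by rewrite -bE metricZl metricZr; ring.
rewrite /r metricBl !metricBr !metricZl !metricZr [metric G q a]Defs.metric_sym.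
rewrite anu -/s -/Q; ring.
Qed.

End horizontal_part.

Section limits.
Context (R : realType) (n k : nat) (G : carnotGroup R n k).
Context (T : Type) (F : set_system T) {FF : Filter F}.

Lemma cvg_metric (f h : T -> 'rV[R]_n) (a b : 'rV[R]_n) :
  f @ F --> a -> h @ F --> b -> metric G (f x) (h x) @[x --> F] --> metric G a b.
Proof.
move=> fa hb; rewrite metricE; under eq_fun do rewrite metricE.
apply: (cvg_mxP _ _).1; apply: cvg_mulmx (cvg_trmx hb).
by apply: cvg_mulmx fa _; exact: cvg_cst.
Qed.

Lemma cvg_rowproj p (B : T -> 'M[R]_(p, n)) (L : 'M[R]_(p, n)) :
  row_free L -> B x @[x --> F] --> L -> rowproj G (B x) @[x --> F] --> rowproj G L.
Proof.
move=> fL BL; apply: (cvg_mulmx _ BL); apply: cvg_mulmx.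
  by apply: (cvg_mulmx _ (cvg_trmx BL)); exact: cvg_cst.
by apply: cvg_invmx (gram_unit G fL); exact: cvg_gram.
Qed.

Lemma cvg_trace p (A : T -> 'M[R]_p) (L : 'M[R]_p) :
  A x @[x --> F] --> L -> \tr (A x) @[x --> F] --> \tr L.
Proof. by move=> /cvg_mxP AL; apply: cvg_sumR => i _; exact: AL. Qed.

End limits.

Section C1_parametrizations.
Context (R : realType) (n k : nat) (G : carnotGroup R n k).

(** [C1_on] speaks of the C^2 parametrizations of [S], while areas use C^1 ones; the two differ
    locally by a C^1 transition map. *)
Lemma C1_on_param (S : set G) (phi : G -> R) U (P : 'rV[R]_n.-1 -> G) :
  submanifold 2 n.-1 S -> C1_on S phi -> local_param 1 S U P ->
  Cr 1 U (phi \o P : _ -> R^o).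
Proof.
move=> hS cphi [oU cP iP [Z oZ PZ] _]; apply: Cr1_local => u Uu.
have [U0 [P0 [hP0 P0u]]] : exists U0 P0, @local_param R n k G 2 n.-1 S U0 P0 /\ (P0 @` U0) (P u).
  by apply: hS; have [] : (S `&` Z) (P u) by rewrite -PZ; exists u.
have [oU0 cP0 iP0 [Z0 oZ0 PZ0] [Q0 [cQ0 K0]]] := local_paramW hP0.
have oW : open (U `&` P @^-1` Z0) by apply: open_preim => //; exact: cP.1.
have Z0u : Z0 (P u) by have [] : (S `&` Z0) (P u) by rewrite -PZ0.
have WP w : (U `&` P @^-1` Z0) w -> (P0 @` U0) (P w).
  move=> [Uw Zw]; rewrite PZ0; split=> //.
  by have [] : (S `&` Z) (P w) by rewrite -PZ; exists w.
have sWU : U `&` P @^-1` Z0 `<=` U by move=> w [].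
have [hW _] := transition oU0 cP0 iP0 cQ0 K0 oW (CrG1_sub sWU cP) WP.
exists (P @^-1` Z0) => //.
have WU0 w : (U `&` P @^-1` Z0) w -> U0 ((Q0 \o P) w) /\ P0 ((Q0 \o P) w) = P w.
  by move=> /WP[v Uv Pv]; rewrite /= -Pv K0 ?inE.
have c1 : Cr 1 (U `&` P @^-1` Z0) ((phi \o P0 : _ -> R^o) \o (Q0 \o P)).
  exact: (Cr1_comp oW (fun w Ww => (WU0 w Ww).1) hW (cphi _ _ hP0)).
by apply: (Cr1_eq oW _ c1) => w Ww /=; rewrite (WU0 w Ww).2.
Qed.

Lemma within_param_continuous m (S N : set G) (Z : topologicalType) (F : G -> Z)
    U (P : 'rV[R]_m -> G) u :
  {within S, continuous F} -> N `<=` S -> local_param 1 N U P -> U u ->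
  {for u, continuous (F \o P)}.
Proof.
move=> /subspace_continuousP cF NS [oU cP _ [Z0 oO PO] _] Uu.
have SP w : U w -> S (P w).
  by move=> Uw; apply: NS; have [] : (N `&` Z0) (P w) by rewrite -PO; exists w.
move=> B nB.
have FB : \forall y \near P u, S y -> B (F y) := cF (P u) (SP u Uu) _ nB.
have {}FB : \forall w \near u, S (P w) -> B (F (P w)) := cP.1 u Uu _ FB.
suff : \forall w \near u, B (F (P w)) by [].
near=> w.
have : S (P w) by apply: SP; near: w; exact: open_nbhs_nbhs.
by near: w.
Unshelve. all: by end_near.
Qed.

Lemma within_param_measurable m (S N : set G) (F : G -> R)
    U (P : 'rV[R]_m -> G) :
  {within S, continuous F} -> N `<=` S -> local_param 1 N U P ->
  measurable_fun (U : set (borel _)) (F \o P : borel _ -> R).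
Proof.
move=> cF NS hP; have [oU _ _ _ _] := hP.
apply: within_continuous_borelR; first exact: open_borel.
by apply: within_continuous => u Uu; exact (within_param_continuous cF NS hP Uu).
Qed.

End C1_parametrizations.

Section hypersurface_geometry.
Context (R : realType) (n k : nat) (G : carnotGroup R n k) (m : nat).
Hypothesis nm : n = m.+1.
Context (S : set G) (phi : G -> R).
Hypothesis hS : forall x, S x -> exists U (P : 'rV[R]_m -> G) u,
  [/\ local_param 1 S U P, U u & x = P u].
Hypothesis cphi : forall U (P : 'rV[R]_m -> G), local_param 1 S U P ->
  Cr 1 U (phi \o P : _ -> R^o).
Local Notation Gam := (metric_mx G).
Local Notation nu := (normal S).
Local Notation PH := (orth_proj G (horizontal G)).
Implicit Types (U : set 'rV[R]_m) (P : 'rV[R]_m -> G).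

Definition diff_row P u : 'rV[R]_m := \row_i 'd (phi \o P : _ -> R^o) u (delta_mx 0 i).

(** The coordinate expression of the Riemannian gradient: the inverse Gram matrix applied to the
    differential, pushed forward by [P]. *)
Definition param_grad P u : 'rV[R]_n :=
  diff_row P u *m invmx (left_mx P u *m Gam *m (left_mx P u)^T) *m left_mx P u.

Lemma diff_rowE P u v : 'd (phi \o P : _ -> R^o) u v = (diff_row P u *m v^T) 0 0.
Proof.
rewrite (@row_linE R m R^o ('d (phi \o P : _ -> R^o) u) v) !mxE.
by apply: eq_bigr => j _; rewrite !mxE mulrC.
Qed.

Lemma param_gradP U P u v : local_param 1 S U P -> U u ->
  metric G (param_grad P u) (v *m left_mx P u) = (diff_row P u *m v^T) 0 0.
Proof.
move=> hP Uu; rewrite -gram_form mulmxKV//.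
exact: gram_unit (param_row_free hP Uu).
Qed.

(** [grad_T] picks a solution with [get]. Its difference with [param_grad] is the velocity of a
    curve, and both have the same product with this velocity, so the difference has norm zero. *)
Lemma grad_TE U P u : local_param 1 S U P -> U u ->
  grad_T S phi (P u) = param_grad P u.
Proof.
move=> hP Uu; set E := [set v | tangent S (P u) v /\ forall c, curve_at S (P u) c ->
  metric G v (velocity c) = derive1 (phi \o c : R^o -> R^o) 0].
have gE : E (param_grad P u).
  split; first by rewrite (tangentE hP Uu) /= submxMl.
  move=> c hc; have [v [-> ->]] := tangent_curve hP Uu hc (cphi hP).
  by rewrite (param_gradP _ hP Uu) diff_rowE.
have [T1 H1] : E (grad_T S phi (P u)) := getPex (ex_intro _ _ gE).
apply/eqP; rewrite -subr_eq0 -(metric_eq0 G).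
move: T1; rewrite (tangentE hP Uu) /= => /submxP[D E1].
have -> : grad_T S phi (P u) - param_grad P u =
    (D - diff_row P u *m invmx (left_mx P u *m Gam *m (left_mx P u)^T)) *m left_mx P u.
  by rewrite mulmxBl E1.
set v := (X in X *m _); have [c [hc vc dc]] := tangent_line hP v Uu (cphi hP).
have {1}-> : v *m left_mx P u = grad_T S phi (P u) - param_grad P u.
  by rewrite mulmxBl -E1.
by rewrite metricBl (param_gradP _ hP Uu) -vc H1// dc diff_rowE subrr.
Qed.

Lemma param_grad_eq0 U P u : local_param 1 S U P -> U u ->
  (param_grad P u == 0) = (diff_row P u == 0).
Proof.
move=> hP Uu; apply/eqP/eqP => [g0|d0]; last by rewrite /param_grad d0 !mul0mx.
apply/rowP => j; have := param_gradP (delta_mx 0 j) hP Uu.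
by rewrite g0 metric0l trmx_delta -colE !mxE => <-.
Qed.

Lemma normalP U P u : local_param 1 S U P -> U u ->
  metric G (nu (P u)) (nu (P u)) = 1 /\
  forall w, (w <= left_mx P u)%MS -> metric G (nu (P u)) w = 0.
Proof.
move=> hP Uu; have [v hv] := exists_normal G nm (param_row_free hP Uu).
have ne : [set v | metric G v v = 1 /\ forall w, tangent S (P u) w -> metric G v w = 0] !=set0.
  by exists v; split; [exact: hv.1|move=> w; rewrite (tangentE hP Uu); exact: hv.2].
by have [-> h] := getPex ne; split=> // w wL; apply: h; rewrite (tangentE hP Uu).
Qed.

Definition hor_normal x : R := (metric_norm G (PH (nu x)))%:num.
Definition grad_norm x : R := (metric_norm G (grad_T S phi x))%:num.
(** The product is kept whole: at characteristic points the horizontal tangent space changes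
    dimension and the second factor may jump, whereas the product is continuous on [S]. *)
Definition hor_normal_grad x : R := hor_normal x * (metric_norm G (grad_H S phi x))%:num.

Definition sqr_hor_normal (M : 'M[R]_n) P u :=
  \tr (M *m Gam *m M^T *m (invmx Gam *m (1%:M - rowproj G (left_mx P u)))).

Lemma hor_normalE p (K : 'M[R]_(p, n)) U P u :
  horizontal G = [set v | (v <= K)%MS] -> local_param 1 S U P -> U u ->
  hor_normal (P u) = Num.sqrt (sqr_hor_normal (rowproj G (row_base K)) P u).
Proof.
move=> HK hP Uu; have [nn nL] := normalP hP Uu.
rewrite /hor_normal /= HK orth_proj_mx.
by rewrite (metric_normal_proj nm (param_row_free hP Uu) nn nL).
Qed.

Lemma hor_tangentE p (K : 'M[R]_(p, n)) U P u :
  horizontal G = [set v | (v <= K)%MS] -> local_param 1 S U P -> U u ->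
  hor_tangent S (P u) = [set v | (v <= K :&: left_mx P u)%MS].
Proof.
move=> HK hP Uu; rewrite /hor_tangent HK (tangentE hP Uu); apply/seteqP.
by split => v /=; rewrite sub_capmx => /andP.
Qed.

(** Combines [sqr_hor_tangent_proj] with the elimination of the normal: under the root only
    [param_grad P] and [left_mx P] vary with [u], and both are continuous. *)
Lemma hor_normal_gradE p (K : 'M[R]_(p, n)) U P u
    (a := param_grad P u *m rowproj G (row_base K)) :
  horizontal G = [set v | (v <= K)%MS] -> local_param 1 S U P -> U u ->
  hor_normal_grad (P u) =
  Num.sqrt (sqr_hor_normal (rowproj G (row_base K)) P u * metric G a a -
            metric G (a - a *m rowproj G (left_mx P u)) a).
Proof.
move=> HK hP Uu; have [nn nL] := normalP hP Uu; have fL := param_row_free hP Uu.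
rewrite -(sqr_metric_normal nm fL nn nL) /hor_normal_grad (hor_normalE HK hP Uu).
have E := hor_tangentE HK hP Uu.
rewrite /= /grad_H E (grad_TE hP Uu) -sqrtrM; last first.
  by rewrite /sqr_hor_normal -(metric_normal_proj nm fL nn nL) metric_ge0.
congr Num.sqrt; rewrite /sqr_hor_normal -(metric_normal_proj nm fL nn nL) /a -!orth_proj_mx.
exact: (sqr_hor_tangent_proj nm K fL nn nL).
Qed.

Lemma within_charts (Z : topologicalType) (F : G -> Z) :
  (forall U P u, local_param 1 S U P -> U u -> {for u, continuous (F \o P)}) ->
  {within S, continuous F}.
Proof.
move=> cF; apply/subspace_continuousP => x Sx.
have [U [P [u [hP Uu ->]]]] := hS Sx.
exact (within_param hP Uu (cF U P u hP Uu)).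
Qed.

Lemma diff_row_continuous U P u : local_param 1 S U P -> U u ->
  {for u, continuous (diff_row P)}.
Proof.
move=> hP Uu; apply/continuous_mxP => i j; have [_ cd] := cphi hP.
have c1 : {for u, continuous (fun w => 'd (phi \o P : _ -> R^o) w (delta_mx 0 j))}.
  exact: cd.
rewrite (_ : (fun w => _) = fun w => 'd (phi \o P : _ -> R^o) w (delta_mx 0 j))//.
by apply/funext => w; rewrite mxE.
Qed.

Lemma left_mx_param_continuous U P u : local_param 1 S U P -> U u ->
  {for u, continuous (left_mx P)}.
Proof. by move=> [oU cP _ _ _] Uu; exact (left_mx_continuous oU cP Uu). Qed.

Lemma param_grad_continuous U P u : local_param 1 S U P -> U u ->
  {for u, continuous (param_grad P)}.
Proof.
move=> hP Uu; have cL := left_mx_param_continuous hP Uu.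
have uG := gram_unit G (param_row_free hP Uu).
exact (cvg_mulmx (cvg_mulmx (diff_row_continuous hP Uu)
  (cvg_invmx (cvg_gram (G := G) cL) uG)) cL).
Qed.

Lemma sqr_hor_normal_continuous M U P u : local_param 1 S U P -> U u ->
  {for u, continuous (sqr_hor_normal M P)}.
Proof.
move=> hP Uu; have cL := left_mx_param_continuous hP Uu.
have cr : rowproj G (left_mx P w) @[w --> u] --> rowproj G (left_mx P u).
  exact (cvg_rowproj (param_row_free hP Uu) cL).
exact (cvg_trace (cvg_mulmx (cvg_cst _) (cvg_mulmx (cvg_cst _) (cvgB (cvg_cst _) cr)))).
Qed.

Lemma for_near_eq (Z : topologicalType) (f h : 'rV[R]_m -> Z) U u :
  open U -> U u -> (forall w, U w -> h w = f w) -> {for u, continuous f} ->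
  {for u, continuous h}.
Proof.
move=> oU Uu hf cf; refine (continuous_near_eq cf _).
by near=> w; rewrite hf//; near: w; exact: open_nbhs_nbhs.
Unshelve. all: by end_near.
Qed.

Lemma sqrt_for (f : 'rV[R]_m -> R) u : {for u, continuous f} ->
  {for u, continuous (fun w => Num.sqrt (f w))}.
Proof. by move=> cf; exact (cvg_comp _ _ cf (@sqrt_continuous R _)). Qed.

Lemma hor_normal_continuous : {within S, continuous hor_normal}.
Proof.
apply: within_charts => U P u hP Uu; have [p [K HK]] : exists p (K : 'M[R]_(p, n)),
    horizontal G = [set v | (v <= K)%MS].
  by have [K HK] := vspace_mx (layer G 1); exists (\dim (layer G 1)), K.
have oU : open U by case: hP.
refine (for_near_eq oU Uu (fun w Uw => hor_normalE HK hP Uw) _).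
exact (sqrt_for (sqr_hor_normal_continuous (M := rowproj G (row_base K)) hP Uu)).
Qed.

Lemma grad_norm_continuous : {within S, continuous grad_norm}.
Proof.
apply: within_charts => U P u hP Uu; have oU : open U by case: hP.
have E w : U w -> (grad_norm \o P) w = Num.sqrt (metric G (param_grad P w) (param_grad P w)).
  by move=> Uw; rewrite /grad_norm /= (grad_TE hP Uw).
refine (for_near_eq oU Uu E _); apply: sqrt_for.
have cg := param_grad_continuous hP Uu; exact (cvg_metric (G := G) cg cg).
Qed.

Lemma hor_normal_grad_continuous : {within S, continuous hor_normal_grad}.
Proof.
apply: within_charts => U P u hP Uu; have [p [K HK]] : exists p (K : 'M[R]_(p, n)),
    horizontal G = [set v | (v <= K)%MS].
  by have [K HK] := vspace_mx (layer G 1); exists (\dim (layer G 1)), K.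
have oU : open U by case: hP.
refine (for_near_eq oU Uu (fun w Uw => hor_normal_gradE HK hP Uw) _).
apply: sqrt_for; have cg := param_grad_continuous hP Uu.
have cL := left_mx_param_continuous hP Uu.
have cr : rowproj G (left_mx P w) @[w --> u] --> rowproj G (left_mx P u).
  exact (cvg_rowproj (param_row_free hP Uu) cL).
have ca : (param_grad P w *m rowproj G (row_base K)) @[w --> u] -->
    param_grad P u *m rowproj G (row_base K).
  exact (cvg_mulmx cg (cvg_cst _)).
have cq := sqr_hor_normal_continuous (M := rowproj G (row_base K)) hP Uu.
exact (cvgB (cvgM cq (cvg_metric (G := G) ca ca)) (cvg_metric (G := G) (cvgB ca (cvg_mulmx ca cr)) ca)).
Qed.

Lemma grad_norm_ge0 x : 0 <= grad_norm x.
Proof. by rewrite /grad_norm /= sqrtr_ge0. Qed.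

Lemma hor_normal_ge0 x : 0 <= hor_normal x.
Proof. by rewrite /hor_normal /= sqrtr_ge0. Qed.

Lemma grad_norm_eq0 x : (grad_norm x == 0) = (grad_T S phi x == 0).
Proof. by rewrite /grad_norm /= sqrtr_eq0 -(metric_eq0 G) eq_le metric_ge0 andbT. Qed.

(** The projection is linear, so normalizing the gradient divides its horizontal tangential part by
    the gradient norm. *)
Lemma level_density x : S x -> hor_normal x *
    (metric_norm G (orth_proj G (hor_tangent S x) (unit_grad S phi x)))%:num =
  hor_normal_grad x / grad_norm x.
Proof.
move=> /hS[U [P [u [hP Uu ->]]]]; rewrite -mulrA; congr (_ * _).
have [K HK] := vspace_mx (layer G 1).
have E := hor_tangentE HK hP Uu.
rewrite /= /grad_H E !orth_proj_mx /unit_grad -scalemxAl metricZl metricZr mulrA -expr2.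
by rewrite sqrtrM ?sqr_ge0// sqrtr_sqr ger0_norm ?invr_ge0// mulrC.
Qed.

Lemma grad_H0 x : S x -> grad_T S phi x = 0 -> grad_H S phi x = 0.
Proof.
move=> /hS[U [P [u [hP Uu ->]]]] g0; have [K HK] := vspace_mx (layer G 1).
have E := hor_tangentE HK hP Uu.
by rewrite /grad_H E g0 orth_proj_mx mul0mx.
Qed.

Lemma grad_H_le x : S x ->
  (metric_norm G (grad_H S phi x))%:num <= grad_norm x.
Proof.
move=> /hS[U [P [u [hP Uu ->]]]]; have [K HK] := vspace_mx (layer G 1).
have E := hor_tangentE HK hP Uu.
rewrite /grad_norm /= ler_wsqrtr// /grad_H E; set g := grad_T _ _ _.
set b := orth_proj _ _ _; have bK : (b <= K :&: left_mx P u)%MS by exact: orth_proj_mx_sub.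
have gb : metric G (g - b) b = 0 by exact: orth_proj_mxP.
rewrite -[X in _ <= metric G X _](subrK b) -[X in _ <= metric G _ X](subrK b).
move: (g - b) gb => d gb.
rewrite metricDl !metricDr gb [metric G b d]Defs.metric_sym gb addr0 add0r.
by rewrite lerDr metric_ge0.
Qed.

End hypersurface_geometry.

(** * The coarea formula *)

Section adapted_parametrizations.
Context (R : realType) (m k : nat) (G : carnotGroup R m.+2 k).
Context (S : set G) (phi : G -> R).
Hypothesis hS : forall x, S x -> exists U (P : 'rV[R]_m.+1 -> G) u,
  [/\ local_param 1 S U P, U u & x = P u].
Hypothesis cphi : forall U (P : 'rV[R]_m.+1 -> G), local_param 1 S U P ->
  Cr 1 U (phi \o P : _ -> R^o).
Local Notation Gam := (metric_mx G).
Implicit Types (U : set 'rV[R]_m.+1) (P : 'rV[R]_m.+1 -> G).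

Definition adapted U P := local_param 1 S U P /\ forall u, U u -> phi (P u) = u 0 0.

Lemma diffeo_swap (j : 'I_m.+1) U : open U ->
  diffeo ((fun u : 'rV[R]_m.+1 => u *m tperm_mx 0 j) @^-1` U) U
    (mulmx^~ (tperm_mx 0 j)) (mulmx^~ (tperm_mx 0 j)).
Proof.
move=> oU; have K (u : 'rV[R]_m.+1) : u *m tperm_mx 0 j *m tperm_mx 0 j = u.
  by rewrite -mulmxA /tperm_mx -perm_mxM tperm2 perm_mx1 mulmx1.
split => //.
- by apply: open_comp oU => u _; exact: mulmxr_continuous.
- exact: Cr1_mulmxr.
- exact: Cr1_mulmxr.
- by split=> [u Uu|u Uu]; rewrite /preimage /= !K.
Qed.

(** A nonzero gradient means a nonzero partial derivative of [phi \o P0], say the [j]-th; [tperm_mx]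
    swaps it into first position, and [straighten] then makes [phi] itself the first coordinate. *)
Lemma exists_adapted x : S x -> grad_T S phi x != 0 ->
  exists U P, adapted U P /\ (P @` U) x.
Proof.
move=> Sx; have [U0 [P0 [u0 [hP0 Uu0 ->]]]] := hS Sx.
rewrite (grad_TE cphi hP0 Uu0) (param_grad_eq0 _ hP0 Uu0) => /rV0Pn[j].
rewrite mxE => dj.
have oU0 : open U0 by case: hP0.
pose T := fun u : 'rV[R]_m.+1 => u *m tperm_mx 0 j.
pose U1 := T @^-1` U0.
have dT := diffeo_swap j oU0.
have [oU1 _ _ _ [TU UT]] := dT.
have hP1 : local_param 1 S U1 (P0 \o T) := local_param_diffeo hP0 dT (@subset_refl _ U0).
have f1 := cphi hP1.
have [U1u Tu] : U1 (T u0) /\ T (T u0) = u0 by exact: UT.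
have df0 : 'd (phi \o (P0 \o T) : _ -> R^o) (T u0) (delta_mx 0 0) != 0.
  have [d1 E1] := diff_mulmxr (tperm_mx 0 j : 'M[R]_m.+1) (T u0).
  have dphi : differentiable (phi \o P0 : _ -> R^o) (T (T u0)).
    by rewrite Tu; exact: (cphi hP0).1.
  have E2 : 'd ((phi \o P0 : _ -> R^o) \o T) (T u0) =
      'd (phi \o P0 : _ -> R^o) (T (T u0)) \o 'd T (T u0) :> (_ -> _).
    exact: diff_comp d1 dphi.
  have E3 := f_equal (@^~ (delta_mx 0 0)) E2; rewrite /= in E3.
  rewrite [X in X != _](_ : _ = 'd (phi \o P0 : _ -> R^o) u0 (delta_mx 0 j))//.
  rewrite [LHS]E3 Tu; congr ('d _ _ _).
  rewrite (f_equal (@^~ (delta_mx 0 0)) E1) /= /tperm_mx.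
  rewrite -rowE; apply/rowP => i; rewrite !mxE eqxx /=.
  by rewrite tpermL eq_sym.
have [e [h [e0 eU _ dg]]] := straighten oU1 f1 U1u df0.
set g := fun u => _ in dg.
have dg' := diffeo_sym dg.
exists (g @` ball (T u0) e), ((P0 \o T) \o h); split.
  split; first exact: local_param_diffeo hP1 dg' eU.
  move=> v [u bu <-]; have [_ _ _ _ [K _]] := dg.
  by rewrite /= (K u bu).2 /g consr0.
have bu : ball (T u0) e (T u0) by exact: ballxx.
exists (g (T u0)); first by exists (T u0).
by have [_ _ _ _ [K _]] := dg; rewrite /= (K _ bu).2 Tu.
Qed.

Lemma adapted_diff_row U P u : adapted U P -> U u -> diff_row phi P u = delta_mx 0 0.
Proof.
move=> [hP aP] Uu; have oU : open U by case: hP.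
have di : differentiable (id : 'rV[R]_m.+1 -> _) u by have [] := @is_diff_id R _ u.
have [d0 _] := diff_coord 0 0 di.
have E : {near u, (fun y : 'rV[R]_m.+1 => id y 0 0 : R^o) =1 (phi \o P : _ -> R^o)}.
  by near=> y; rewrite /= aP//; near: y; exact: open_nbhs_nbhs.
have [_ E1] := diff_near_eq E d0.
apply/rowP => j; rewrite mxE.
have -> : 'd (phi \o P : _ -> R^o) u (delta_mx 0 j) =
    'd (fun y : 'rV[R]_m.+1 => id y 0 0 : R^o) u (delta_mx 0 j).
  exact (f_equal (@^~ (delta_mx 0 j)) E1).
have [_ ->] := diff_coord (delta_mx 0 j) 0 di.
have -> : 'd (id : 'rV[R]_m.+1 -> _) u (delta_mx 0 j) = delta_mx 0 j.
  by have [_ ->] := @is_diff_id R _ u.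
by rewrite !mxE !eqxx /= eq_sym.
Unshelve. all: by end_near.
Qed.

Lemma adapted_regular U P u : adapted U P -> U u -> grad_T S phi (P u) != 0.
Proof.
move=> ha Uu; have [hP _] := ha.
rewrite (grad_TE cphi hP Uu) (param_grad_eq0 _ hP Uu) (adapted_diff_row ha Uu).
by apply/eqP => /matrixP/(_ 0 0); rewrite !mxE eqxx => /eqP; rewrite oner_eq0.
Qed.

Definition slice_param P (s : R) (t : 'rV[R]_m) : G := P (consr s t).

Lemma left_diff_slice U P s t v : local_param 1 S U P -> U (consr s t) ->
  left_diff (slice_param P s) t v = left_diff P (consr s t) (consr 0 v).
Proof.
move=> [oU cP _ _ _] Uu.
have dh : differentiable (fun t : 'rV[R]_m => consr s t) t.
  by apply: (@Cr1_consr_slice R m s setT openT).1.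
have E : {near t, P \o consr s =1 slice_param P s} by near=> y.
by rewrite (left_diff_comp v oU cP Uu dh E) diff_consr_slice.
Unshelve. all: by end_near.
Qed.

Lemma left_mx_slice U P s t : local_param 1 S U P -> U (consr s t) ->
  left_mx (slice_param P s) t = row' 0 (left_mx P (consr s t)).
Proof.
move=> hP Uu; apply/row_matrixP => i.
rewrite rowE -left_diffE (left_diff_slice _ hP Uu) left_diffE row_rowsub rowE.
congr (_ *m _); apply/rowP => j; rewrite [RHS]mxE eqxx /=.
case: (unliftP 0 j) => [j' ->|->]; rewrite ?consrS ?consr0 ?mxE ?eqxx /=.
  by rewrite (inj_eq lift_inj).
by [].

Qed.

(** Every point of an adapted parametrization is regular, so freezing the first coordinate at [s]
    covers exactly the part of [regular_level] in the open set [Z]; the inverse is the tail of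
    [Q]. *)
Lemma slice_local_param U P s : adapted U P ->
  local_param 1 (regular_level S phi s) (slice1 U s) (slice_param P s).
Proof.
move=> ha; have [hP aP] := ha; have [oU cP iP [Z oZ PZ] [Q [cQ K]]] := hP.
have oV : open (slice1 U s) by exact: open_slice1.
have im : slice_param P s @` slice1 U s = regular_level S phi s `&` Z.
  apply/seteqP; split=> [_ [t Ut <-]|x [[Sx px gx] Zx]].
    have [SPt ZPt] : (S `&` Z) (P (consr s t)) by rewrite -PZ; exists (consr s t).
    by split=> //; split=> //; [rewrite aP// consr0|exact: adapted_regular ha Ut].
  have [u Uu Pu] : (P @` U) x by rewrite PZ.
  have us : u 0 0 = s by rewrite -aP// Pu.
  by exists (tl u); rewrite /slice_param /slice1 /= -us consr_tl.
split => //.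
- apply: (CrG1_comp oV _ cP) => //; exact: Cr1_consr_slice.
- move=> t Ut v v'; rewrite !(left_diff_slice _ hP Ut) => /(iP _ Ut).
  by move=> /consr_inj[].
- by exists Z.
- exists (tl \o Q); split; last first.
    by move=> t; rewrite inE => Ut; rewrite /= K ?inE// tl_consr.
  apply/subspace_continuousP => _ [t Ut <-].
  have cQt : Q y @[y --> within (P @` U) (nbhs (P (consr s t)))] --> Q (P (consr s t)).
    by apply: ((subspace_continuousP _ _).1 cQ); exists (consr s t).
  move=> B nB.
  have nB' : nbhs (Q (P (consr s t))) (tl @^-1` B).
    by apply: (@tl_continuous R m (Q (P (consr s t)))); exact: nB.
  have QB : \forall y \near P (consr s t), (P @` U) y -> B (tl (Q y)) := cQt _ nB'.
  rewrite /= nbhs_simpl /within /=.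
  apply: filterS QB => y yB [t' Ut' Pt']; apply: yB; exists (consr s t') => //.
Qed.

(* By Cramer's rule the upper left entry of the inverse Gram matrix of P is the
   Gram determinant of the slice divided by that of P. *)
Lemma slice_jacobian U P s t : adapted U P -> U (consr s t) ->
  Defs.jacobian (slice_param P s) t =
  grad_norm S phi (P (consr s t)) * Defs.jacobian P (consr s t).
Proof.
move=> ha Uu; have [hP _] := ha; rewrite !jacobianE (left_mx_slice hP Uu).
set L := left_mx P (consr s t); set M := L *m Gam *m L^T.
have uM : M \in unitmx by exact: gram_unit (param_row_free hP Uu).
have g2 : metric G (param_grad phi P (consr s t)) (param_grad phi P (consr s t)) =
    (invmx M) 0 0.
  rewrite {2}/param_grad (param_gradP _ _ hP Uu) (adapted_diff_row ha Uu).
  by rewrite -/L -/M trmx_mul trmx_delta mulmxA -rowE -colE !mxE.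
rewrite /grad_norm /= (grad_TE cphi hP Uu) -sqrtrM ?metric_ge0// g2.
congr Num.sqrt; rewrite /invmx uM !mxE /cofactor expr0 mul1r.
have d0 : \det M != 0 by rewrite -unitfE -unitmxE.
rewrite mulrC mulrA divff// mul1r; congr (\det _).
by apply/matrixP => i j; rewrite !mxE; apply: eq_bigr => l _;
  rewrite !mxE; congr (_ * _); apply: eq_bigr => l' _; rewrite !mxE.
Qed.

End adapted_parametrizations.

Section coarea_borel.
Context (R : realType) (m k : nat) (G : carnotGroup R m.+2 k).
Context (S : set G) (phi : G -> R).
Hypothesis hS : forall x, S x -> exists U (P : 'rV[R]_m.+1 -> G) u,
  [/\ local_param 1 S U P, U u & x = P u].
Hypothesis cphi : forall U (P : 'rV[R]_m.+1 -> G), local_param 1 S U P ->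
  Cr 1 U (phi \o P : _ -> R^o).
Hypothesis cS : compact S.
Local Notation hn := (hor_normal S).
Local Notation gn := (grad_norm S phi).
Local Notation hng := (hor_normal_grad S phi).

Let nm : m.+2 = m.+2 := erefl.

Let wS (x : G) : {nonneg R} := metric_norm G (orth_proj G (horizontal G) (normal S x)).
Let wL (x : G) : {nonneg R} :=
  ((metric_norm G (orth_proj G (horizontal G) (normal S x)))%:num *
   (metric_norm G (orth_proj G (hor_tangent S x) (unit_grad S phi x)))%:num)%:nng.

Let hn_cont := hor_normal_continuous nm hS.
Let gn_cont := grad_norm_continuous hS cphi.
Let hng_cont := hor_normal_grad_continuous nm hS cphi.

Lemma compact_borel : measurable (S : set (borel G)).
Proof. by apply: closed_borel; exact: compact_closed (@lie_hausdorff _ _ G) cS. Qed.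

Lemma phi_continuous : {within S, continuous phi}.
Proof.
apply: (within_charts hS) => U P u hP Uu.
exact: (@Cr1_continuous R _ R^o U (phi \o P) u (cphi hP) Uu).
Qed.

Lemma level_set_borel s : measurable (S `&` phi @^-1` [set s] : set (borel G)).
Proof.
have mphi := within_continuous_borelR compact_borel phi_continuous.
exact: (mphi compact_borel [set s] (measurable_set1 s)).
Qed.

Lemma perimeter_weight_measurable U (P : 'rV[R]_m.+1 -> G) : local_param 1 S U P ->
  measurable_fun (U : set (borel _)) (fun u : borel 'rV[R]_m.+1 => (wS (P u))%:num).
Proof. exact: within_param_measurable hn_cont (@subset_refl _ S). Qed.

Lemma level_weight_measurable s U (P : 'rV[R]_m -> G) :
  local_param 1 (regular_level S phi s) U P ->
  measurable_fun (U : set (borel _)) (fun u : borel 'rV[R]_m => (wL (P u))%:num).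
Proof.
move=> hP; have [oU cP _ [Z oZ PZ] _] := hP.
have NS : regular_level S phi s `<=` S by move=> x [].
have NP u : U u -> (regular_level S phi s) (P u).
  by move=> Uu; have [] : (regular_level S phi s `&` Z) (P u) by rewrite -PZ; exists u.
apply: within_continuous_borelR; first exact: open_borel.
apply: within_continuous => u Uu.
have c1 := within_param_continuous hng_cont NS hP Uu.
have c2 := within_param_continuous gn_cont NS hP Uu.
have g0 : gn (P u) != 0 by rewrite grad_norm_eq0; have [] := NP u Uu.
have E w : U w -> (wL (P w))%:num = hng (P w) / gn (P w).
  by move=> /NP[Sx _ _]; rewrite -(level_density phi hS Sx).
refine (for_near_eq oU Uu E _).
exact (cvgM c1 (cvgV g0 c2)).
Qed.

Let D0 := S `&` [set x | hn x != 0].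

(* This is |grad_H phi| off the characteristic set [hn = 0], which is null for the
   perimeter measure; on that set [grad_ratio] is 0. *)
Definition grad_ratio : G -> R := (fun x => hng x / hn x) \_ D0.

Lemma char_borel : measurable (S `&` [set x | hn x = 0] : set (borel G)).
Proof.
have mh := within_continuous_borelR compact_borel hn_cont.
exact: (mh compact_borel [set 0] (measurable_set1 _)).
Qed.

Let mD0 : measurable (D0 : set (borel G)).
Proof.
have -> : D0 = S `\` (S `&` [set x | hn x = 0]).
  apply/seteqP; split => x [Sx h]; split => //; first by case=> _ /eqP; exact/negP.
  by apply/eqP => h0; apply: h.
by apply: measurableD; [exact: compact_borel|exact: char_borel].
Qed.

Lemma grad_ratio_measurable : measurable_fun setT (grad_ratio : borel G -> R).
Proof.
apply/(measurable_restrictT _ _).1; first exact: mD0.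
apply: (@within_continuous_borelR G R D0 _ mD0).
apply/subspace_continuousP => x [Sx h0].
have sub (F : G -> R) : {within S, continuous F} -> F y @[y --> within D0 (nbhs x)] --> F x.
  move=> /subspace_continuousP cF B nB; have FB := cF x Sx B nB.
  have {}FB : \forall y \near x, S y -> B (F y) by exact: FB.
  by rewrite /= nbhs_simpl /within /=; apply: filterS FB => y yB [Sy _]; exact: yB.
exact (cvgM (sub _ hng_cont) (cvgV h0 (sub _ hn_cont))).
Qed.

Lemma hng_ge0 x : 0 <= hng x.
Proof. by rewrite /hor_normal_grad mulr_ge0// hor_normal_ge0. Qed.

Lemma grad_ratio_ge0 x : 0 <= grad_ratio x.
Proof.
rewrite /grad_ratio /patch; case: ifP => // _.
by rewrite divr_ge0// ?hng_ge0// hor_normal_ge0.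
Qed.

Lemma grad_ratioE x : S x -> hn x != 0 ->
  grad_ratio x = (metric_norm G (grad_H S phi x))%:num.
Proof.
move=> Sx h0; rewrite /grad_ratio /patch mem_set//.
by rewrite /hor_normal_grad mulrAC divff// mul1r.
Qed.

(** Against the perimeter density the truncated quotient loses nothing: [hng x] vanishes wherever
    [hn x] does. *)
Lemma grad_ratio_mul x : S x -> grad_ratio x * hn x = hng x.
Proof.
move=> Sx; have [h0|h0] := eqVneq (hn x) 0.
  by rewrite h0 mulr0 /hor_normal_grad h0 mul0r.
by rewrite grad_ratioE// mulrC.
Qed.

Lemma adapted_cover : exists (O : nat -> set G) (U : nat -> set 'rV[R]_m.+1)
    (P : nat -> 'rV[R]_m.+1 -> G),
  [/\ forall i, open (O i), forall i, adapted S phi (U i) (P i),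
      forall i, P i @` U i = S `&` O i &
      forall x, S x -> ~ (\bigcup_i O i) x -> grad_T S phi x = 0].
Proof.
pose Pr (O : set G) := exists UP : set 'rV[R]_m.+1 * ('rV[R]_m.+1 -> G),
  adapted S phi UP.1 UP.2 /\ UP.2 @` UP.1 = S `&` O.
have Pr0 : Pr set0.
  exists (set0, fun=> point); split; last by rewrite image_set0 setI0.
  by split => //; exact: param0.
have [|O [oO PrO cO]] := @second_countable_cover G
    [set x | S x /\ grad_T S phi x != 0] Pr (@lie_second_countable _ _ G) Pr0.
  move=> x [Sx gx]; have [U [P [aP Px]]] := exists_adapted hS cphi Sx gx.
  have [[_ _ _ [Z oZ PZ] _] _] := aP.
  exists Z; split => //; last by exists (U, P).
  by have [] : (S `&` Z) x by rewrite -PZ.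
have [UP UPP] := choice PrO.
exists O, (fun i => (UP i).1), (fun i => (UP i).2); split => //.
- by move=> i; have [] := UPP i.
- by move=> i; have [] := UPP i.
- move=> x Sx nO; apply: contrapT => /eqP g0; apply: nO.
  by apply: cO.
Qed.

(** The factor [gn] of [slice_jacobian] cancels the denominator of [level_density]. What remains is
    the density in the hypersurface coordinates: the pointwise form of the coarea formula. *)
Lemma adapted_density U (P : 'rV[R]_m.+1 -> G) s t : adapted S phi U P ->
  U (consr s t) ->
  density wL (slice_param P s) t = hng (P (consr s t)) * Defs.jacobian P (consr s t).
Proof.
move=> ha Uu; rewrite /density (slice_jacobian cphi ha Uu).
have [[_ _ _ [Z oZ PZ] _] _] := ha.
have SP : S (P (consr s t)).
  by have [] : (S `&` Z) (P (consr s t)) by rewrite -PZ; exists (consr s t).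
have g0 : gn (P (consr s t)) != 0.
  by rewrite grad_norm_eq0; exact (adapted_regular cphi ha Uu).
have -> : (wL (slice_param P s t))%:num = hng (P (consr s t)) / gn (P (consr s t)).
  by rewrite -(level_density phi hS SP).
by rewrite mulrA divfK.
Qed.

Local Open Scope ereal_scope.

Let D s := S `&` phi @^-1` [set s].

(** Both sides become the sum over [i] of the integrals of [F i] on [A i], the level side through
    Tonelli. Measurability in [s] is part of the conclusion for the later null set and subtraction
    arguments. *)
Lemma coarea_borel (f : G -> \bar R) :
  measurable_fun setT (f : borel G -> \bar R) -> (forall x, 0 <= f x) ->
  measurable_fun setT (fun s : measurableTypeR R =>
    \int[level_measure S phi s]_(y in S `&` phi @^-1` [set s]) f y) /\
  \int[perimeter_measure S]_(x in S) (f x * (grad_ratio x)%:E) =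
  \int[@lebesgue_measure R]_s
    \int[level_measure S phi s]_(y in S `&` phi @^-1` [set s]) f y.
Proof.
move=> mf f0; have [Ob [U [P [oO aP PO cO]]]] := adapted_cover.
have mO i : measurable (Ob i : set (borel G)) by exact: open_borel.
have hP i : local_param 1 S (U i) (P i) := (aP i).1.
have oU i : open (U i) by case: (hP i).
have mUO : measurable (\bigcup_i Ob i : set (borel G)).
  by apply: bigcupT_measurable => i; exact: mO.
have mseq i : measurable (S `&` seqDU Ob i : set (borel G)).
  apply: measurableI; first exact: compact_borel.
  by apply: measurableD => //; exact: bigsetU_measurable.
pose A i := U i `&` P i @^-1` (S `&` seqDU Ob i).
have mA i : measurable (A i : set (borel _)) := param_preim_measurable (hP i) (mseq i).
have AU i : A i `<=` U i by move=> u [].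
pose F i u := f (P i u) * (hng (P i u) * Defs.jacobian (P i) u)%:E.
have F0 i u : 0 <= F i u.
  by rewrite mule_ge0// lee_fin mulr_ge0// ?hng_ge0// jacobian_ge0.
have mF i : measurable_fun (A i : set (borel _)) (F i : borel _ -> _).
  have mU := open_borel (oU i).
  apply: (measurable_funS mU (AU i)).
  have [_ cP _ _ _] := hP i.
  apply: emeasurable_funM.
    have mP : measurable_fun (U i : set (borel _)) (P i : borel _ -> borel G).
      apply: within_continuous_borel => //; apply: within_continuous => u Uu.
      exact (cP.1 u Uu).
    exact: (measurableT_comp mf mP).
  apply/measurable_EFinP; apply: measurable_funM.
    exact: within_param_measurable hng_cont (@subset_refl _ S) (hP i).
  apply: within_continuous_borelR => //; apply: within_continuous => u Uu.
  exact (jacobian_continuous (oU i) cP Uu).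
have mFA i : measurable_fun setT (((F i) \_ (A i)) : borel _ -> _).
  by apply/(measurable_restrictT _ _).1; [exact: mA|exact: mF].
have FA0 i u : 0 <= ((F i) \_ (A i)) u by rewrite /patch; case: ifP.
pose J i s := \int[leb R m]_(t in slice1 (A i) s) F i (consr s t).
have JE i s : J i s = \int[leb R m]_t ((F i) \_ (A i)) (consr s t).
  by rewrite /J integral_mkcond -patch_slice1.
have J0 i s : 0 <= J i s by apply: integral_ge0.
have mJ i : measurable_fun setT (fun s : measurableTypeR R => J i s).
  have -> : (fun s : measurableTypeR R => J i s) =
      (fun s : measurableTypeR R => \int[leb R m]_t ((F i) \_ (A i)) (consr s t)).
    by apply/funext => s; exact: JE.
  exact: measurable_leb_slice.
have level s : \int[level_measure S phi s]_(y in D s) f y = \sum_(i <oo) J i s.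
  have mw := @level_weight_measurable s.
  have mD : measurable (D s : set (borel G)) := level_set_borel s.
  have hPs i := slice_local_param cphi s (aP i).
  have NO i : regular_level S phi s `&` Ob i `<=` slice_param (P i) s @` slice1 (U i) s.
    move=> x [[Sx px gx] Ox].
    have [u Uu Pu] : (P i @` U i) x by rewrite PO.
    have us : u ord0 ord0 = s by rewrite -(aP i).2// Pu.
    by exists (tl u); rewrite /slice_param /slice1 /= -us consr_tl.
  (* Points of the level set outside all the [Ob i] have zero gradient, hence miss [regular_level],
     which carries the measure. *)
  transitivity (\int[area m (regular_level S phi s) wL]_(y in D s) (f \_ (\bigcup_i Ob i)) y).
    have mDO : measurable (D s `\` \bigcup_i Ob i : set (borel G)) by exact: measurableD.
    refine (@integral_off_null _ _ R (area m (regular_level S phi s) wL) (D s)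
      (D s `\` \bigcup_i Ob i) _ _ (borel_caratheodory mw mDO) _ _).
      apply: (area_disjoint mw mDO); apply/seteqP; split => // x [[Sx px gx] [_ nO]].
      by apply/negP: gx; apply/negPn/eqP; exact: cO.
    move=> x Dx nDO; rewrite /patch mem_set//; apply: contrapT => nO.
    by apply: nDO; split.
  rewrite -integral_mkcondr (integral_area_bigcup mw mO hPs NO mD mf f0).
  apply: eq_eseriesr => i _; rewrite /J.
  have -> : slice1 (U i) s `&` slice_param (P i) s @^-1` (D s `&` seqDU Ob i) = slice1 (A i) s.
    apply/seteqP; split=> t; first by move=> [Ut [[St pt] Ot]].
    move=> [Ut [St Ot]]; split=> //; split=> //; split => //.
    by rewrite /preimage/= /slice_param (aP i).2// consr0.
  apply: eq_integral => t; rewrite inE => -[Ut _].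
  by rewrite (adapted_density (aP i) Ut).
have levelE : (fun s : measurableTypeR R => \int[level_measure S phi s]_(y in D s) f y) =
    (fun s => \sum_(i <oo) J i s) by apply/funext => s; exact: level.
split.
  rewrite levelE; exact: (@ge0_emeasurable_sum _ (measurableTypeR R) R setT (fun i s => J i s) xpredT
    (fun i s _ _ => J0 i s) (fun i _ => mJ i)).
rewrite [RHS](_ : _ = \int[@lebesgue_measure R]_s \sum_(i <oo) J i s); last first.
  by apply: eq_integral => s _; exact: level.
rewrite integral_nneseries//.
have mw := @perimeter_weight_measurable.
have mr : measurable_fun setT (fun x : borel G => f x * (grad_ratio x)%:E).
  by apply: emeasurable_funM => //; apply/measurable_EFinP; exact: grad_ratio_measurable.
have r0 x : 0 <= f x * (grad_ratio x)%:E by rewrite mule_ge0// lee_fin grad_ratio_ge0.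
(* On the perimeter side such points may have positive measure, but there [grad_H], and with it
   [grad_ratio], is zero. *)
transitivity (\int[area m.+1 S wS]_(x in S)
    ((fun x => f x * (grad_ratio x)%:E) \_ (\bigcup_i Ob i)) x).
  apply: eq_integral => x; rewrite inE => Sx; rewrite /patch; case: ifPn => // /negP nO.
  have g0 : grad_T S phi x = 0%R.
    by apply: cO => // Ox; apply: nO; rewrite inE.
  rewrite (_ : grad_ratio x = 0%R) ?mule0//.
  rewrite /grad_ratio /patch; case: ifP => // _.
  rewrite /hor_normal_grad (grad_H0 hS Sx g0) /= metric0l sqrtr0 mulr0 mul0r//.
rewrite -integral_mkcondr.
have NO i : S `&` Ob i `<=` P i @` U i by rewrite PO.
rewrite (integral_area_bigcup mw mO hP NO compact_borel mr r0).
apply: eq_eseriesr => i _; rewrite -[LHS]/(\int[leb R m.+1]_(u in A i) _).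
transitivity (\int[leb R m.+1]_(u in A i) F i u).
  apply: eq_integral.
  move=> u; rewrite inE => -[Uu [Su _]].
  rewrite /F /density -muleA -EFinM; congr (_ * _%:E).
  by rewrite mulrA -[(wS _)%:num%R]/(hn (P i u)) grad_ratio_mul.
by rewrite integral_slice1.
Qed.

End coarea_borel.

(** * From Borel functions to integrable functions *)

Section borel_version.
Local Open Scope ereal_scope.
Context (R : realType) (n k : nat) (G : carnotGroup R n k) (m : nat).
Context (N : set G) (w : G -> {nonneg R}).
Hypothesis mw : forall U (P : 'rV[R]_m -> G), local_param 1 N U P ->
  measurable_fun (U : set (borel _)) (fun u : borel 'rV[R]_m => (w (P u))%:num%R).
Context (S : set G).
Hypothesis mS : measurable (S : set (borel G)).

Let T := caratheodory_type (area_outer m N w).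
Let mST : measurable (S : set T) := borel_caratheodory mw mS.

(** An enumeration of the rationals, with the value 0 at the numbers that code none. *)
Let q (i : nat) : R := ratr (odflt (0%R : rat) (unpickle i)).

(* The sets [q < r] with [q] a positive rational have finite area, so each of them
   is Borel up to a null set. *)
Lemma borel_version (r : G -> R) :
  measurable_fun (S : set T) (r : T -> R) -> (forall x, 0 <= r x)%R ->
  \int[area m N w]_(x in S) (r x)%:E < +oo ->
  exists Z : set G, [/\ measurable (Z : set (borel G)), area_ext m N w Z = 0 &
    measurable_fun setT (r \_ (S `\` Z) : borel G -> R)].
Proof.
move=> mr r0 rfin.
pose E i : set G := if (0 < q i)%R then S `&` [set x | q i < r x]%R else set0.
have mE i : measurable (E i : set T).
  rewrite /E; case: ifP => // _.
  have := mr mST _ (measurable_itv `]q i, +oo[).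
  by congr (measurable _); apply/seteqP; split => x /=; rewrite in_itv/= andbT.
have ES i : E i `<=` S by rewrite /E; case: ifP => // _ x [].
have Efin i : area_ext m N w (E i) < +oo.
  have [qi|qi] := boolP (0 < q i)%R; last first.
    by rewrite /E (negbTE qi) (outer_measure0 (area_outer m N w)).
  (* Chebyshev's inequality, for which [q i] has to be positive. *)
  have : (q i)%:E * area m N w (E i : set T) < +oo.
    rewrite -integral_cst//.
    apply: (@le_lt_trans _ _ (\int[area m N w]_(x in E i) (r x)%:E)).
      apply: ge0_le_integral => //.
      - by move=> x _; rewrite lee_fin ltW.
      - by apply/measurable_EFinP; apply: (measurable_funS mST (ES i)).
      - by move=> x; rewrite /E qi => -[_ /=]; rewrite lee_fin => /ltW.
    apply: le_lt_trans rfin; apply: ge0_subset_integral => //.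
      exact/measurable_EFinP.
    by move=> x _; rewrite lee_fin r0.
  have lty_cancel (y : \bar R) : (q i)%:E * y < +oo -> y < +oo.
    by case: y => [y _||//]; [exact: ltry|rewrite gt0_muley ?ltxx ?lte_fin].
  exact: lty_cancel.
have [Z ZP] := choice (fun i => area_null (mE i) (Efin i)).
have mZ : measurable (\bigcup_i Z i : set (borel G)).
  by apply: bigcupT_measurable => i; have [] := ZP i.
exists (\bigcup_i Z i); split => //.
  apply/eqP; rewrite eq_le (outer_measure_ge0 (area_outer m N w)) andbT.
  apply: (le_trans (outer_measure_sigma_subadditive (area_outer m N w) Z)).
  by rewrite eseries0// => i _ _; have [_ Zi _] := ZP i; exact: Zi.
have mEZ i : measurable (E i `\` \bigcup_i Z i : set (borel G)).
  have -> : E i `\` \bigcup_i Z i = (E i `\` Z i) `\` \bigcup_i Z i.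
    apply/seteqP; split=> x; last by move=> [[]].
    by move=> [Ex nZ]; split => //; split => // Zx; apply: nZ; exists i.
  by apply: measurableD => //; have [] := ZP i.
apply: (@measurability _ _ (borel G) R setT (r \_ (S `\` \bigcup_i Z i)) _
  (measurable_realfun.RGenOInfty.measurableE R)) => //.
move=> _ [_ [a ->] <-]; rewrite setTI.
(* For negative [a] the preimage is everything, the function being nonnegative. Otherwise the points
   where it was set to 0 do not count, and the preimage is the union of the reduced [E i] with
   [a < q i]. *)
have [a0|a0] := ltP a 0%R.
  rewrite (_ : _ @^-1` _ = setT)//; apply/seteqP; split=> // x _ /=.
  rewrite in_itv/= andbT (lt_le_trans a0)// /patch; case: ifP => // _; exact: r0.
rewrite (_ : _ @^-1` _ =
  \bigcup_i (if (a < q i)%R then E i `\` \bigcup_i Z i else set0)).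
  by apply: bigcupT_measurable => i; case: ifP.
apply/seteqP; split=> x /=.
  rewrite in_itv/= andbT /patch; case: ifPn; last by rewrite ltNge a0.
  rewrite inE => -[Sx nZ] /rat_in_itvoo[p]; rewrite in_itv/= => /andP[ap pr].
  have qp : q (pickle p) = ratr p by rewrite /q pickleK.
  exists (pickle p) => //; rewrite qp ap; split=> //.
  by rewrite /E qp (le_lt_trans a0 ap).
move=> [i _]; case: ifP => // aq [Ex nZ].
have Sx := ES i x Ex.
rewrite in_itv/= andbT /patch mem_set//.
by move: Ex; rewrite /E (le_lt_trans a0 aq) => -[_ /=]; exact: lt_trans.
Qed.

Lemma borel_measurable_fun (f : G -> R) :
  measurable_fun setT (f : borel G -> R) -> measurable_fun (S : set T) (f : T -> R).
Proof.
move=> mf _ B mB; apply: measurableI => //.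
have := mf measurableT B mB; rewrite setTI => mfB.
exact (borel_caratheodory mw mfB).
Qed.

End borel_version.

Section characteristic_set.
Local Open Scope ereal_scope.
Context (R : realType) (m k : nat) (G : carnotGroup R m.+2 k).
Context (S : set G).
Hypothesis hS : forall x, S x -> exists U (P : 'rV[R]_m.+1 -> G) u,
  [/\ local_param 1 S U P, U u & x = P u].
Hypothesis cS : compact S.

(** The perimeter density [hor_normal] vanishes on this set, so each parametrized piece of it
    contributes the integral of zero. *)
Lemma char_null : area_ext m.+1 S
  (fun x => metric_norm G (orth_proj G (horizontal G) (normal S x)))
  (S `&` [set x | hor_normal S x = 0%R]) = 0.
Proof.
set wS := fun x => _; set B := S `&` _.
have mw := perimeter_weight_measurable hS.
have mB : measurable (B : set (borel G)) := char_borel hS cS.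
have mBT : measurable (B : set (caratheodory_type (area_outer m.+1 S wS))) :=
  borel_caratheodory mw mB.
pose Pr (O : set G) := exists UP : set 'rV[R]_m.+1 * ('rV[R]_m.+1 -> G),
  local_param 1 S UP.1 UP.2 /\ UP.2 @` UP.1 = S `&` O.
have Pr0 : Pr set0.
  exists (set0, fun=> point); split; last by rewrite image_set0 setI0.
  exact: param0.
have [|O [oO PrO cO]] := @second_countable_cover G S Pr (@lie_second_countable _ _ G) Pr0.
  move=> x Sx; have [U [P [u [hP Uu xE]]]] := hS Sx.
  have [_ _ _ [Z oZ PZ] _] := hP.
  exists Z; split => //; last by exists (U, P).
  by have [] : (S `&` Z) x by rewrite -PZ xE; exists u.
have [UP UPP] := choice PrO.
have mO i : measurable (O i : set (borel G)) by exact: open_borel.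
have hP i : local_param 1 S (UP i).1 (UP i).2 := (UPP i).1.
have NO i : S `&` O i `<=` (UP i).2 @` (UP i).1 by rewrite (UPP i).2.
have := @integral_area_bigcup R m.+2 k G m.+1 S wS mw O _ _ B (cst 1) mO hP NO mB
  (measurable_cst _) (fun=> lee01).
rewrite (setIidl (subset_trans (@subIsetl _ S _) cO)).
rewrite integral_cst// mul1e => E.
rewrite -[LHS]/(area m.+1 S wS (B : set (caratheodory_type (area_outer m.+1 S wS)))) E.
apply: eseries0 => i _ _; apply: integral0_eq => u [_ [[_ h0] _]].
by rewrite /density -[(wS _)%:num%R]/(hor_normal S _) h0 mul0r mule0.
Qed.

End characteristic_set.

Section coarea.
Local Open Scope ereal_scope.
Context (R : realType) (m k : nat) (G : carnotGroup R m.+2 k).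
Context (S : set G) (phi : G -> R).
Hypothesis hS : forall x, S x -> exists U (P : 'rV[R]_m.+1 -> G) u,
  [/\ local_param 1 S U P, U u & x = P u].
Hypothesis cphi : forall U (P : 'rV[R]_m.+1 -> G), local_param 1 S U P ->
  Cr 1 U (phi \o P : _ -> R^o).
Hypothesis cS : compact S.

Let wS (x : G) : {nonneg R} := metric_norm G (orth_proj G (horizontal G) (normal S x)).
Let wL (x : G) : {nonneg R} :=
  (((metric_norm G (orth_proj G (horizontal G) (normal S x)))%:num *
   (metric_norm G (orth_proj G (hor_tangent S x) (unit_grad S phi x)))%:num)%:nng)%R.
Let sigma : {measure set (caratheodory_type (area_outer m.+1 S wS)) -> \bar R} :=
  area m.+1 S wS.
Let T := caratheodory_type (area_outer m.+1 S wS).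
Let mw := perimeter_weight_measurable hS.
Let mS : measurable (S : set (borel G)) := compact_borel cS.
Let mST : measurable (S : set T) := borel_caratheodory mw mS.
Let h := grad_ratio S phi.
Let D s := S `&` phi @^-1` [set s].

(** An orthogonal projection shortens vectors, and the full gradient norm is continuous on the
    compact [S]. The bound passes integrability from [psi] to the level integrals of its parts. *)
Lemma grad_ratio_bounded : exists C : R, forall x, S x -> (h x <= C)%R.
Proof.
have c := continuous_compact (grad_norm_continuous hS cphi) cS.
have [M [_ HM]] := @compact_bounded R R^o _ c.
exists (M + 1)%R => x Sx.
apply: (@le_trans _ _ (grad_norm S phi x)); last first.
  apply: (le_trans (ler_norm _)); apply: (HM (M + 1)%R); first by rewrite ltrDl.
  by exists x.
have [h0|h0] := eqVneq (hor_normal S x) 0%R.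
  rewrite /h /grad_ratio /patch; case: ifP => [|_]; last exact: grad_norm_ge0.
  by rewrite inE => -[_ /=]; rewrite h0 eqxx.
have E := grad_ratioE phi Sx h0.
by rewrite /h E; exact: (grad_H_le phi hS Sx).
Qed.

Let a (f : G -> R) (s : R) := \int[level_measure S phi s]_(y in D s) (f y)%:E.

Let level_null (Z : set G) : measurable (Z : set (borel G)) -> sigma (Z : set T) = 0 ->
  exists N0 : set R, [/\ measurable (N0 : set (measurableTypeR R)),
    lebesgue_measure N0 = 0 &
    forall s, ~ N0 s -> level_measure S phi s (Z `&` D s) = 0].
Proof.
move=> mZ Z0.
have m1 : measurable_fun setT (fun x : borel G => (\1_Z x)%:E : \bar R).
  by apply/measurable_EFinP; exact: measurable_indic.
have i0 (x : G) : 0 <= (\1_Z x)%:E :> \bar R by rewrite lee_fin.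
have [mb E] := coarea_borel hS cphi cS m1 i0.
set b := fun s : measurableTypeR R => _ in mb.
have b0 s : 0 <= b s by apply: integral_ge0 => x _.
have mZT : measurable (Z : set T) := borel_caratheodory mw mZ.
have intb : \int[@lebesgue_measure R]_s b s = 0.
  rewrite /b -E -[RHS](integral0 sigma S).
  apply: (@integral_off_null _ T R sigma S Z _ _ mZT Z0) => x _ Zx.
  by rewrite indicE memNset// mul0e.
(* The exceptional set is exactly where the level area of [Z] is nonzero; measurability of [b] makes
   it measurable and not merely contained in a null set. *)
have mN0 : measurable ([set: R] `&` [set s | b s != 0] : set (measurableTypeR R)).
  exact: (emeasurable_neq measurableT mb).
exists ([set: R] `&` [set s | b s != 0]); split => //.
  have : \int[@lebesgue_measure R]_(s in setT) `|b s| = 0.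
    by rewrite -[RHS]intb; apply: eq_integral => s _; rewrite gee0_abs.
  move=> /(ae_eq_integral_abs _ measurableT mb)[N [mN N0 bN]].
  apply/eqP; rewrite eq_le measure_ge0 andbT -[X in _ <= X]N0.
  apply: le_measure; rewrite ?inE//.
  move=> s [_ /eqP bs]; apply: bN => /= bs0; apply: bs; exact: bs0.
move=> s nb; have bs0 : b s = 0.
  by apply/eqP; apply: contrapT => /negP bs; apply: nb; split.
rewrite -[RHS]bs0 /b integral_indic//.
- exact (borel_caratheodory (@level_weight_measurable R m k G S phi hS cphi s) (level_set_borel hS cphi cS s)).
- exact (borel_caratheodory (@level_weight_measurable R m k G S phi hS cphi s) mZ).
Qed.

Let null_setU (A B : set G) : measurable (A : set (borel G)) ->
  measurable (B : set (borel G)) -> sigma (A : set T) = 0 -> sigma (B : set T) = 0 ->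
  sigma (A `|` B : set T) = 0.
Proof.
move=> mA mB A0 B0.
exact (etrans (@measureU0 _ T R sigma A B (borel_caratheodory mw mA)
  (borel_caratheodory mw mB) B0) A0).
Qed.

Theorem coarea (psi : G -> R) : sigma.-integrable S (EFin \o psi) ->
  \int[perimeter_measure S]_(x in S) (psi x * (metric_norm G (grad_H S phi x))%:num)%:E =
  \int[@lebesgue_measure R]_s \int[level_measure S phi s]_(y in D s) (psi y)%:E.
Proof.
move=> /integrableP[/measurable_EFinP mpsi psifin].
(* [borel_version] is for nonnegative functions, so the positive parts of [psi] and [- psi] are
   treated separately, each with its own null set. *)
pose pos (r : G -> R) (x : G) : R := Num.max (r x) 0%R.
have pos0 r x : (0 <= pos r x)%R by rewrite /pos le_max lexx orbT.
have pos_le r x : (pos r x <= `|r x|)%R by rewrite /pos ge_max ler_norm normr_ge0.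
pose npsi x := (- psi x)%R.
have mnpsi : measurable_fun (S : set T) (npsi : T -> R) by exact: measurableT_comp.
have mpos r : measurable_fun (S : set T) (r : T -> R) ->
    measurable_fun (S : set T) (pos r : T -> R).
  by move=> mr; apply: measurable_maxr.
have fin (r : G -> R) : measurable_fun (S : set T) (r : T -> R) ->
    (forall x, (0 <= r x)%R) -> (forall x, (r x <= `|psi x|)%R) ->
    \int[sigma]_(x in S) (r x)%:E < +oo.
  move=> mr r0 rpsi; apply: le_lt_trans psifin; apply: ge0_le_integral.
  - exact mST.
  - by move=> x _; rewrite lee_fin.
  - exact/measurable_EFinP.
  - by apply/measurable_EFinP; exact: measurableT_comp.
  - by move=> x _; rewrite lee_fin.
have posn_le x : (pos npsi x <= `|psi x|)%R.
  by rewrite -[X in (_ <= X)%R]normrN; exact: pos_le.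
have [Z1 [mZ1 Z10 mr1]] := borel_version mw mS (mpos _ mpsi) (pos0 psi)
  (fin _ (mpos _ mpsi) (pos0 psi) (pos_le psi)).
have [Z2 [mZ2 Z20 mr2]] := borel_version mw mS (mpos _ mnpsi) (pos0 npsi)
  (fin _ (mpos _ mnpsi) (pos0 npsi) posn_le).
pose Z := Z1 `|` Z2.
have mZ : measurable (Z : set (borel G)) by exact: measurableU.
have mZT (Y : set G) : measurable (Y : set (borel G)) -> measurable (Y : set T).
  by move=> mY; exact (borel_caratheodory mw mY).
have Z0 : sigma (Z : set T) = 0.
  exact (null_setU mZ1 mZ2 Z10 Z20).
(* [psi] with the value 0 off [S] and on [Z]; its positive and negative parts are Borel on the whole
   group. *)
pose r : G -> R := psi \_ (S `\` Z).
have rE x : S x -> ~ Z x -> r x = psi x.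
  by move=> Sx Zx; rewrite /r /patch mem_set.
have r0E x : ~ (S x /\ ~ Z x) -> r x = 0%R.
  by move=> nx; rewrite /r /patch memNset.
have mpr : measurable_fun setT (pos r : borel G -> R).
  have -> : pos r = (pos psi \_ (S `\` Z1)) \_ (~` Z2).
    apply/funext => x; rewrite /patch.
    case: (pselect (S x /\ ~ Z x)) => [[Sx Zx]|nx].
      have z1 : ~ Z1 x by move=> ?; apply: Zx; left.
      have z2 : ~ Z2 x by move=> ?; apply: Zx; right.
      by rewrite mem_set// mem_set// /pos rE.
    rewrite /pos r0E// maxxx; case: ifPn => // /set_mem z2.
    case: ifPn => // /set_mem[Sx z1]; exfalso; apply: nx; split => //.
    by case.
  by apply/(measurable_restrictT _ _).1; [exact: measurableC|exact: measurable_funTS].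
have mnr : measurable_fun setT (pos (fun x => - r x)%R : borel G -> R).
  have -> : pos (fun x => - r x)%R = (pos npsi \_ (S `\` Z2)) \_ (~` Z1).
    apply/funext => x; rewrite /patch.
    case: (pselect (S x /\ ~ Z x)) => [[Sx Zx]|nx].
      have z1 : ~ Z1 x by move=> ?; apply: Zx; left.
      have z2 : ~ Z2 x by move=> ?; apply: Zx; right.
      by rewrite mem_set// mem_set// /pos rE.
    rewrite /pos r0E// oppr0 maxxx; case: ifPn => // /set_mem z1.
    case: ifPn => // /set_mem[Sx z2]; exfalso; apply: nx; split => //.
    by case.
  by apply/(measurable_restrictT _ _).1; [exact: measurableC|exact: measurable_funTS].
have h0 x : (0 <= h x)%R by exact: grad_ratio_ge0.
have mh : measurable_fun setT (h : borel G -> R) by exact: grad_ratio_measurable.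
(* Off the null sets [Z] and the characteristic set, both integrands are Borel. *)
have LHSE : \int[perimeter_measure S]_(x in S)
      (psi x * (metric_norm G (grad_H S phi x))%:num)%:E =
    \int[sigma]_(x in S) (r x * h x)%:E.
  pose ch := S `&` [set x | hor_normal S x = 0%R].
  have mch : measurable (ch : set (borel G)) := char_borel hS cS.
  have mZch : measurable (Z `|` ch : set T) by apply: mZT; exact: measurableU.
  apply: (@integral_off_null _ T R sigma S (Z `|` ch) _ _ mZch).
    exact (null_setU mZ mch Z0 (char_null hS cS)).
  move=> x Sx nx; have Zx : ~ Z x by move=> ?; apply: nx; left.
  have x0 : hor_normal S x != 0%R by apply/eqP => ?; apply: nx; right.
  by rewrite rE// /h (grad_ratioE phi Sx x0).
rewrite {}LHSE integralE.
pose f1 x : \bar R := (pos r x)%:E; pose f2 x : \bar R := (pos (fun x => - r x)%R x)%:E.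
have f10 x : 0 <= f1 x by rewrite lee_fin.
have f20 x : 0 <= f2 x by rewrite lee_fin.
have mf1 : measurable_fun setT (f1 : borel G -> \bar R) by exact/measurable_EFinP.
have mf2 : measurable_fun setT (f2 : borel G -> \bar R) by exact/measurable_EFinP.
have [ma1 E1] := coarea_borel hS cphi cS mf1 f10.
have [ma2 E2] := coarea_borel hS cphi cS mf2 f20.
have -> : \int[sigma]_(x in S) (fun x => (r x * h x)%:E)^\+ x =
    \int[@lebesgue_measure R]_s a (pos r) s.
  rewrite -E1; apply: eq_integral => x _.
  by rewrite funeposE -EFin_max -EFinM /pos maxr_pMl// mul0r.
have -> : \int[sigma]_(x in S) (fun x => (r x * h x)%:E)^\- x =
    \int[@lebesgue_measure R]_s a (pos (fun x => - r x)%R) s.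
  rewrite -E2; apply: eq_integral => x _.
  by rewrite funenegE -EFinN -EFin_max -EFinM /pos maxr_pMl// mul0r mulNr.
(* Both level integrals must be integrable in [s] before their difference can be taken under the
   outer integral; the bound on [h] provides this. *)
have [C hC] := grad_ratio_bounded.
have ifin (f : G -> R) : measurable_fun setT (f : borel G -> R) ->
    (forall x, (0 <= f x)%R) -> (forall x, S x -> (f x <= `|psi x|)%R) ->
    measurable_fun setT (fun s : measurableTypeR R => a f s) ->
    \int[sigma]_(x in S) ((f x)%:E * (h x)%:E) = \int[@lebesgue_measure R]_s a f s ->
    (@lebesgue_measure R).-integrable setT (a f).
  move=> mf f0 fpsi maf E; apply/integrableP; split; first exact: maf.
  have -> : \int[@lebesgue_measure R]_s `|a f s| = \int[@lebesgue_measure R]_s a f s.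
    apply: eq_integral => s _; rewrite gee0_abs//.
    by apply: integral_ge0 => x _; rewrite lee_fin.
  rewrite -E; have C0 : (0 <= Num.max C 0%R)%R by rewrite le_max lexx orbT.
  apply: (@le_lt_trans _ _ (\int[sigma]_(x in S) ((Num.max C 0%R)%:E * `|(psi x)%:E|))).
    apply: ge0_le_integral.
    - exact mST.
    - by move=> x _; rewrite mule_ge0// lee_fin.
    - apply/measurable_EFinP; apply: (borel_measurable_fun mw mS).
      exact: measurable_funM.
    - apply: measurable_funeM; apply/measurable_EFinP; exact: measurableT_comp.
    - move=> x Sx; rewrite -EFinM lee_fin mulrC.
      by apply: ler_pM => //; [rewrite le_max hC|exact: fpsi].
  rewrite ge0_integralZl_EFin; first 1 last.
  - exact mST.
  - by move=> x _; exact: abse_ge0.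
  - by apply/measurable_EFinP; exact: measurableT_comp.
  - exact C0.
  by rewrite lte_mul_pinfty// lee_fin.
have r_le x : S x -> (`|r x| <= `|psi x|)%R.
  move=> Sx; have [Zx|Zx] := pselect (Z x); last by rewrite rE.
  by rewrite r0E ?normr0//; case.
have ia1 : (@lebesgue_measure R).-integrable setT (a (pos r)).
  apply: (ifin _ mpr (pos0 r) _ ma1 E1) => x Sx.
  exact: le_trans (pos_le r x) (r_le x Sx).
have ia2 : (@lebesgue_measure R).-integrable setT (a (pos (fun x => - r x)%R)).
  apply: (ifin _ mnr (pos0 _) _ ma2 E2) => x Sx; apply: le_trans (pos_le _ x) _.
  by rewrite normrN; exact: r_le.
rewrite -(integralB measurableT ia1 ia2).
have [N0 [mN0 N00 lN]] := level_null mZ Z0.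
symmetry; apply: (integral_off_null mN0 N00) => s _ Ns.
have mZD : measurable (Z `&` D s :
    set (caratheodory_type (area_outer m (regular_level S phi s) wL))).
  apply: (borel_caratheodory (@level_weight_measurable R m k G S phi hS cphi s)).
  by apply: measurableI => //; exact: level_set_borel.
transitivity (\int[level_measure S phi s]_(y in D s) (r y)%:E).
  apply: (integral_off_null mZD (lN s Ns)) => x Dx nZ.
  by rewrite rE//; [case: Dx|move=> Zx; apply: nZ].
(* The integral is by definition the difference of those of the two parts, whether or not these are
   finite, so the identity holds at every [s] outside [N0]. *)
rewrite integralE; congr (_ - _); apply: eq_integral => x _.
  by rewrite funeposE -EFin_max.
by rewrite funenegE -EFinN -EFin_max.
Qed.

End coarea.

Theorem theorem3p1 (R : realType) (n k : nat) (G : carnotGroup R n k)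
    (S : set G) (phi : G -> R) (psi : G -> R) :
  (1 < n)%N ->
  compact S -> submanifold 2 n.-1 S -> C1_on S phi ->
  (perimeter_measure S).-integrable S (EFin \o psi) ->
  (\int[perimeter_measure S]_(x in S) (psi x * (metric_norm G (grad_H S phi x))%:num)%:E =
   \int[@lebesgue_measure R]_s
     \int[level_measure S phi s]_(y in S `&` phi @^-1` [set s]) (psi y)%:E)%E.
Proof.
(* Writing [n = m + 2] turns [n.-1] and [n.-2] into [m + 1] and [m], so that slices of
   parametrizations of [S] have the dimension of the level sets. *)
case: n G S phi psi => [|[|m]] // G S phi psi _ cS hS cphi ipsi.
have hS1 x : S x -> exists U (P : 'rV[R]_m.+1 -> G) u, [/\ local_param 1 S U P, U u & x = P u].
  by move=> /hS[U [P [/local_paramW hP [u Uu <-]]]]; exists U, P, u.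
exact: (coarea hS1 (fun U P hP => C1_on_param hS cphi hP) cS ipsi).
Qed.
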